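(* Let $n\ge 1$, let $m_n,\dots,m_1$ be nonnegative integers, and put $m_0=m_{n+1}=0$. The generic decomposition of the band module component $[m_n,\dots,m_1]$ of $A(n)$ is given as follows. (a) If $m_{i+1}=m_i$ (for some $1\le i\le n-1$), then the generic decomposition of $[m_n,\dots,m_1]$ is the same as that of the shorter vector $[m_n,\dots,m_{i+1},m_{i-1},\dots,m_1]$ (for $A(n-1)$) with the repetition of the $i$-th and $(i+1)$-st place added, i.e. each summand $[c_n,\dots,c_{i+1},c_{i-1},\dots,c_1]$ is replaced by $[c_n,\dots,c_{i+1},c_i,c_{i-1},\dots,c_1]$ with $c_i=c_{i+1}$. (b) If $m_i>\max(m_{i-1},m_{i+1})$, then the generic decomposition of $[m_n,\dots,m_1]$ is the same as that of $[m_n,\dots,m_{i+1},\,m_i-|m_{i-1}-m_{i+1}|,\,m_{i-1},\dots,m_1]$, meaning that the number of summands in both decompositions is the same and the summands differ only in the $i$-th place. (c) If $m_i>m_{i-1}=m_{i+1}$, then in the generic decomposition of $[m_n,\dots,m_1]$ there are $m_i-m_{i-1}$ summands $[0,\dots,0,1,0,\dots,0]$ (with $1$ in the $i$-th place), and the remaining summands are the same as the summands in the generic decomposition of $[m_n,\dots,m_{i+1},m_{i+1},m_{i-1},\dots,m_1]$ (with $m_i$ replaced by $m_{i+1}$). (d) For $n=2$, if $\gcd(m_2,m_1)=d$ and $m_i=dn_i$, then the generic decomposition is $[m_2,m_1]=d\,[n_2,n_1]$ ($d$ copies of $[n_2,n_1]$), and $[n_2,n_1]$ is a Schur component. Thus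 $N([m_2,m_1])=d$. (e) For $n=3$, $N([m_3,m_2,m_1])=\gcd(m_2,|m_3-m_1|)$.
   Context: Let $K$ be a field of characteristic $0$. The quiver $Q(n)$ has vertices $x_n,\dots,x_0$ and arrows $a_i,b_i:x_i\to x_{i-1}$ for $1\le i\le n$. The algebra $A(n)$ is the path algebra $KQ(n)$ modulo the two-sided ideal generated by $a_ia_{i+1}$ and $b_ib_{i+1}$, $1\le i\le n-1$ (composition of maps: $a_{i+1}$ first). A representation of dimension vector $\beta=(\beta_n,\dots,\beta_0)$ consists of spaces $F_i$ with $\dim F_i=\beta_i$ and maps $a_i,b_i:F_i\to F_{i-1}$ with $a_ia_{i+1}=b_ib_{i+1}=0$; $\mathrm{Rep}(A(n),\beta)$ is the affine variety of these. For nonnegative integers $m_n,\dots,m_1$ (with $m_0=m_{n+1}=0$), $[m_n,\dots,m_1]$ denotes the dimension vector $\beta$ with $\beta_i=m_i+m_{i+1}$, $0\le i\le n$, and also the corresponding band module component, the irreducible component of $\mathrm{Rep}(A(n),\beta)$ defined by $\operatorname{rank}a_i\le m_i$, $\operatorname{rank}b_i\le m_i$ for all $i$. The $i$-th place of $[m_n,\dots,m_1]$ is the entry $m_i$. The generic decomposition of a band module component $\alpha$ is the sum (multiset) of band module components $\alpha^{(1)},\dots,\alpha^{(r)}$ such that a general module in $\alpha$ is a direct sum of indecomposable modules lying in the components $\alpha^{(1)},\dots,\alpha^{(r)}$; it is written as a sum of dimension vectors. $N(\alpha)=r$ is the number of summands. A component is a Schur component if its general module is indecomposable (so a band module component $\alpha$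 is Schur iff $N(\alpha)=1$).
   Formalization: (e) excludes m_2=0 with m_3,m_1>0, where it fails: [1,0,1]=[1,0,0]+[0,0,1] has N=2, but gcd(0,0)=0. General modules are taken over an algebraic closure of K (over Q, [2] has no generic decomposition). In (d), [n_2,n_1] is Schur for d>0. *)

(* Defs.v *)
From HB Require Import structures.
From mathcomp Require Import all_boot all_order all_algebra.
From mathcomp.multinomials Require Import mpoly.

Set Implicit Arguments.
Unset Strict Implicit.
Unset Printing Implicit Defensive.

Import GRing.Theory.
Local Open Scope ring_scope.

(* The representations of A(n) with dim F_j = beta j; only the values beta j    *)
(* with j <= n matter. Maps are matrices acting on column vectors, and the     *)
(* index i : 'I_n stands for the arrows a_(i+1), b_(i+1) : F_(i+1) -> F_i.      *)
Record rep (L : fieldType) (n : nat) (beta : nat -> nat) := Rep {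
  arr_a : forall i : 'I_n, 'M[L]_(beta i, beta i.+1);
  arr_b : forall i : 'I_n, 'M[L]_(beta i, beta i.+1);
  arr_aa0 : forall (i : nat) (lt_i1n : (i.+1 < n)%N),
    arr_a (Ordinal (ltnW lt_i1n)) *m arr_a (Ordinal lt_i1n) = 0;
  arr_bb0 : forall (i : nat) (lt_i1n : (i.+1 < n)%N),
    arr_b (Ordinal (ltnW lt_i1n)) *m arr_b (Ordinal lt_i1n) = 0
}.

Section Modules.

Variables (L : fieldType) (n : nat).

Definition rep_hom (beta gamma : nat -> nat) (M : rep L n beta)
    (N : rep L n gamma) (phi : forall j : nat, 'M[L]_(gamma j, beta j)) : Prop :=
  forall i : 'I_n,
    phi i *m arr_a M i = arr_a N i *m phi i.+1 /\
    phi i *m arr_b M i = arr_b N i *m phi i.+1.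

Definition rep_iso (beta gamma : nat -> nat) (M : rep L n beta)
    (N : rep L n gamma) : Prop :=
  exists phi : forall j : nat, 'M[L]_(gamma j, beta j),
  exists psi : forall j : nat, 'M[L]_(beta j, gamma j),
    rep_hom M N phi /\
    forall j : nat, (j <= n)%N ->
      psi j *m phi j = 1%:M /\ phi j *m psi j = 1%:M.

Definition rep_zero (beta : nat -> nat) (M : rep L n beta) : Prop :=
  forall j : nat, (j <= n)%N -> beta j = 0%N.

Section DirectSum.

Variables (beta gamma : nat -> nat) (M : rep L n beta) (N : rep L n gamma).

Let beta_gamma (j : nat) : nat := (beta j + gamma j)%N.

Let sum_a (i : 'I_n) : 'M[L]_(beta_gamma i, beta_gamma i.+1) :=
  block_mx (arr_a M i) 0 0 (arr_a N i).

Let sum_b (i : 'I_n) : 'M[L]_(beta_gamma i, beta_gamma i.+1) :=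
  block_mx (arr_b M i) 0 0 (arr_b N i).

Fact sum_aa0 (i : nat) (lt_i1n : (i.+1 < n)%N) :
  sum_a (Ordinal (ltnW lt_i1n)) *m sum_a (Ordinal lt_i1n) = 0.
Proof.
by rewrite /sum_a mulmx_block !arr_aa0 !(mul0mx, mulmx0) !addr0 block_mx0.
Qed.

Fact sum_bb0 (i : nat) (lt_i1n : (i.+1 < n)%N) :
  sum_b (Ordinal (ltnW lt_i1n)) *m sum_b (Ordinal lt_i1n) = 0.
Proof.
by rewrite /sum_b mulmx_block !arr_bb0 !(mul0mx, mulmx0) !addr0 block_mx0.
Qed.

Definition rep_sum : rep L n (fun j => (beta j + gamma j)%N) :=
  Rep sum_aa0 sum_bb0.

End DirectSum.

Definition indecomposable (beta : nat -> nat) (M : rep L n beta) : Prop :=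
  ~ rep_zero M /\
  forall (beta1 beta2 : nat -> nat) (M1 : rep L n beta1) (M2 : rep L n beta2),
    rep_iso M (rep_sum M1 M2) -> rep_zero M1 \/ rep_zero M2.

End Modules.

(* The vector [m_n, ..., m_1] is the tuple m = (m_1, ..., m_n), in increasing   *)
(* order of the places; place m i is m_i, including m_0 = m_(n+1) = 0.          *)
Definition place (n : nat) (m : n.-tuple nat) (i : nat) : nat :=
  nth 0%N (0%N :: m) i.

Definition band_dim (n : nat) (m : n.-tuple nat) (i : nat) : nat :=
  (place m i + place m i.+1)%N.

Definition band_component (L : fieldType) (n : nat) (m : n.-tuple nat)
    (M : rep L n (band_dim m)) : Prop :=
  forall i : 'I_n,
    (\rank (arr_a M i) <= place m i.+1)%N /\
    (\rank (arr_b M i) <= place m i.+1)%N.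

(* The matrix entries: (true, (i; (r, s))) is the (r, s) entry of a_(i+1), and  *)
(* (false, (i; (r, s))) that of b_(i+1).                                        *)
Definition coord (n : nat) (beta : nat -> nat) : finType :=
  (bool * {i : 'I_n & ('I_(beta i) * 'I_(beta i.+1))%type})%type.

Definition coord_val (L : fieldType) (n : nat) (beta : nat -> nat)
    (M : rep L n beta) (c : coord n beta) : L :=
  let: (r, s) := tagged c.2 in
  if c.1 then arr_a M (tag c.2) r s else arr_b M (tag c.2) r s.

Section Generic.

Variables (K : fieldType) (L : closedFieldType) (iota : {rmorphism K -> L}).

Definition rep_eval (n : nat) (beta : nat -> nat)
    (f : {mpoly K[#|coord n beta|]}) (M : rep L n beta) : L :=
  mmap iota (fun k => coord_val M (enum_val k)) f.

(* The open sets are defined over K, but the modules tested are those over an *)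
(* algebraic closure L of K: with modules over K only, the component [2] of    *)
(* A(1) has no generic decomposition when K is the field of rationals. Since   *)
(* the component is irreducible, it is enough to consider nonempty principal   *)
(* open subsets f != 0.                                                        *)
Definition general (n : nat) (m : n.-tuple nat)
    (P : rep L n (band_dim m) -> Prop) : Prop :=
  exists f : {mpoly K[#|coord n (band_dim m)|]},
    (exists M, band_component M /\ rep_eval f M != 0) /\
    (forall M, band_component M -> rep_eval f M != 0 -> P M).

Fixpoint decomposes_as (n : nat) (D : seq (n.-tuple nat))
    (beta : nat -> nat) (M : rep L n beta) : Prop :=
  match D with
  | [::] => rep_zero M
  | c :: D' =>
      exists (N : rep L n (band_dim c)) (gamma : nat -> nat)
             (M' : rep L n gamma),
        [/\ band_component N, indecomposable N,
            rep_iso M (rep_sum N M') & decomposes_as D' M']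
  end.

(* The sequence D represents a multiset of band module components.             *)
Definition generic_decomposition (n : nat) (m : n.-tuple nat)
    (D : seq (n.-tuple nat)) : Prop :=
  general (fun M : rep L n (band_dim m) => decomposes_as D M).

Definition num_summands (n : nat) (m : n.-tuple nat) (r : nat) : Prop :=
  exists2 D, generic_decomposition m D & size D = r.

Definition schur_component (n : nat) (m : n.-tuple nat) : Prop :=
  general (fun M : rep L n (band_dim m) => indecomposable M).

End Generic.

Definition set_place (n : nat) (m : n.-tuple nat) (i v : nat) : n.-tuple nat :=
  [tuple (if j.+1 == i then v else place m j.+1) | j < n].

Definition del_place (n : nat) (m : n.+1.-tuple nat) (i : nat) : n.-tuple nat :=
  [tuple place m (if (j.+1 < i)%N then j.+1 else j.+2) | j < n].

(* The old i-th place is moved to place i.+1 and copied to place i.            *)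
Definition dup_place (n : nat) (c : n.-tuple nat) (i : nat) : n.+1.-tuple nat :=
  [tuple place c (if (j.+1 <= i)%N then j.+1 else j) | j < n.+1].

Definition unit_place (n : nat) (i : nat) : n.-tuple nat :=
  [tuple nat_of_bool (j.+1 == i) | j < n].

(* Main.v *)
Require Import Defs.
From HB Require Import structures.
From mathcomp Require Import all_boot all_order all_algebra.
From mathcomp.multinomials Require Import mpoly.
From mathcomp Require Import zify.

(* A module over A(n) is changed near one space F_i by moves which carry direct
   sums to direct sums and back, hence decompositions to decompositions.
   If m_(i+1) <= m_i, then a general module has F_i -> F_(i-1)^2 injective; the
   pair (F_i, F_(i-1)) is replaced by (F_(i-1), coker (F_i -> F_(i-1)^2)), which
   turns m_i into m_i + m_(i-1) - m_(i+1). The inverse move exists if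
   m_(i-1) <= m_i. If m_(i+1) = m_i, then F_i is recovered from the composites
   a_i b_(i+1) and b_i a_(i+1), and can be deleted. If
   m_(i-1) = m_(i+1) = p < m_i, then the composites of three alternating arrows
   through F_i and F_(i-1) have rank p and split off a summand whose complement
   is a pair of square matrices of size m_i - p, which is generically
   diagonalizable: the determinant of the Hankel matrix of the traces of its
   powers is its discriminant.
   All these constructions are rational in the entries of the module and in
   auxiliary parameters. As K is infinite, the parameters can be chosen in K, so
   that a nonempty open condition on the small module pulls back to one on the
   large module which is still defined over K. *)

Set Implicit Arguments.
Unset Strict Implicit.
Unset Printing Implicit Defensive.
Import GRing.Theory.
Local Open Scope ring_scope.

(** A move determines the new module only up to isomorphism, whereas an open condition on it is a
    polynomial in matrix entries. Complements and bases are therefore supplied by auxiliary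
    parameters, and the transferred condition is rational in parameters and entries. Two facts are
    needed: on a principal open set a decomposition of the new module lifts to the old one, and some
    module in that set is sent into the given open subset. For the second, the given condition must
    hold together with the rank conditions that make the move invertible. This is where
    irreducibility of the band component enters; it comes from a rational parametrization of the
    component. Consecutive arrows with equal labels compose to zero, so the composites that serve as
    new arrows have alternating labels, which dictates every exchange of the two families. No
    functor is constructed: it is enough that morphisms extend along the relation between old and
    new module in both directions, and that the identity extends only to the identity. *)

Local Notation block0E := (mulmx_block, mul0mx, mulmx0, addr0, add0r).

(** * Graded representations *)

Section IdentityMatrices.
Variable F : fieldType.

(* Used to cast along a propositional equality p = q. *)
Definition idm p q : 'M[F]_(p, q) := pid_mx p.

Lemma idm1 p : idm p p = 1%:M.
Proof. exact: pid_mx_1. Qed.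

Lemma idmK p q : p = q -> idm p q *m idm q p = 1%:M.
Proof. by move=> ->; rewrite idm1 mulmx1. Qed.

(** The cast is meaningful when the dimensions agree; otherwise it truncates or pads by zeros, which
    spares dependent equality proofs in the types. *)
Definition sw p q p' q' (W : 'M[F]_(p', q')) : 'M[F]_(p, q) :=
  idm p p' *m W *m idm q' q.

Lemma sw_id p q (W : 'M[F]_(p, q)) : sw p q W = W.
Proof. by rewrite /sw !idm1 mul1mx mulmx1. Qed.

Lemma sw0 p q p' q' : sw p q (0 : 'M[F]_(p', q')) = 0.
Proof. by rewrite /sw mulmx0 mul0mx. Qed.

Lemma sw_mul p q r p' q' r' (W : 'M[F]_(p', q')) (W' : 'M[F]_(q', r')) :
  q = q' -> sw p q W *m sw q r W' = sw p r (W *m W').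
Proof.
by move=> ->; rewrite /sw !mulmxA -[_ *m W *m _ *m _]mulmxA idm1 !mulmx1.
Qed.

Lemma sw1 p q : p = q -> sw p p (1%:M : 'M[F]_q) = 1%:M.
Proof. by move=> ->; rewrite sw_id. Qed.

Lemma rank_sw p q p' q' (W : 'M[F]_(p', q')) :
  p = p' -> q = q' -> \rank (sw p q W) = \rank W.
Proof. by move=> -> ->; rewrite sw_id. Qed.

Lemma sw_sw p q p1 q1 p2 q2 (W : 'M[F]_(p2, q2)) :
  p1 = p2 -> q1 = q2 -> sw p q (sw p1 q1 W) = sw p q W.
Proof. by move=> -> ->; rewrite sw_id. Qed.

Lemma idm_sw p q p' q' (W : 'M[F]_(p', q')) :
  p = p' -> idm p' p *m sw p q W = W *m idm q' q.
Proof. by move=> ->; rewrite /sw idm1 !mul1mx. Qed.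

Lemma sw_idm p q p' q' (W : 'M[F]_(p', q')) :
  q = q' -> sw p q W *m idm q q' = idm p p' *m W.
Proof. by move=> ->; rewrite /sw idm1 !mulmx1. Qed.

Lemma sw_block p1 p2 q1 q2 p1' p2' q1' q2'
    (W1 : 'M[F]_(p1', q1')) (W2 : 'M[F]_(p2', q2')) :
  p1 = p1' -> p2 = p2' -> q1 = q1' -> q2 = q2' ->
  sw (p1 + p2) (q1 + q2) (block_mx W1 0 0 W2)
    = block_mx (sw p1 q1 W1) 0 0 (sw p2 q2 W2).
Proof. by move=> -> -> -> ->; rewrite !sw_id. Qed.

Lemma mulmx1_dim m n (A : 'M[F]_(m, n)) (B : 'M[F]_(n, m)) :
  A *m B = 1%:M -> B *m A = 1%:M -> m = n.
Proof.
move=> AB BA; have := mulmx1_min AB; have := mulmx1_min BA.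
by move=> h1 h2; apply/eqP; rewrite eqn_leq h1 h2.
Qed.

Lemma mulmx1C_dim m n (A : 'M[F]_(m, n)) (B : 'M[F]_(n, m)) :
  m = n -> A *m B = 1%:M -> B *m A = 1%:M.
Proof. by move=> e; subst n; apply: mulmx1C. Qed.

Lemma rank_lmul1 m n p (A : 'M[F]_(m, n)) (B : 'M[F]_(n, m)) (W : 'M[F]_(n, p)) :
  B *m A *m W = W -> (\rank W <= \rank (A *m W))%N.
Proof. by move=> e; rewrite -{1}e -mulmxA mxrankM_maxr. Qed.

End IdentityMatrices.

Section Objects.
Variable F : fieldType.

(* Indexing by all of nat spares the moves any case analysis at the two ends *)
(* of the quiver. *)
Record obj := Obj {
  dm : nat -> nat;
  ar : bool -> forall j, 'M[F]_(dm j, dm j.+1);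
  ar0 : forall s j, ar s j *m ar s j.+1 = 0
}.

Definition ohom X Y (f : forall j, 'M[F]_(dm Y j, dm X j)) : Prop :=
  forall s j, f j *m ar X s j = ar Y s j *m f j.+1.

Definition iso X Y : Prop :=
  exists f : forall j, 'M[F]_(dm Y j, dm X j),
  exists g : forall j, 'M[F]_(dm X j, dm Y j),
    [/\ ohom f, forall j, g j *m f j = 1%:M & forall j, f j *m g j = 1%:M].

Definition zero X : Prop := forall j, dm X j = 0%N.

Lemma iso_refl X : iso X X.
Proof.
exists (fun j => 1%:M), (fun j => 1%:M); split=> [s j|j|j]; rewrite ?mulmx1 //.
by rewrite mul1mx.
Qed.

Lemma ohom_inv X Y (f : forall j, 'M[F]_(dm Y j, dm X j)) (g : forall j, 'M[F]_(dm X j, dm Y j)) :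
  ohom f -> (forall j, g j *m f j = 1%:M) -> (forall j, f j *m g j = 1%:M) -> ohom g.
Proof.
move=> hf gf fg s j; have := congr1 (fun W => g j *m W *m g j.+1) (hf s j).
by rewrite !mulmxA gf mul1mx -!mulmxA fg mulmx1.
Qed.

Lemma iso_sym X Y : iso X Y -> iso Y X.
Proof.
by move=> [f [g [hf gf fg]]]; exists g, f; split=> //; apply: ohom_inv hf gf fg.
Qed.

Lemma iso_trans Y X Z : iso X Y -> iso Y Z -> iso X Z.
Proof.
move=> [f [g [hf gf fg]]] [f' [g' [hf' gf' fg']]].
exists (fun j => f' j *m f j), (fun j => g j *m g' j); split.
- by move=> s j; rewrite -mulmxA hf mulmxA hf' -mulmxA.
- by move=> j; rewrite -mulmxA (mulmxA (g' j)) gf' mul1mx gf.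
- by move=> j; rewrite -mulmxA (mulmxA (f j)) fg mul1mx fg'.
Qed.

Lemma iso_dim X Y : iso X Y -> forall j, dm X j = dm Y j.
Proof. by move=> [f [g [_ gf fg]]] j; apply: mulmx1_dim (gf j) (fg j). Qed.

Lemma iso_rank X Y : iso X Y -> forall s j, \rank (ar X s j) = \rank (ar Y s j).
Proof.
move=> XY s j.
suff le X' Y' : iso X' Y' -> (\rank (ar X' s j) <= \rank (ar Y' s j))%N.
  by apply/eqP; rewrite eqn_leq !le //; apply: iso_sym.
move=> [f [g [hf gf _]]]; rewrite -[ar X' s j]mul1mx -gf -mulmxA hf.
by apply: leq_trans (mxrankM_maxr _ _) _; apply: mxrankM_maxl.
Qed.

Section Sum.
Variables X Y : obj.

Let sum_ar s j : 'M[F]_(dm X j + dm Y j, dm X j.+1 + dm Y j.+1) :=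
  block_mx (ar X s j) 0 0 (ar Y s j).

Fact sum_ar0 s j : sum_ar s j *m sum_ar s j.+1 = 0.
Proof. by rewrite mulmx_block !ar0 !(mul0mx, mulmx0, addr0) block_mx0. Qed.

Definition osum := Obj sum_ar0.

End Sum.

Lemma osum_iso X X' Y Y' : iso X X' -> iso Y Y' -> iso (osum X Y) (osum X' Y').
Proof.
move=> [f [g [hf gf fg]]] [f' [g' [hf' gf' fg']]].
exists (fun j => block_mx (f j) 0 0 (f' j)), (fun j => block_mx (g j) 0 0 (g' j)).
split=> [s j|j|j] /=; rewrite !block0E.
- by rewrite hf hf'.
- by rewrite gf gf' -scalar_mx_block.
- by rewrite fg fg' -scalar_mx_block.
Qed.

Definition oindec X : Prop :=
  ~ zero X /\ forall X1 X2, iso X (osum X1 X2) -> zero X1 \/ zero X2.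

Lemma rank_osum X Y s j :
  \rank (ar (osum X Y) s j) = (\rank (ar X s j) + \rank (ar Y s j))%N.
Proof. exact: rank_diag_block_mx. Qed.

Lemma iso_zero X Y : iso X Y -> zero X -> zero Y.
Proof. by move=> /iso_dim e z j; rewrite -e. Qed.

Definition oband (c : nat -> nat) X : Prop :=
  (forall j, dm X j = (c j + c j.+1)%N) /\
  (forall s j, (\rank (ar X s j) <= c j.+1)%N).

Lemma iso_oband c X Y : iso X Y -> oband c X -> oband c Y.
Proof.
move=> e [d r]; split=> [j|s j]; first by rewrite -(iso_dim e).
by rewrite -(iso_rank e).
Qed.

Lemma iso_oindec X Y : iso X Y -> oindec X -> oindec Y.
Proof.
move=> e [nz ind]; split=> [z|Y1 Y2 e']; first by apply/nz/(iso_zero (iso_sym e)).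
by apply/ind/(iso_trans e).
Qed.

(* Place i of a tuple corresponds to index i.+2: the two spaces and the arrow *)
(* below F_0 are zero, so that every move has a lower neighbourhood. *)
Definition pl n (c : n.-tuple nat) (j : nat) : nat := place c (j - 2).

(** [P] carries a side condition on each summand. Deletion needs [exactP], because the dimension of
    a restored space is a sum of ranks. *)
Fixpoint odec (P : forall n, n.-tuple nat -> obj -> Prop) n (D : seq (n.-tuple nat)) X : Prop :=
  match D with
  | [::] => zero X
  | c :: D' => exists N X',
      [/\ oband (pl c) N /\ P n c N, oindec N, iso X (osum N X') & odec P D' X']
  end.

Lemma iso_odec P n (D : seq (n.-tuple nat)) X Y :
  iso X Y -> odec P D X -> odec P D Y.
Proof.
case: D => [|c D] e /=; first exact: iso_zero.
move=> [N [X' [b i eX d]]]; exists N, X'; split=> //.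
exact: iso_trans (iso_sym e) eX.
Qed.

Definition noP n (c : n.-tuple nat) (X : obj) := True.
Definition exactP k n (c : n.-tuple nat) X :=
  forall s, \rank (ar X s k) = pl c k.+1.

Lemma odec_rank P n (D : seq (n.-tuple nat)) X s j :
  odec P D X -> (\rank (ar X s j) <= \sum_(c <- D) pl c j.+1)%N.
Proof.
elim: D X => [|c D IH] X /=.
  move=> z; rewrite big_nil; apply: leq_trans (rank_leq_row _) _; by rewrite z.
move=> [N [X' [[[_ r] _] _ e d]]]; rewrite big_cons (iso_rank e) rank_osum.
exact: leq_add (r s j) (IH _ d).
Qed.

Lemma odec_dim P n (D : seq (n.-tuple nat)) X j :
  odec P D X -> dm X j = (\sum_(c <- D) pl c j + \sum_(c <- D) pl c j.+1)%N.
Proof.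
elim: D X => [|c D IH] X /=; first by rewrite !big_nil => ->.
move=> [N [X' [[[d _] _] _ e dX]]]; rewrite !big_cons (iso_dim e) /= d (IH _ dX).
by rewrite addnACA.
Qed.

(** Ranks add up over a direct sum and are bounded summand by summand, so a total equal to the sum
    of the bounds forces equality in every summand. *)
Lemma odec_exact k n (D : seq (n.-tuple nat)) X :
  odec noP D X -> (forall s, \rank (ar X s k) = \sum_(c <- D) pl c k.+1)%N ->
  odec (exactP k) D X.
Proof.
elim: D X => [|c D IH] X //=.
move=> [N [X' [[[d r] _] i e dX]]] ex; exists N, X'.
have rN s : \rank (ar N s k) = pl c k.+1 /\
    \rank (ar X' s k) = \sum_(c <- D) pl c k.+1.
  have := ex s; rewrite big_cons (iso_rank e) rank_osum => /eqP.
  have := r s k; have := odec_rank s k dX; move: (\rank _) => a.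
  move: (\rank _) (pl _ _) (\sum_(_ <- _) _)%N => b u v; lia.
split=> //; first by split=> // s; case: (rN s).
by apply: IH => // s; case: (rN s).
Qed.

End Objects.

(** * Lifting decompositions along a relation between objects *)

Section Transfer.
Variables (F : fieldType) (Rl : obj F -> obj F -> Prop) (G : obj F -> Prop).

(** [G] describes the range of the move. As it passes to summands, [Y1] and [Y2] have preimages; by
    additivity their sum is related to [osum Y1 Y2], and uniqueness up to isomorphism identifies it
    with [X]. *)
Lemma lift_sum
  (RE : forall Y, G Y -> exists X, Rl X Y)
  (RG : forall X Y, Rl X Y -> G Y)
  (GS : forall Y Y1 Y2, iso Y (osum Y1 Y2) -> G Y -> G Y1 /\ G Y2)
  (RA : forall X1 X2 Y1 Y2, Rl X1 Y1 -> Rl X2 Y2 -> Rl (osum X1 X2) (osum Y1 Y2))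
  (RU : forall X X' Y Y', Rl X Y -> Rl X' Y' -> iso Y Y' -> iso X X') X Y Y1 Y2 :
  Rl X Y -> iso Y (osum Y1 Y2) ->
  exists X1 X2, [/\ iso X (osum X1 X2), Rl X1 Y1 & Rl X2 Y2].
Proof.
move=> r e; have [g1 g2] := GS _ _ _ e (RG _ _ r).
have [X1 r1] := RE _ g1; have [X2 r2] := RE _ g2; exists X1, X2; split=> //.
exact: RU r (RA _ _ _ _ r1 r2) e.
Qed.

Lemma odec_transfer
  (lift : forall X Y Y1 Y2, Rl X Y -> iso Y (osum Y1 Y2) ->
    exists X1 X2, [/\ iso X (osum X1 X2), Rl X1 Y1 & Rl X2 Y2])
  (lower : forall X Y X1 X2, Rl X Y -> iso X (osum X1 X2) ->
    exists Y1 Y2, [/\ iso Y (osum Y1 Y2), Rl X1 Y1 & Rl X2 Y2])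
  (Rz : forall X Y, Rl X Y -> (zero X <-> zero Y))
  P n n' (f : n.-tuple nat -> n'.-tuple nat)
  (dims : forall X Y (c : n.-tuple nat), Rl X Y -> oband (pl c) Y -> P n c Y -> oband (pl (f c)) X)
  X Y (D : seq (n.-tuple nat)) :
  Rl X Y -> odec P D Y -> odec (@noP F) [seq f c | c <- D] X.
Proof.
elim: D X Y => [|c D IH] X Y r /=; first by move=> z; apply/(Rz _ _ r).
move=> [N [Y' [[b p] [nz ind] e d]]].
have [X1 [X2 [eX r1 r2]]] := lift _ _ _ _ r e.
exists X1, X2; split=> //; last exact: IH r2 d.
- by split=> //; apply: dims r1 b p.
- split=> [z|U1 U2 eU]; first by apply: nz; apply/(Rz _ _ r1).
  have [V1 [V2 [eV s1 s2]]] := lower _ _ _ _ r1 eU.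
  by case: (ind _ _ eV) => z; [left; apply/(Rz _ _ s1) | right; apply/(Rz _ _ s2)].
Qed.

End Transfer.

(** * Representations of A(n) as graded objects, and back *)

Section Padding.
Variable F : fieldType.

Definition arr n beta (M : rep F n beta) (s : bool) (i : 'I_n) : 'M[F]_(beta i, beta i.+1) :=
  if s then arr_a M i else arr_b M i.

Section Families.
Variables (n : nat) (beta : nat -> nat).
Implicit Type W : bool -> forall i : 'I_n, 'M[F]_(beta i, beta i.+1).

Definition tarr W s j : 'M[F]_(beta j, beta j.+1) :=
  (if (j < n)%N as b return (j < n)%N = b -> 'M[F]_(beta j, beta j.+1)
   then fun h => W s (Ordinal h) else fun=> 0) erefl.

Lemma tarr_lt W s j (h : (j < n)%N) : tarr W s j = W s (Ordinal h).
Proof.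
rewrite /tarr; move: (erefl (j < n)%N); case: {2 3}(j < n)%N => h'.
  by rewrite (bool_irrelevance h h').
by exfalso; move: h'; rewrite h.
Qed.

Lemma tarr_ord W s (i : 'I_n) : tarr W s i = W s i.
Proof. by case: i => i h; rewrite (tarr_lt _ _ h). Qed.

Lemma tarr_out W s j : (n <= j)%N -> tarr W s j = 0.
Proof.
move=> le; rewrite /tarr; move: (erefl (j < n)%N); case: {2 3}(j < n)%N => // h.
by exfalso; move: h; rewrite ltnNge le.
Qed.

Definition pdim j := if j is j'.+2 then if (j' <= n)%N then beta j' else 0%N else 0%N.

Definition pfam W s j : 'M[F]_(pdim j, pdim j.+1) :=
  match j return 'M[F]_(pdim j, pdim j.+1) with
  | j'.+2 => sw (pdim j'.+2) (pdim j'.+3) (tarr W s j')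
  | _ => 0
  end.

Lemma pdimE j : (j <= n)%N -> pdim j.+2 = beta j.
Proof. by move=> /= ->. Qed.

Lemma pdim_out j : (n < j)%N -> pdim j.+2 = 0%N.
Proof. by move=> h; rewrite /= leqNgt h. Qed.

Lemma pfam_ext W W' : (forall s i, W s i = W' s i) -> forall s j, pfam W s j = pfam W' s j.
Proof.
move=> e s [|[|j]] //=; congr (sw _ _ _).
by have [h|h] := ltnP j n; [rewrite !(tarr_lt _ _ h) e | rewrite !tarr_out].
Qed.

End Families.

Lemma tarr0 n beta (M : rep F n beta) s j : tarr (arr M) s j *m tarr (arr M) s j.+1 = 0.
Proof.
have [h|h] := ltnP j.+1 n; last by rewrite (tarr_out _ _ h) mulmx0.
rewrite (tarr_ord (arr M) s (Ordinal (ltnW h))) (tarr_ord (arr M) s (Ordinal h)).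
by case: s; [apply: arr_aa0 | apply: arr_bb0].
Qed.

Lemma pfam0 n beta (M : rep F n beta) s j : pfam (arr M) s j *m pfam (arr M) s j.+1 = 0.
Proof.
case: j => [|[|j]]; rewrite ?mul0mx //=.
have [h|h] := ltnP j n; last first.
  by rewrite (tarr_out _ _ h) sw0 mul0mx.
by rewrite sw_mul ?h // tarr0 sw0.
Qed.

Definition pad n beta (M : rep F n beta) : obj F := Obj (pfam0 M).

Lemma mx0_eq p q (A B : 'M[F]_(p, q)) : (p == 0%N) || (q == 0%N) -> A = B.
Proof.
by case/orP=> /eqP h; subst; rewrite ?(flatmx0 A) ?(flatmx0 B) ?(thinmx0 A) ?(thinmx0 B).
Qed.

Lemma rep_iso_pad n beta gamma (M : rep F n beta) (N : rep F n gamma) :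
  rep_iso M N <-> iso (pad M) (pad N).
Proof.
split=> [[f [g [hf fg]]]|[f [g [hf gf fg]]]].
  pose T b b' (w : forall j, 'M[F]_(b j, b' j)) j : 'M[F]_(pdim n b j, pdim n b' j) :=
    match j with j'.+2 => sw (pdim n b j'.+2) (pdim n b' j'.+2) (w j') | _ => 0 end.
  have TT b b' (w : forall j, 'M[F]_(b j, b' j)) (w' : forall j, 'M[F]_(b' j, b j)) :
      (forall j, (j <= n)%N -> w j *m w' j = 1%:M) -> forall j, T _ _ w j *m T _ _ w' j = 1%:M.
    move=> h [|[|j]] /=; try by apply: mx0_eq.
    have [le|gt] := leqP j n; last by apply: mx0_eq.
    by rewrite sw_mul // h // sw_id.
  exists (T _ _ f), (T _ _ g); split; try by apply: TT => j /fg [].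
  move=> s [|[|j]]; try by apply: mx0_eq.
  have [h|h] := ltnP j n; last by apply: mx0_eq; apply/orP; right; apply/eqP/pdim_out.
  have le : (j <= n)%N by apply: ltnW.
  rewrite /= !sw_mul ?h ?le //; congr (sw _ _ _).
  rewrite (tarr_ord _ s (Ordinal h)) (tarr_ord (arr N) s (Ordinal h)).
  by have [ha hb] := hf (Ordinal h); case: s.
exists (fun j => sw (gamma j) (beta j) (f j.+2)), (fun j => sw (beta j) (gamma j) (g j.+2)).
split=> [i|j le]; last first.
  by rewrite !sw_mul ?gf ?fg ?sw1 /= ?le //.
have h s : sw (gamma i) (beta i) (f i.+2) *m arr M s i = arr N s i *m sw (gamma i.+1) (beta i.+1) (f i.+3).
  have le : (i <= n)%N by apply: ltnW.
  have e1 : arr M s i = sw _ _ (ar (pad M) s i.+2).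
    by rewrite /= sw_sw ?tarr_ord ?sw_id // ?le ?ltn_ord.
  have e2 : arr N s i = sw _ _ (ar (pad N) s i.+2).
    by rewrite /= sw_sw ?tarr_ord ?sw_id // ?le ?ltn_ord.
  by rewrite e1 e2 !sw_mul ?hf // [RHS]/= ?le ?ltn_ord.
by split; [exact: (h true) | exact: (h false)].
Qed.

Lemma zero_pad n beta (M : rep F n beta) : rep_zero M <-> zero (pad M).
Proof.
split=> [z [|[|j]] //=|z j le]; first by case: ifP => // /z.
by have := z j.+2; rewrite /= le.
Qed.

Lemma pad_sum n beta gamma (M : rep F n beta) (N : rep F n gamma) :
  iso (pad (rep_sum M N)) (osum (pad M) (pad N)).
Proof.
have d j : pdim n (fun j => (beta j + gamma j)%N) j = (pdim n beta j + pdim n gamma j)%N.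
  by case: j => [|[|j]] //=; case: ifP.
exists (fun j => idm F _ _), (fun j => idm F _ _); split=> [s j|j|j]; [|by apply: idmK; exact: d|by apply: idmK; exact/esym/d].
case: j => [|[|j]]; try by apply: mx0_eq.
have [h|h] := ltnP j n; last first.
  by apply: mx0_eq; apply/orP; right; apply/eqP/pdim_out.
have le : (j <= n)%N by apply: ltnW.
rewrite /= -sw_block ?h ?le // idm_sw ?le // sw_idm ?h //.
rewrite !(tarr_ord _ s (Ordinal h)).
have e : arr (rep_sum M N) s (Ordinal h) = block_mx (arr M s (Ordinal h)) 0 0 (arr N s (Ordinal h)).
  by case: s.
by rewrite -e (idm1 F (beta j.+1 + gamma j.+1)) (idm1 F (beta j + gamma j)) mulmx1 mul1mx.
Qed.

Section Unpad.
Variables (n : nat) (beta : nat -> nat) (X : obj F).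
Hypothesis dX : forall j, dm X j = pdim n beta j.

Let ua s (i : 'I_n) : 'M[F]_(beta i, beta i.+1) := sw _ _ (ar X s i.+2).

Let ua0 s (i : nat) (lt : (i.+1 < n)%N) : ua s (Ordinal (ltnW lt)) *m ua s (Ordinal lt) = 0.
Proof. by rewrite /ua sw_mul ?ar0 ?sw0 //= dX pdimE // ltnW. Qed.

Definition unpad : rep F n beta := Rep (ua0 true) (ua0 false).

Lemma arr_unpad s i : arr unpad s i = sw _ _ (ar X s i.+2).
Proof. by case: s. Qed.

Lemma pad_unpad : iso (pad unpad) X.
Proof.
exists (fun j => idm F _ _), (fun j => idm F _ _); split=> [s j|j|j]; [|by apply: idmK; exact/esym/dX|by apply: idmK; exact: dX].
case: j => [|[|j]]; try by apply: mx0_eq; rewrite !dX.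
have [h|h] := ltnP j n; last first.
  by apply: mx0_eq; apply/orP; right; apply/eqP/pdim_out.
have le : (j <= n)%N by apply: ltnW.
rewrite [ar (pad _) _ _]/= (tarr_ord _ s (Ordinal h)) arr_unpad sw_sw ?dX //; last 2 first.
- by rewrite pdimE.
- by rewrite pdimE.
by rewrite idm_sw.
Qed.

End Unpad.

(** A direct summand of a padded object vanishes outside the degrees of the quiver, so every
    splitting of the padded object is itself the padding of a splitting. *)
Lemma indec_pad n beta (M : rep F n beta) : indecomposable M <-> oindec (pad M).
Proof.
split=> [[nz ind]|[nz ind]]; split; try by move=> /zero_pad.
- move=> X1 X2 e.
  pose b (X : obj F) j := dm X j.+2.
  have d X : (exists Y, iso (osum X Y) (pad M) \/ iso (osum Y X) (pad M)) ->
      forall j, dm X j = pdim n (b X) j.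
    move=> [Y eY].
    have {eY} eY j : exists k, dm (pad M) j = (dm X j + k)%N.
      by case: eY => /iso_dim /(_ j) <-; exists (dm Y j) => //=; rewrite addnC.
    case=> [|[|j]] /=; try by case: (eY 0%N) => k /= /esym/eqP; rewrite addn_eq0 => /andP[/eqP].
      by case: (eY 1%N) => k /= /esym/eqP; rewrite addn_eq0 => /andP[/eqP].
    case: (eY j.+2) => k /=; case: ifP => // _.
    by move/esym/eqP; rewrite addn_eq0 => /andP[/eqP].
  have d1 : forall j, dm X1 j = pdim n (b X1) j.
    by apply: d; exists X2; left; apply: iso_sym.
  have d2 : forall j, dm X2 j = pdim n (b X2) j.
    by apply: d; exists X1; right; apply: iso_sym.
  have : rep_iso M (rep_sum (unpad d1) (unpad d2)).
    apply/rep_iso_pad/(iso_trans e)/iso_sym/(iso_trans (pad_sum _ _)).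
    by apply: osum_iso; apply: pad_unpad.
  move=> /ind [] /zero_pad z; [left|right]; exact: iso_zero (pad_unpad _) z.
- move=> b1 b2 M1 M2 /rep_iso_pad e.
  by case: (ind _ _ (iso_trans e (pad_sum M1 M2))) => /zero_pad; [left|right].
Qed.

End Padding.

Section Decompositions.
Variable F : fieldType.

Lemma place_out n (m : n.-tuple nat) i : (n < i)%N -> place m i = 0%N.
Proof. by case: i => // i h; rewrite /place nth_default //= size_tuple. Qed.

Lemma plE n (m : n.-tuple nat) j : pl m j.+2 = place m j.
Proof. by rewrite /pl !subSS subn0. Qed.

Lemma pdim_band n (c : n.-tuple nat) j :
  pdim n (band_dim c) j = (pl c j + pl c j.+1)%N.
Proof.
case: j => [|[|j]]; rewrite ?plE //=; case: leqP => // h.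
by rewrite !place_out // ltnW.
Qed.

Lemma pad_oband n (c : n.-tuple nat) (M : rep F n (band_dim c)) :
  band_component M <-> oband (pl c) (pad M).
Proof.
have H s (i : 'I_n) : \rank (ar (pad M) s i.+2) = \rank (arr M s i).
  rewrite /= tarr_ord rank_sw //; first by rewrite ltnW.
  by rewrite ltn_ord.
split=> [b|[_ r] i].
  split=> [|s [|[|j]]]; first exact: pdim_band.
  - by apply: leq_trans (rank_leq_row _) _.
  - by apply: leq_trans (rank_leq_row _) _.
  have [h|h] := ltnP j n; last by rewrite /= tarr_out // sw0 mxrank0.
  rewrite (H s (Ordinal h)) plE; have [ha hb] := b (Ordinal h).
  by case: s.
by have := r true i.+2; have := r false i.+2; rewrite !H !plE.
Qed.

Lemma unpad_dims n beta (M : rep F n beta) (X Y : obj F) :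
  iso (pad M) (osum X Y) ->
  (forall j, dm X j = pdim n (fun j => dm X j.+2) j) /\
  (forall j, dm Y j = pdim n (fun j => dm Y j.+2) j).
Proof.
move/iso_dim=> e.
have H Z : (forall j, (dm Z j <= dm (pad M) j)%N) -> forall j, dm Z j = pdim n (fun j => dm Z j.+2) j.
  move=> h [|[|j]]; try by apply/eqP; rewrite -leqn0; apply: h.
  by have := h j.+2; rewrite /=; case: ifP => // _; rewrite leqn0 => /eqP.
by split; apply: H => j; rewrite e /= ?leq_addr ?leq_addl.
Qed.

Lemma band_unpad n (c : n.-tuple nat) (X : obj F) : oband (pl c) X ->
  exists M : rep F n (band_dim c), band_component M /\ iso (pad M) X.
Proof.
move=> b; have dX j : dm X j = pdim n (band_dim c) j by rewrite pdim_band; case: b.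
exists (unpad dX); have e := pad_unpad dX; split=> //.
by apply/pad_oband; apply: iso_oband b; apply/iso_sym.
Qed.

End Decompositions.

Lemma decomp_odec (F : closedFieldType) n (D : seq (n.-tuple nat)) beta (M : rep F n beta) :
  decomposes_as D M <-> odec (@noP F) D (pad M).
Proof.
elim: D beta M => [|c D IH] beta M /=; first exact: zero_pad.
split=> [[N [gamma [M' [b i e d]]]]|[N [X' [[b _] i e d]]]].
  exists (pad N), (pad M'); split.
  - by split=> //; apply/pad_oband.
  - exact/indec_pad.
  - by apply: iso_trans (pad_sum _ _); apply/rep_iso_pad.
  - exact/IH.
have dN j : dm N j = pdim n (band_dim c) j by rewrite pdim_band; case: b.
have [_ dX'] := unpad_dims e.
exists (unpad dN), (fun j => dm X' j.+2), (unpad dX'); split.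
- by apply/pad_oband; apply: iso_oband b; apply/iso_sym/pad_unpad.
- by apply/indec_pad; apply: iso_oindec i; apply/iso_sym/pad_unpad.
- apply/rep_iso_pad/(iso_trans e)/iso_sym/(iso_trans (pad_sum _ _)).
  by apply: osum_iso; apply: pad_unpad.
- by apply/IH; apply: iso_odec d; apply/iso_sym/pad_unpad.
Qed.

Section Surgery.
Variable F : fieldType.

(* Replacing F_{k+2}, F_{k+3} by spaces of dimensions z, y. *)
Variables (k z y : nat).

Definition srg_dim (d : nat -> nat) j :=
  if j == k.+2 then z else if j == k.+3 then y else d j.

Variables (d : nat -> nat).
Notation fam d := (bool -> forall j, 'M[F]_(d j, d j.+1)).

Definition srg_fam (W : fam d) (q : bool -> 'M[F]_(d k.+1, z))
    (x : bool -> 'M[F]_(z, y)) (p : bool -> 'M[F]_(y, d k.+4)) : fam (srg_dim d) :=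
  fun s j => if j == k.+1 then sw _ _ (q s) else if j == k.+2 then sw _ _ (x s)
    else if j == k.+3 then sw _ _ (p s) else sw _ _ (W s j).

Lemma srg_dim2 : srg_dim d k.+2 = z.
Proof. by rewrite /srg_dim eqxx. Qed.
Lemma srg_dim3 : srg_dim d k.+3 = y.
Proof. by rewrite /srg_dim eqxx ifF //; lia. Qed.
Lemma srg_dimo j : j != k.+2 -> j != k.+3 -> srg_dim d j = d j.
Proof. by rewrite /srg_dim => /negPf-> /negPf->. Qed.

Variables (W : fam d) (q : bool -> 'M[F]_(d k.+1, z))
    (x : bool -> 'M[F]_(z, y)) (p : bool -> 'M[F]_(y, d k.+4)).
Notation N := (srg_fam W q x p).

Lemma srg_fam1 s : N s k.+1 = sw _ _ (q s).
Proof. by rewrite /srg_fam eqxx. Qed.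
Lemma srg_fam2 s : N s k.+2 = sw _ _ (x s).
Proof. by rewrite /srg_fam eqxx ifF //; lia. Qed.
Lemma srg_fam3 s : N s k.+3 = sw _ _ (p s).
Proof. by rewrite /srg_fam eqxx !ifF //; lia. Qed.
Lemma srg_famo s j : j != k.+1 -> j != k.+2 -> j != k.+3 -> N s j = sw _ _ (W s j).
Proof. by rewrite /srg_fam => /negPf-> /negPf-> /negPf->. Qed.

Hypothesis WW : forall s j, W s j *m W s j.+1 = 0.
Hypothesis Wq : forall s, W s k *m q s = 0.
Hypothesis qx : forall s, q s *m x s = 0.
Hypothesis xp : forall s, x s *m p s = 0.
Hypothesis pW : forall s, p s *m W s k.+4 = 0.

Lemma srg0 s j : N s j *m N s j.+1 = 0.
Proof.
have [->|n1] := eqVneq j k.+1.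
  by rewrite srg_fam1 srg_fam2 sw_mul ?qx ?sw0 // srg_dim2.
have [->|n2] := eqVneq j k.+2.
  by rewrite srg_fam2 srg_fam3 sw_mul ?xp ?sw0 // srg_dim3.
have [->|n3] := eqVneq j k.+3.
  rewrite srg_fam3 srg_famo; try lia.
  by rewrite sw_mul ?pW ?sw0 // srg_dimo //; lia.
have [->|n0] := eqVneq j k.
  rewrite srg_famo ?srg_fam1; try lia.
  by rewrite sw_mul ?Wq ?sw0 // srg_dimo //; lia.
rewrite !srg_famo; try lia.
by rewrite sw_mul ?WW ?sw0 // srg_dimo //; lia.
Qed.

End Surgery.

(** * The cokernel move *)

Section Splitting.
Variable F : fieldType.

(** Split exactness of X -> Y + Y -> Z, with retraction [L] and section [R]. The remaining identity,
    that [L] after [R] is zero, follows from these four. *)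
Definition split_eqs x y z (a : bool -> 'M[F]_(y, x)) (C : bool -> 'M[F]_(z, y))
    (L : bool -> 'M[F]_(x, y)) (R : bool -> 'M[F]_(y, z)) : Prop :=
  [/\ L true *m a true + L false *m a false = 1%:M,
      C true *m R true + C false *m R false = 1%:M,
      C true *m a true + C false *m a false = 0 &
      forall s t, R s *m C t = (s == t)%:R%:M - a s *m L t].

Definition colb p q (W : 'M[F]_(p + p, q)) (s : bool) : 'M[F]_(p, q) :=
  if s then usubmx W else dsubmx W.
Definition rowb p q (W : 'M[F]_(q, p + p)) (s : bool) : 'M[F]_(q, p) :=
  if s then lsubmx W else rsubmx W.
Definition bcol p q (w : bool -> 'M[F]_(p, q)) := col_mx (w true) (w false).
Definition brow p q (w : bool -> 'M[F]_(q, p)) := row_mx (w true) (w false).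

Lemma bcolK p q (W : 'M[F]_(p + p, q)) : bcol (colb W) = W.
Proof. exact: vsubmxK. Qed.
Lemma browK p q (W : 'M[F]_(q, p + p)) : brow (rowb W) = W.
Proof. exact: hsubmxK. Qed.

Lemma brow_bcol p q r (A : bool -> 'M[F]_(p, q)) (B : bool -> 'M[F]_(q, r)) :
  brow A *m bcol B = A true *m B true + A false *m B false.
Proof. exact: mul_row_col. Qed.

Lemma split_of_square x y z (a : bool -> 'M[F]_(y, x)) (C : bool -> 'M[F]_(z, y))
    (L : bool -> 'M[F]_(x, y)) (R : bool -> 'M[F]_(y, z)) :
  col_mx (brow L) (brow C) *m row_mx (bcol a) (bcol R) = 1%:M ->
  (x + z = y + y)%N -> split_eqs a C L R.
Proof.
move=> e d; have := mulmx1C_dim d e; move: e.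
rewrite mul_col_row scalar_mx_block !brow_bcol => /eq_block_mx [LE LR CE CR].
rewrite mul_row_col => EL.
split; rewrite ?H // => s t; apply/eqP; rewrite eq_sym subr_eq eq_sym; apply/eqP.
move: EL; rewrite !mul_col_row add_block_mx scalar_mx_block => /eq_block_mx [e1 e2 e3 e4].
by rewrite addrC; case: s; case: t; rewrite ?e1 ?e2 ?e3 ?e4 //= mulr0n raddf0.
Qed.

(** Since a L + R C = 1 and C R = 1, one gets a (L R) = 0, and [a] is injective because L a = 1. *)
Lemma split_square x y z (a : bool -> 'M[F]_(y, x)) (C : bool -> 'M[F]_(z, y))
    (L : bool -> 'M[F]_(x, y)) (R : bool -> 'M[F]_(y, z)) :
  split_eqs a C L R ->
  col_mx (brow L) (brow C) *m row_mx (bcol a) (bcol R) = 1%:M /\ (x + z = y + y)%N.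
Proof.
move=> [La CR Ca RC].
have LR : L true *m R true + L false *m R false = 0.
  have aL s t : a s *m L t = (s == t)%:R%:M - R s *m C t.
    by rewrite RC opprB addrC subrK.
  have aLR s : a s *m (L true *m R true + L false *m R false) = 0.
    rewrite mulmxDr !mulmxA !aL !mulmxBl -!mulmxA addrACA -opprD -mulmxDr CR mulmx1.
    by clear aL; case: s; rewrite /= !mul_scalar_mx !scale1r !scale0r ?addr0 ?add0r subrr.
  by rewrite -[LHS]mul1mx -La mulmxDl -!mulmxA !aLR !mulmx0 addr0.
have e : col_mx (brow L) (brow C) *m row_mx (bcol a) (bcol R) = 1%:M.
  by rewrite mul_col_row !brow_bcol La LR Ca CR -scalar_mx_block.
split=> //; apply: mulmx1_dim e _.
rewrite mul_row_col !mul_col_row.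
have aLRC s t : a s *m L t + R s *m C t = (s == t)%:R%:M by rewrite RC addrC subrK.
by rewrite add_block_mx !aLRC /= !mulr0n !raddf0 -scalar_mx_block.
Qed.

(** A rank factorization works: cancelling the factors of full rank in R (C R) C = R C leaves C R =
    1. *)
Lemma idem_factor p (e : 'M[F]_p) : e *m e = e ->
  exists z (R : 'M[F]_(p, z)) (C : 'M[F]_(z, p)), R *m C = e /\ C *m R = 1%:M.
Proof.
move=> ee; have RC := mulmx_base e.
have [B CB] := row_freeP (row_base_free e); have [B' BR] := row_fullP (col_base_full e).
move: (\rank e) (col_base e) (row_base e) RC B CB B' BR => z R C RC B CB B' BR.
exists z, R, C; split=> //.
have h : R *m (C *m R) *m C = R *m C by rewrite !mulmxA RC -mulmxA RC.
have := congr1 (fun W => B' *m W *m B) h.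
by rewrite !mulmxA BR !mul1mx -!mulmxA CB mulmx1.
Qed.

(** The complement of the image of [E] is the image of the idempotent 1 - E L. *)
Lemma split_complement p x (E : 'M[F]_(p, x)) (L : 'M[F]_(x, p)) : L *m E = 1%:M ->
  exists z (R : 'M[F]_(p, z)) (C : 'M[F]_(z, p)),
    col_mx L C *m row_mx E R = 1%:M /\ row_mx E R *m col_mx L C = 1%:M.
Proof.
move=> LE; pose e := 1%:M - E *m L.
have eE : e *m E = 0 by rewrite mulmxBl mul1mx -mulmxA LE mulmx1 subrr.
have Le : L *m e = 0 by rewrite mulmxBr mulmx1 mulmxA LE mul1mx subrr.
have ee : e *m e = e by rewrite {2}/e mulmxBr mulmx1 mulmxA eE mul0mx subr0.
have [z [R [C [RC CR]]]] := idem_factor ee; exists z, R, C; split.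
  have CE : C *m E = 0 by rewrite -[C]mul1mx -CR -!mulmxA (mulmxA R) RC eE mulmx0.
  have LR : L *m R = 0 by rewrite -[R]mulmx1 -CR (mulmxA R) RC !mulmxA Le mul0mx.
  by rewrite mul_col_row LE LR CE CR -scalar_mx_block.
by rewrite mul_row_col RC addrC subrK.
Qed.

Lemma split_of_L x y (a : bool -> 'M[F]_(y, x)) (L : bool -> 'M[F]_(x, y)) :
  L true *m a true + L false *m a false = 1%:M ->
  exists z (C : bool -> 'M[F]_(z, y)) (R : bool -> 'M[F]_(y, z)), split_eqs a C L R.
Proof.
rewrite -brow_bcol => /split_complement [z [R [C [e e']]]].
exists z, (rowb C), (colb R); apply: split_of_square; first by rewrite browK bcolK.
exact: mulmx1_dim e e'.
Qed.

Lemma split_of_R y z (C : bool -> 'M[F]_(z, y)) (R : bool -> 'M[F]_(y, z)) :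
  C true *m R true + C false *m R false = 1%:M ->
  exists x (a : bool -> 'M[F]_(y, x)) (L : bool -> 'M[F]_(x, y)), split_eqs a C L R.
Proof.
rewrite -brow_bcol => /split_complement [x [a [L [e e']]]].
have d : (z + x = y + y)%N := mulmx1_dim e e'.
exists x, (colb a), (rowb L); apply: split_of_square; last by rewrite addnC.
move: e; rewrite !mul_col_row browK bcolK scalar_mx_block => /eq_block_mx [-> -> -> ->].
by rewrite -scalar_mx_block.
Qed.

End Splitting.

Lemma bool_neqE (t s : bool) : (t != s) = (t == ~~ s).
Proof. by case: t; case: s. Qed.

Section CokernelMove.
Variables (F : fieldType) (k : nat).
Implicit Types M N : obj F.

Lemma override2 (T : nat -> Type) (f : forall j, T j) (x : T k.+2) (y : T k.+3) :
  exists g : forall j, T j, [/\ forall j, j != k.+2 -> j != k.+3 -> g j = f j,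
    g k.+2 = x & g k.+3 = y].
Proof.
exists (dfwith (dfwith f x) y); split=> [j n2 n3||]; last exact: dfwith_in.
  by rewrite !dfwith_out // eq_sym.
by rewrite dfwith_out ?dfwith_in //; lia.
Qed.

(* With X = F_{k+3}, Y = F_{k+2} of M, the module N has Y in degree k+3 and *)
(* Z = coker (X -> Y + Y) in degree k+2; N s k.+2 is the component ~~ s of the *)
(* projection C. The maps L and R split 0 -> X -> Y + Y -> Z -> 0. *)
Record coker_data M N := CokerData {
  th : forall j, 'M[F]_(dm N j, dm M j);
  thi : forall j, 'M[F]_(dm M j, dm N j);
  ta : 'M[F]_(dm N k.+3, dm M k.+2);
  tai : 'M[F]_(dm M k.+2, dm N k.+3);
  spL : bool -> 'M[F]_(dm M k.+3, dm M k.+2);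
  spR : bool -> 'M[F]_(dm M k.+2, dm N k.+2);
  spC : bool -> 'M[F]_(dm N k.+2, dm M k.+2);
  thK : forall j, j != k.+2 -> j != k.+3 -> thi j *m th j = 1%:M;
  thiK : forall j, j != k.+2 -> j != k.+3 -> th j *m thi j = 1%:M;
  taK : tai *m ta = 1%:M;
  taiK : ta *m tai = 1%:M;
  spCE : forall s, spC s = ar N (~~ s) k.+2 *m ta;
  spLa : spL true *m ar M true k.+2 + spL false *m ar M false k.+2 = 1%:M;
  spCR : spC true *m spR true + spC false *m spR false = 1%:M;
  spCa : spC true *m ar M true k.+2 + spC false *m ar M false k.+2 = 0;
  spRC : forall s t, spR s *m spC t = (s == t)%:R%:M - ar M s k.+2 *m spL t;
  ck3 : forall s, ar N s k.+3 *m th k.+4 = ta *m ar M (~~ s) k.+2 *m ar M s k.+3;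
  ck1 : forall s, ar N s k.+1 *m spC s = th k.+1 *m ar M s k.+1;
  cko : forall s j, j != k.+1 -> j != k.+2 -> j != k.+3 ->
    ar N s j *m th j.+1 = th j *m ar M s j
}.

Definition coker_rel M N : Prop := inhabited (coker_data M N).

Section Cancel.
Variables (M N : obj F) (D : coker_data M N).

Lemma cancel_th j p (A B : 'M[F]_(p, dm N j)) : j != k.+2 -> j != k.+3 ->
  A *m th D j = B *m th D j -> A = B.
Proof.
move=> n2 n3 /(congr1 (mulmx^~ (thi D j))).
by rewrite -!mulmxA thiK // !mulmx1.
Qed.

Lemma cancel_C p (A B : 'M[F]_(p, dm N k.+2)) :
  (forall s, A *m spC D s = B *m spC D s) -> A = B.
Proof.
move=> e; rewrite -[A]mulmx1 -[B]mulmx1 -(spCR D) !mulmxDr.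
by rewrite !(mulmxA A) !(mulmxA B) !e.
Qed.

Lemma ck1' s : ar N s k.+1 *m spC D (~~ s) = 0.
Proof. by rewrite spCE negbK mulmxA ar0 mul0mx. Qed.

Lemma cancel_L p (A B : 'M[F]_(dm M k.+3, p)) :
  (forall s, ar M s k.+2 *m A = ar M s k.+2 *m B) -> A = B.
Proof.
by move=> e; rewrite -[A]mul1mx -[B]mul1mx -(spLa D) !mulmxDl -!mulmxA !e.
Qed.

Lemma cancel_thi j p (A B : 'M[F]_(dm M j, p)) : j != k.+2 -> j != k.+3 ->
  th D j *m A = th D j *m B -> A = B.
Proof.
move=> n2 n3 /(congr1 (mulmx (thi D j))).
by rewrite !mulmxA thK // !mul1mx.
Qed.

Lemma ckN s : ar N s k.+2 = spC D (~~ s) *m tai D.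
Proof. by rewrite spCE negbK -mulmxA taiK mulmx1. Qed.

Lemma ck3' s : ar M (~~ s) k.+2 *m ar M s k.+3 = tai D *m ar N s k.+3 *m th D k.+4.
Proof. by rewrite -mulmxA ck3 !mulmxA taK mul1mx. Qed.

End Cancel.

Section Homs.
Variables (M N M' N' : obj F) (D : coker_data M N) (D' : coker_data M' N').

(** Nothing is required of [f k.+3] and [g k.+2]: these are the maps induced on the kernel X and on
    the cokernel Z. *)
Definition rel_hom (f : forall j, 'M[F]_(dm M' j, dm M j))
    (g : forall j, 'M[F]_(dm N' j, dm N j)) : Prop :=
  (forall j, j != k.+2 -> j != k.+3 -> g j *m th D j = th D' j *m f j) /\
  g k.+3 *m ta D = ta D' *m f k.+2.

(** Acting on both copies of Y, [f k.+2] preserves the image of X because [f] is a morphism; [gZ] is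
    the induced map on the cokernel, written through the section [spR]. *)
Lemma hom_down f : @ohom F M M' f -> exists g, @ohom F N N' g /\ rel_hom f g.
Proof.
move=> hf.
pose gZ := spC D' true *m f k.+2 *m spR D true + spC D' false *m f k.+2 *m spR D false.
have gZC s : gZ *m spC D s = spC D' s *m f k.+2.
  have z : spC D' true *m f k.+2 *m ar M true k.+2
      + spC D' false *m f k.+2 *m ar M false k.+2 = 0.
    by rewrite -!mulmxA !hf !mulmxA -mulmxDl spCa mul0mx.
  rewrite mulmxDl -!mulmxA !spRC !(mulmxBr (f _)) !mulmxBr.
  rewrite addrACA -opprD !mulmxA -mulmxDl z mul0mx subr0.
  by case: s; rewrite /= !mul_mx_scalar !scale1r !scale0r ?addr0 ?add0r // -!mulmxA !(mulmx0, addr0, add0r).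
have [g [go g2 g3]] := override2 (fun j => th D' j *m f j *m thi D j) gZ (ta D' *m f k.+2 *m tai D).
have gth j : j != k.+2 -> j != k.+3 -> g j *m th D j = th D' j *m f j.
  by move=> n2 n3; rewrite go // -mulmxA thK // mulmx1.
have gta : g k.+3 *m ta D = ta D' *m f k.+2 by rewrite g3 -mulmxA taK mulmx1.
exists g; split=> // s j.
have [->|n1] := eqVneq j k.+1.
  apply: (@cancel_C _ _ D) => t; rewrite g2 -!mulmxA gZC.
  have [->|] := eqVneq t s.
    rewrite ck1 !mulmxA ck1 gth -?mulmxA ?hf //; lia.
  rewrite bool_neqE => /eqP->; rewrite ck1' mulmx0.
  by rewrite mulmxA ck1' mul0mx.
have [->|n2] := eqVneq j k.+2.
  by rewrite g2 g3 (ckN D) (ckN D') !mulmxA gZC -!mulmxA (mulmxA (tai D')) taK mul1mx.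
have [->|n3] := eqVneq j k.+3.
  apply: (@cancel_th _ _ D); try lia.
  rewrite -!mulmxA gth; try lia.
  by rewrite ck3 !mulmxA gta ck3 -(mulmxA (ta D')) hf !mulmxA -(mulmxA _ (f _)) hf !mulmxA.
apply: (@cancel_th _ _ D); try lia.
by rewrite -!mulmxA cko // gth ?mulmxA ?gth -?mulmxA ?hf ?mulmxA ?cko //; lia.
Qed.

(** Dual to [hom_down]: X is the kernel of Y + Y -> Z, and the map on both copies of Y given by
    [g k.+3] restricts to it. *)
Lemma hom_up g : @ohom F N N' g -> exists f, @ohom F M M' f /\ rel_hom f g.
Proof.
move=> hg.
have [fY fYE] : exists fY, fY = tai D' *m g k.+3 *m ta D by eexists.
pose fX := spL D' true *m fY *m ar M true k.+2 + spL D' false *m fY *m ar M false k.+2.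
have fYC s : spC D' s *m fY = g k.+2 *m spC D s.
  by rewrite fYE !spCE !mulmxA -(mulmxA _ (ta D')) taiK mulmx1 hg.
have afX s : ar M' s k.+2 *m fX = fY *m ar M s k.+2.
  have aL t : ar M' s k.+2 *m spL D' t = (s == t)%:R%:M - spR D' s *m spC D' t.
    by rewrite spRC opprB addrC subrK.
  rewrite mulmxDr !mulmxA !aL !mulmxBl -!mulmxA !(mulmxA (spC D' _)) !fYC.
  rewrite addrACA -opprD -!mulmxA -mulmxDr -mulmxDr spCa !mulmx0 subr0.
  by clear aL; case: s; rewrite /= !mul_scalar_mx !scale1r !scale0r ?addr0 ?add0r.
have [f [fo f2 f3]] := override2 (fun j => thi D' j *m g j *m th D j) fY fX.
have thf j : j != k.+2 -> j != k.+3 -> th D' j *m f j = g j *m th D j.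
  by move=> n2 n3; rewrite fo // !mulmxA thiK // mul1mx.
have taf : ta D' *m f k.+2 = g k.+3 *m ta D by rewrite f2 fYE !mulmxA taiK mul1mx.
exists f; split; last first.
  by split=> // j n2 n3; rewrite thf.
move=> s j.
have [->|n1] := eqVneq j k.+1.
  apply: (@cancel_thi _ _ D'); try lia.
  rewrite f2 !mulmxA thf -?ck1 -?mulmxA; try lia.
  by rewrite -ck1 fYC !mulmxA hg.
have [->|n2] := eqVneq j k.+2; first by rewrite f2 f3 afX.
have [->|n3] := eqVneq j k.+3.
  (* The two arrows out of X are jointly injective, so the square may be tested after each of them.
     With equal labels both sides vanish; with opposite labels it becomes the commutation of [g]
     with an arrow of [N']. *)
  apply: (@cancel_L _ _ D') => t; rewrite f3 !mulmxA afX.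
  have [->|] := eqVneq t s.
    by rewrite -mulmxA !ar0 mulmx0 mul0mx.
  rewrite bool_neqE => /eqP->; rewrite (ck3' D') -!mulmxA thf; try lia.
  rewrite (ck3' D) fYE -!mulmxA (mulmxA (ta D)) taiK mul1mx.
  by rewrite !mulmxA -(mulmxA _ (g k.+3)) hg !mulmxA.
apply: (@cancel_thi _ _ D'); try lia.
rewrite !mulmxA -cko // thf // -!mulmxA -cko // thf; try lia.
by rewrite !mulmxA hg.
Qed.

End Homs.

Lemma rel_hom_comp M N M' N' M'' N'' (D : coker_data M N) (D' : coker_data M' N')
    (D'' : coker_data M'' N'') f g f' g' :
  rel_hom D D' f g -> rel_hom D' D'' f' g' ->
  rel_hom D D'' (fun j => f' j *m f j) (fun j => g' j *m g j).
Proof.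
move=> [r e] [r' e']; split=> [j n2 n3|].
  by rewrite -mulmxA r // !mulmxA r'.
by rewrite -mulmxA e !mulmxA e'.
Qed.

(** Faithfulness: it makes the extensions of two mutually inverse morphisms mutually inverse, so
    isomorphisms are carried to isomorphisms. *)
Lemma rel_hom_id_down M N (D : coker_data M N) f g :
  @ohom F N N g -> rel_hom D D f g -> (forall j, f j = 1%:M) -> forall j, g j = 1%:M.
Proof.
move=> hg [r e] f1 j.
have g3 : g k.+3 = 1%:M.
  by rewrite -[LHS]mulmx1 -(taiK D) mulmxA e f1 mulmx1.
have [->|n2] := eqVneq j k.+2.
  by apply: (@cancel_C _ _ D) => s; rewrite spCE mulmxA hg g3 mulmx1 mul1mx.
have [-> //|n3] := eqVneq j k.+3.
by apply: (@cancel_th _ _ D) => //; rewrite r // f1 mulmx1 mul1mx.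
Qed.

Lemma rel_hom_id_up M N (D : coker_data M N) f g :
  @ohom F M M f -> rel_hom D D f g -> (forall j, g j = 1%:M) -> forall j, f j = 1%:M.
Proof.
move=> hf [r e] g1 j.
have f2 : f k.+2 = 1%:M.
  by rewrite -[LHS]mul1mx -(taK D) -mulmxA -e g1 mul1mx.
have [->|n3] := eqVneq j k.+3.
  by apply: (@cancel_L _ _ D) => s; rewrite -hf f2 mul1mx mulmx1.
have [-> //|n2] := eqVneq j k.+2.
by apply: (@cancel_thi _ _ D) => //; rewrite -r // g1 mulmx1 mul1mx.
Qed.

Lemma coker_iso_down M N M' N' :
  coker_rel M N -> coker_rel M' N' -> iso M M' -> iso N N'.
Proof.
move=> [D] [D'] [f [f' [hf f'f ff']]]; have hf' := ohom_inv hf f'f ff'.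
have [g [hg r]] := hom_down D D' hf; have [g' [hg' r']] := hom_down D' D hf'.
exists g, g'; split=> //.
- apply: (rel_hom_id_down _ (rel_hom_comp r r')) => // s j.
  by rewrite -mulmxA hg mulmxA hg' -mulmxA.
- apply: (rel_hom_id_down _ (rel_hom_comp r' r)) => // s j.
  by rewrite -mulmxA hg' mulmxA hg -mulmxA.
Qed.

Lemma coker_iso_up M N M' N' :
  coker_rel M N -> coker_rel M' N' -> iso N N' -> iso M M'.
Proof.
move=> [D] [D'] [f [f' [hf f'f ff']]]; have hf' := ohom_inv hf f'f ff'.
have [g [hg r]] := hom_up D D' hf; have [g' [hg' r']] := hom_up D' D hf'.
exists g, g'; split=> //.
- apply: (rel_hom_id_up _ (rel_hom_comp r r')) => // s j.
  by rewrite -mulmxA hg mulmxA hg' -mulmxA.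
- apply: (rel_hom_id_up _ (rel_hom_comp r' r)) => // s j.
  by rewrite -mulmxA hg' mulmxA hg -mulmxA.
Qed.

Lemma coker_dim M N : coker_rel M N ->
  (dm M k.+3 + dm N k.+2 = dm M k.+2 + dm M k.+2)%N.
Proof. by move=> [D]; apply: (split_square (And4 (spLa D) (spCR D) (spCa D) (spRC D))).2. Qed.

(** Domain of the move, expressed by a retraction rather than a rank so that it passes to direct
    summands; [good_surj] plays the same role for the range. *)
Definition good_inj M := exists L : bool -> 'M[F]_(dm M k.+3, dm M k.+2),
  L true *m ar M true k.+2 + L false *m ar M false k.+2 = 1%:M.
Definition good_surj M := exists R : bool -> 'M[F]_(dm M k.+3, dm M k.+2),
  ar M true k.+2 *m R true + ar M false k.+2 *m R false = 1%:M.

Lemma coker_inj M N : coker_rel M N -> good_inj M.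
Proof. by move=> [D]; exists (spL D); apply: spLa. Qed.

Lemma coker_surj M N : coker_rel M N -> good_surj N.
Proof.
move=> [D]; exists (fun s => ta D *m spR D (~~ s)).
by rewrite addrC !mulmxA -(spCR D) !spCE.
Qed.

Lemma coker_zero M N : coker_rel M N -> (zero M <-> zero N).
Proof.
move=> r; have dz := coker_dim r; case: r => D.
have dt := mulmx1_dim (taiK D) (taK D).
have dj j : j != k.+2 -> j != k.+3 -> dm N j = dm M j.
  by move=> n2 n3; apply: mulmx1_dim (thiK D n2 n3) (thK D n2 n3).
split=> z j.
  have [->|n2] := eqVneq j k.+2; first by move: dz; rewrite !z; lia.
  have [->|n3] := eqVneq j k.+3; first by rewrite dt z.
  by rewrite dj.
have y0 : dm M k.+2 = 0%N by rewrite -dt z.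
have [->|n2] := eqVneq j k.+3; first by move: dz; rewrite y0; lia.
have [->|n3] := eqVneq j k.+2; first by rewrite y0.
by rewrite -dj.
Qed.

(** The diagonal blocks of a retraction for the sum are retractions for the summands. *)
Lemma good_inj_sum M M1 M2 :
  iso M (osum M1 M2) -> good_inj M -> good_inj M1 /\ good_inj M2.
Proof.
move=> e [L La]; have [g [f [hg fg gf]]] := iso_sym e.
pose L' s := f k.+3 *m L s *m g k.+2.
have L'a : L' true *m ar (osum M1 M2) true k.+2 + L' false *m ar (osum M1 M2) false k.+2 = 1%:M.
  rewrite /L' -!mulmxA !hg -mulmxDr !(mulmxA (L _)) -mulmxDl La mul1mx.
  exact: fg.
move: L' L'a => L' L'a.
split; [exists (fun s => ulsubmx (L' s)) | exists (fun s => drsubmx (L' s))];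
  move: L'a; rewrite -{1}[L' true]submxK -{1}[L' false]submxK !mulmx_block add_block_mx;
  rewrite !(mulmx0, addr0, add0r) scalar_mx_block => /eq_block_mx; by case.
Qed.

Lemma good_surj_sum M M1 M2 :
  iso M (osum M1 M2) -> good_surj M -> good_surj M1 /\ good_surj M2.
Proof.
move=> e [L La]; have [f [g [hf gf fg]]] := e.
pose L' s := f k.+3 *m L s *m g k.+2.
have L'a : ar (osum M1 M2) true k.+2 *m L' true + ar (osum M1 M2) false k.+2 *m L' false = 1%:M.
  rewrite /L' !mulmxA -!hf -mulmxDl -!(mulmxA (f _)) -mulmxDr La mulmx1.
  exact: fg.
move: L' L'a => L' L'a.
split; [exists (fun s => ulsubmx (L' s)) | exists (fun s => drsubmx (L' s))];
  move: L'a; rewrite -{1}[L' true]submxK -{1}[L' false]submxK !mulmx_block add_block_mx;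
  rewrite !(mul0mx, addr0, add0r) scalar_mx_block => /eq_block_mx; by case.
Qed.

Lemma coker_sum M1 M2 N1 N2 :
  coker_rel M1 N1 -> coker_rel M2 N2 -> coker_rel (osum M1 M2) (osum N1 N2).
Proof.
move=> [D1] [D2]; constructor.
apply: (@CokerData (osum M1 M2) (osum N1 N2)
  (fun j => block_mx (th D1 j) 0 0 (th D2 j)) (fun j => block_mx (thi D1 j) 0 0 (thi D2 j))
  (block_mx (ta D1) 0 0 (ta D2)) (block_mx (tai D1) 0 0 (tai D2))
  (fun s => block_mx (spL D1 s) 0 0 (spL D2 s)) (fun s => block_mx (spR D1 s) 0 0 (spR D2 s))
  (fun s => block_mx (spC D1 s) 0 0 (spC D2 s))) => /=.
- by move=> j n2 n3; rewrite !block0E !thK // -scalar_mx_block.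
- by move=> j n2 n3; rewrite !block0E !thiK // -scalar_mx_block.
- by rewrite !block0E !taK // -scalar_mx_block.
- by rewrite !block0E !taiK // -scalar_mx_block.
- by move=> s; rewrite !block0E !spCE.
- by rewrite !block0E add_block_mx !spLa !addr0 -scalar_mx_block.
- by rewrite !block0E add_block_mx !spCR !addr0 -scalar_mx_block.
- by rewrite !block0E add_block_mx !spCa !addr0 block_mx0.
- move=> s t; rewrite !block0E !spRC.
  by rewrite scalar_mx_block opp_block_mx add_block_mx !oppr0 !addr0.
- by move=> s; rewrite !block0E !ck3.
- by move=> s; rewrite !block0E !ck1.
- by move=> s j n1 n2 n3; rewrite !block0E !cko.
Qed.

End CokernelMove.

Section CokernelExistence.
Variables (F : fieldType) (k : nat).

(** The arrow from Z is induced on the cokernel by the old arrow on copy [s] of Y and zero on the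
    other copy, which kills X by the relations; [R] makes it explicit. *)
Definition down_fam (d : nat -> nat) (W : bool -> forall j, 'M[F]_(d j, d j.+1)) z
    (C : bool -> 'M[F]_(z, d k.+2)) (R : bool -> 'M[F]_(d k.+2, z)) :=
  srg_fam W (fun s => W s k.+1 *m R s) (fun s => C (~~ s))
    (fun s => W (~~ s) k.+2 *m W s k.+3).

(** The new arrow into the kernel X is the old arrow placed in copy [~~ s] of Y; by the relations it
    lands in the kernel, and [L] expresses the corestriction. *)
Definition up_fam (d : nat -> nat) (W : bool -> forall j, 'M[F]_(d j, d j.+1)) x
    (a : bool -> 'M[F]_(d k.+3, x)) (L : bool -> 'M[F]_(x, d k.+3)) :=
  srg_fam W (fun s => W s k.+1 *m W (~~ s) k.+2) a (fun s => L (~~ s) *m W s k.+3).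

(** The relations at Z: R C differs from the identity of Y + Y by a term that the arrow below kills,
    and the sum of the products of [C] with the arrows of X being zero trades a product for one with
    two equal labels in a row. *)
Lemma coker_down M z (C : bool -> 'M[F]_(z, dm M k.+2)) L R :
  split_eqs (fun s => ar M s k.+2) C L R ->
  exists h0 : forall s j, down_fam (ar M) C R s j *m down_fam (ar M) C R s j.+1 = 0,
    coker_rel k M (Obj h0).
Proof.
move=> [La CR Ca RC].
have MRC s t : ar M s k.+1 *m R s *m C t = (s == t)%:R *: ar M s k.+1.
  by rewrite -mulmxA RC mulmxBr mulmxA ar0 mul0mx subr0 mul_mx_scalar.
have Ca' s : C (~~ s) *m ar M (~~ s) k.+2 = - (C s *m ar M s k.+2).
  by apply/eqP; rewrite -subr_eq0 opprK; case: s => /=; rewrite ?Ca // addrC Ca.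
have h0 s j : down_fam (ar M) C R s j *m down_fam (ar M) C R s j.+1 = 0.
  apply: srg0 => {j}{}s.
  - exact: ar0.
  - by rewrite mulmxA ar0 mul0mx.
  - by rewrite MRC; case: s; rewrite scale0r.
  - by rewrite mulmxA Ca' mulNmx -mulmxA ar0 mulmx0 oppr0.
  - by rewrite -mulmxA ar0 mulmx0.
exists h0; constructor.
pose dd := srg_dim k z (dm M k.+2) (dm M).
have ddo j : j != k.+2 -> j != k.+3 -> dd j = dm M j by apply: srg_dimo.
apply: (@CokerData F k M (Obj h0) (fun j => idm F _ _) (fun j => idm F _ _)
  (idm F _ _) (idm F _ _) L (fun s => R s *m idm F _ _) (fun s => idm F _ _ *m C s)) => /=.
- by move=> j n2 n3; apply/idmK/esym/ddo.
- by move=> j n2 n3; apply/idmK/ddo.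
- by apply/idmK; rewrite srg_dim3.
- by apply/idmK; rewrite srg_dim3.
- by move=> s; rewrite /down_fam srg_fam2 negbK sw_idm // srg_dim3.
- exact: La.
- by rewrite -!(mulmxA (idm F _ _)) !(mulmxA (C _)) -mulmxDr -mulmxDl CR mul1mx idmK // srg_dim2.
- by rewrite -!mulmxA -mulmxDr Ca mulmx0.
- by move=> s t; rewrite mulmxA -(mulmxA (R s)) idmK ?mulmx1 ?RC // srg_dim2.
- by move=> s; rewrite /down_fam srg_fam3 sw_idm ?mulmxA //; apply: ddo; lia.
- move=> s; rewrite /down_fam srg_fam1 mulmxA sw_idm ?srg_dim2 // -mulmxA MRC eqxx scale1r //.
- move=> s j n1 n2 n3; rewrite /down_fam srg_famo // sw_idm //; apply: ddo; lia.
Qed.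

Lemma coker_up N x (a : bool -> 'M[F]_(dm N k.+3, x)) L R :
  split_eqs a (fun s => ar N (~~ s) k.+2) L R ->
  exists h0 : forall s j, up_fam (ar N) a L s j *m up_fam (ar N) a L s j.+1 = 0,
    coker_rel k (Obj h0) N.
Proof.
move=> [La CR Ca RC].
have aLN s t : a s *m L (~~ t) *m ar N t k.+3 = (s == ~~ t)%:R *: ar N t k.+3.
  have -> : a s *m L (~~ t) = (s == ~~ t)%:R%:M - R s *m ar N t k.+2.
    by have := RC s (~~ t); rewrite negbK => ->; rewrite opprB addrC subrK.
  by rewrite mulmxBl -mulmxA ar0 mulmx0 subr0 mul_scalar_mx.
have Ca' s : ar N (~~ s) k.+2 *m a s = - (ar N s k.+2 *m a (~~ s)).
  by apply/eqP; rewrite -subr_eq0 opprK; case: s => /=; rewrite ?Ca // addrC Ca.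
have h0 s j : up_fam (ar N) a L s j *m up_fam (ar N) a L s j.+1 = 0.
  apply: srg0 => {j}{}s.
  - exact: ar0.
  - by rewrite mulmxA ar0 mul0mx.
  - by rewrite -mulmxA Ca' mulmxN mulmxA ar0 mul0mx oppr0.
  - by rewrite mulmxA aLN; case: s; rewrite scale0r.
  - by rewrite -mulmxA ar0 mulmx0.
exists h0; constructor.
pose dd := srg_dim k (dm N k.+3) x (dm N).
have ddo j : j != k.+2 -> j != k.+3 -> dd j = dm N j by apply: srg_dimo.
apply: (@CokerData F k (Obj h0) N (fun j => idm F _ _) (fun j => idm F _ _)
  (idm F _ _) (idm F _ _) (fun s => idm F _ _ *m L s *m idm F _ _)
  (fun s => idm F _ _ *m R s) (fun s => ar N (~~ s) k.+2 *m idm F _ _)) => /=.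
- by move=> j n2 n3; apply/idmK/ddo.
- by move=> j n2 n3; apply/idmK/esym/ddo.
- by apply/idmK; rewrite srg_dim2.
- by apply/idmK; rewrite srg_dim2.
- by [].
- rewrite /up_fam !srg_fam2 -!mulmxA !idm_sw ?srg_dim2 //.
  by rewrite -mulmxDr !mulmxA -mulmxDl La mul1mx idmK // srg_dim3.
- by rewrite !mulmxA -!(mulmxA (ar N _ _) (idm F _ _)) idmK ?mulmx1 ?CR // srg_dim2.
- by rewrite /up_fam !srg_fam2 -!mulmxA !idm_sw ?srg_dim2 // !mulmxA -mulmxDl Ca mul0mx.
- move=> s t; rewrite /up_fam srg_fam2 !mulmxA -(mulmxA _ (R s)).
  rewrite RC mulmxBr !mulmxBl mul_mx_scalar -scalemxAl idmK ?srg_dim2 //.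
  rewrite scalemx1; congr (_ - _).
  by rewrite sw_idm ?srg_dim3 // !mulmxA.
- move=> s; rewrite /up_fam srg_fam2 srg_fam3 idm_sw ?srg_dim2 // -mulmxA idm_sw ?srg_dim3 //.
  by rewrite !mulmxA aLN eqxx scale1r.
- move=> s; rewrite /up_fam srg_fam1 mulmxA idm_sw //; apply: ddo; lia.
- move=> s j n1 n2 n3; rewrite /up_fam srg_famo // idm_sw //; apply: ddo; lia.
Qed.

Lemma coker_exists_down (M : obj F) : good_inj k M -> exists N, coker_rel k M N.
Proof.
move=> [L La]; have [z [C [R e]]] := split_of_L (a := fun s => ar M s k.+2) La.
by have [h r] := coker_down e; exists (Obj h).
Qed.

Lemma coker_exists_up (N : obj F) : good_surj k N -> exists M, coker_rel k M N.
Proof.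
move=> [R NR]; have NR' : ar N (~~ true) k.+2 *m R (~~ true) + ar N (~~ false) k.+2 *m R (~~ false) = 1%:M.
  by rewrite addrC.
have [x [a [L e]]] := split_of_R (C := fun s => ar N (~~ s) k.+2) (R := fun s => R (~~ s)) NR'.
by have [h r] := coker_up e; exists (Obj h).
Qed.

(** [f] maps the kernel of [a] into the kernel of [c], and [g] undoes it there, as the correction
    [w *m a] vanishes on the kernel of [a]. The inequality compares the two nullities. *)
Lemma ker_rank_le p x q y (a : 'M[F]_(p, x)) (c : 'M[F]_(q, y)) (f : 'M[F]_(y, x))
    (g : 'M[F]_(x, y)) (h : 'M[F]_(q, p)) (w : 'M[F]_(x, p)) :
  c *m f = h *m a -> g *m f = 1%:M + w *m a -> (x + \rank c <= y + \rank a)%N.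
Proof.
move=> cf gf; pose K := cokermx a.
have aK : a *m K = 0 by exact: mulmx_coker.
have rK : \rank K = (x - \rank a)%N by exact: mxrank_coker.
have := mulmx0_rank_max (_ : c *m (f *m K) = 0).
rewrite mulmxA cf -mulmxA aK mulmx0 => /(_ erefl).
have : (\rank K <= \rank (f *m K))%N.
  by apply: (rank_lmul1 (B := g)); rewrite gf mulmxDl mul1mx -mulmxA aK mulmx0 addr0.
have := rank_leq_col a; rewrite rK; move: (\rank (f *m K)) => u.
move: (\rank a) (\rank c) => v w'; lia.
Qed.

(** The only rank that changes is the one between the two replaced spaces: the arrow of X with label
    [~~ s] maps the kernel of the arrow with label [s] isomorphically onto the kernel of
    [ar N s k.+2], so the nullities agree. *)
Lemma coker_rank (M N : obj F) : coker_rel k M N -> forall s,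
    [/\ (dm M k.+3 + \rank (ar N s k.+2) = dm M k.+2 + \rank (ar M s k.+2))%N,
      \rank (ar N s k.+1) = \rank (ar M s k.+1),
      \rank (ar N s k.+3) = \rank (ar M s k.+3) &
      forall j, j != k.+1 -> j != k.+2 -> j != k.+3 -> \rank (ar N s j) = \rank (ar M s j)].
Proof.
move=> [D] s.
have thr j : j != k.+2 -> j != k.+3 -> row_free (th D j) /\ row_full (th D j).
  move=> n2 n3; split.
    by apply/row_freeP; exists (thi D j); apply: thiK.
  by apply/row_fullP; exists (thi D j); apply: thK.
have thl j p (W : 'M[F]_(dm M j, p)) : j != k.+2 -> j != k.+3 -> \rank (th D j *m W) = \rank W.
  by move=> n2 n3; case: (thr _ n2 n3) => _ /eqmxMfull ->.
have thf j p (W : 'M[F]_(p, dm N j)) : j != k.+2 -> j != k.+3 -> \rank (W *m th D j) = \rank W.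
  by move=> n2 n3; case: (thr _ n2 n3) => /mxrankMfree ->.
have taf p (W : 'M[F]_(p, dm N k.+3)) : \rank (W *m ta D) = \rank W.
  by apply: mxrankMfree; apply/row_freeP; exists (tai D); apply: taiK.
have tal p (W : 'M[F]_(dm M k.+2, p)) : \rank (ta D *m W) = \rank W.
  have h : row_full (ta D) by apply/row_fullP; exists (tai D); apply: taK.
  by rewrite (eqmxMfull _ h).
have aL u t : ar M u k.+2 *m spL D t = (u == t)%:R%:M - spR D u *m spC D t.
  by rewrite spRC opprB addrC subrK.
have Ca u : spC D (~~ u) *m ar M (~~ u) k.+2 = - spC D u *m ar M u k.+2.
  apply/eqP; rewrite -subr_eq0 mulNmx opprK; have := spCa D.
  by case: u => /= <-; rewrite // addrC.
have La u : spL D (~~ u) *m ar M (~~ u) k.+2 = 1%:M + - spL D u *m ar M u k.+2.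
  have e : spL D (~~ u) *m ar M (~~ u) k.+2 + spL D u *m ar M u k.+2 = 1%:M.
    by rewrite -(spLa D); case: u => //=; rewrite addrC.
  by rewrite mulNmx -e addrK.
have rC : \rank (ar N s k.+2) = \rank (spC D (~~ s)) by rewrite spCE negbK taf.
split.
- apply/eqP; rewrite rC eqn_leq (ker_rank_le (Ca s) (La s)) /=.
  apply: (ker_rank_le (f := spL D (~~ s)) (g := ar M (~~ s) k.+2) (h := - spR D s) (w := - spR D (~~ s))).
    by rewrite aL (_ : (s == ~~ s) = false) ?mulr0n ?raddf0 ?sub0r ?mulNmx //; clear; case: s.
  by rewrite aL eqxx mulNmx.
- rewrite -(thl k.+1) -?ck1; try lia.
  apply/eqP; rewrite eqn_leq mxrankM_maxl andbT.
  have e u : ar N u k.+1 = ar N u k.+1 *m spC D u *m spR D u.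
    rewrite -[LHS]mulmx1 -(spCR D) mulmxDr !mulmxA.
    by have := ck1' D u; case: u => /= ->; rewrite mul0mx ?addr0 ?add0r.
  by rewrite {1}e mxrankM_maxl.
- rewrite -(thf k.+4) ?ck3 -?mulmxA ?tal; try lia.
  apply/eqP; rewrite eqn_leq mxrankM_maxr /=.
  apply: (rank_lmul1 (B := spL D (~~ s))).
  by rewrite La mulmxDl mul1mx -mulmxA ar0 mulmx0 addr0.
- move=> j n1 n2 n3; rewrite -(thl j) // -cko // thf //; lia.
Qed.

End CokernelExistence.

Section CokernelBands.
Variables (F : fieldType) (k : nat).

Lemma place_tuple n (f : nat -> nat) p :
  place [tuple f j | j < n] p = if p is p'.+1 then if (p' < n)%N then f p' else 0%N else 0%N.
Proof.
case: p => // p; case: ltnP => h; last by rewrite place_out.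
exact: (nth_mktuple (fun j : 'I_n => f j) 0%N (Ordinal h)).
Qed.

Lemma place_set n (m : n.-tuple nat) i v p : (0 < i <= n)%N ->
  place (set_place m i v) p = if p == i then v else place m p.
Proof.
move=> /andP [i0 iN]; rewrite /set_place (place_tuple _ (fun j => if j.+1 == i then v else place m j.+1)).
case: p => [|p]; first by case: eqP => // e; move: i0; rewrite -e.
case: ltnP => // h; case: eqP => [e|_]; first by move: iN; rewrite -e; lia.
by rewrite place_out.
Qed.

Lemma pl_set n (m : n.-tuple nat) i v p : (0 < i <= n)%N ->
  pl (set_place m i v) p = if p == i.+2 then v else pl m p.
Proof.
by move=> h; case: p => [|[|p]]; rewrite ?plE ?place_set.
Qed.

Lemma coker_dims (M N : obj F) : coker_rel k M N ->
  dm N k.+3 = dm M k.+2 /\ forall j, j != k.+2 -> j != k.+3 -> dm N j = dm M j.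
Proof.
move=> [D]; split=> [|j n2 n3]; first exact: mulmx1_dim (taiK D) (taK D).
exact: mulmx1_dim (thiK D n2 n3) (thK D n2 n3).
Qed.

Lemma coker_oband_up (M N : obj F) c c' : coker_rel k M N -> oband c N ->
  (forall j, j != k.+3 -> c' j = c j) -> c' k.+3 = (c k.+3 + c k.+4 - c k.+2)%N ->
  oband c' M.
Proof.
move=> r [d rk] co c3; have [d3 dd] := coker_dims r; have dz := coker_dim r.
have rr s := coker_rank r s.
have := d k.+2; have := d k.+3; have := rk true k.+2; have [e _ _ _] := rr true.
have := co k.+2; have := co k.+4; move=> /(_ ltac:(lia)) c4 /(_ ltac:(lia)) c2 h1 h2 h3.
(* Makes the truncated subtraction in [c3] exact: by the rank identity dim Z is at most dim Y plus
   [c k.+3]. *)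
have le : (c k.+2 <= c k.+3 + c k.+4)%N by lia.
split=> [j|s j].
  have [->|n2] := eqVneq j k.+2; first by rewrite c3 c2; lia.
  have [->|n3] := eqVneq j k.+3; first by rewrite c3 c4; lia.
  by rewrite -dd // d !co //; lia.
have [e1 e2 e3 e4] := rr s.
have [->|n2] := eqVneq j k.+2; first by have := rk s k.+2; rewrite c3; lia.
rewrite co; last by lia.
have [->|n1] := eqVneq j k.+1; first by rewrite -e2.
have [->|n3] := eqVneq j k.+3; first by rewrite -e3.
by rewrite -e4.
Qed.

Lemma coker_oband_down (M N : obj F) c c' : coker_rel k M N -> oband c M ->
  (forall j, j != k.+3 -> c' j = c j) -> c' k.+3 = (c k.+3 + c k.+2 - c k.+4)%N ->
  oband c' N.
Proof.
move=> r [d rk] co c3; have [d3 dd] := coker_dims r; have dz := coker_dim r.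
have rr s := coker_rank r s.
have := d k.+2; have := d k.+3; have := rk true k.+2; have [e _ _ _] := rr true.
have := co k.+2; have := co k.+4; move=> /(_ ltac:(lia)) c4 /(_ ltac:(lia)) c2 h1 h2 h3.
have le : (c k.+4 <= c k.+3 + c k.+2)%N by lia.
split=> [j|s j].
  have [->|n2] := eqVneq j k.+2; first by rewrite c3 c2; lia.
  have [->|n3] := eqVneq j k.+3; first by rewrite c3 c4; lia.
  by rewrite dd // d !co //; lia.
have [e1 e2 e3 e4] := rr s.
have [->|n2] := eqVneq j k.+2; first by have := rk s k.+2; rewrite c3; lia.
rewrite co; last by lia.
have [->|n1] := eqVneq j k.+1; first by rewrite e2.
have [->|n3] := eqVneq j k.+3; first by rewrite e3.
by rewrite e4.
Qed.

Definition up_tuple n (c : n.-tuple nat) :=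
  set_place c k.+1 (place c k.+1 + place c k.+2 - place c k).
Definition down_tuple n (c : n.-tuple nat) :=
  set_place c k.+1 (place c k.+1 + place c k - place c k.+2).

Lemma coker_odec_up n (D : seq (n.-tuple nat)) (M N : obj F) : (k < n)%N ->
  coker_rel k M N -> odec (@noP F) D N -> odec (@noP F) [seq up_tuple c | c <- D] M.
Proof.
move=> kn; apply: (odec_transfer (Rl := coker_rel k)).
- apply: (lift_sum (G := good_surj k)).
  + exact: coker_exists_up.
  + by move=> X Y; apply: coker_surj.
  + exact: good_surj_sum.
  + exact: coker_sum.
  + by move=> X X' Y Y' r r'; apply: coker_iso_up r r'.
- move=> X Y X1 X2 r e.
  have [] := lift_sum (Rl := fun Y X => coker_rel k X Y) (G := good_inj k) _ _ _ _ _ r e.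
  + exact: coker_exists_down.
  + by move=> ? ?; apply: coker_inj.
  + exact: good_inj_sum.
  + by move=> U1 U2 V1 V2; apply: coker_sum.
  + by move=> ? ? ? ? r1 r2; apply: (coker_iso_down r1 r2).
  by move=> Y1 [Y2 [h1 h2 h3]]; exists Y1, Y2.
- exact: coker_zero.
- move=> X Y c r b _; apply: coker_oband_up r b _ _ => [j n3|]; rewrite pl_set //.
    by rewrite (negPf n3).
  by rewrite eqxx !plE.
Qed.

Lemma coker_odec_down n (D : seq (n.-tuple nat)) (M N : obj F) : (k < n)%N ->
  coker_rel k M N -> odec (@noP F) D M -> odec (@noP F) [seq down_tuple c | c <- D] N.
Proof.
move=> kn; apply: (odec_transfer (Rl := fun Y X => coker_rel k X Y)).
- apply: (lift_sum (G := good_inj k)).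
  + exact: coker_exists_down.
  + by move=> X Y; apply: coker_inj.
  + exact: good_inj_sum.
  + by move=> X1 X2 Y1 Y2; apply: coker_sum.
  + by move=> X X' Y Y' r r'; apply: coker_iso_down r r'.
- move=> X Y X1 X2 r e.
  have [] := lift_sum (Rl := coker_rel k) (G := good_surj k) _ _ _ _ _ r e.
  + exact: coker_exists_up.
  + by move=> ? ?; apply: coker_surj.
  + exact: good_surj_sum.
  + by move=> U1 U2 V1 V2; apply: coker_sum.
  + by move=> ? ? ? ? r1 r2; apply: (coker_iso_up r1 r2).
  by move=> Y1 [Y2 [h1 h2 h3]]; exists Y1, Y2.
- by move=> X Y r; apply: iff_sym; apply: coker_zero r.
- move=> X Y c r b _; apply: coker_oband_down r b _ _ => [j n3|]; rewrite pl_set //.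
    by rewrite (negPf n3).
  by rewrite eqxx !plE.
Qed.

End CokernelBands.

(** * Deleting a space *)

Section Deletion.
Variables (F : fieldType) (k : nat).
Implicit Types M N : obj F.

Lemma splice (T : nat -> Type) (lo : forall j, T j) (x : T k.+3) (hi : forall j, T j.+1) :
  exists f : forall j, T j, [/\ forall j, (j <= k.+2)%N -> f j = lo j,
    f k.+3 = x & forall j, (k.+2 < j)%N -> f j.+1 = hi j].
Proof.
pose f0 j := match j return T j with
  | 0 => lo 0%N | j'.+1 => if (j' < k.+2)%N then lo j'.+1 else hi j' end.
exists (dfwith f0 x); split=> [j le||j gt]; last first.
- by rewrite dfwith_out /= ?ifN //; lia.
- exact: dfwith_in.
- by rewrite dfwith_out; [case: j le => //= j -> | lia].
Qed.

(* N is M with F_{k+3} deleted and, above it, the two families of arrows *)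
(* exchanged. *)
Record del_data M N := DelData {
  dth : forall j, 'M[F]_(dm N j, dm M j);
  dthi : forall j, 'M[F]_(dm M j, dm N j);
  dka : forall j, 'M[F]_(dm N j, dm M j.+1);
  dkai : forall j, 'M[F]_(dm M j.+1, dm N j);
  dL : bool -> 'M[F]_(dm M k.+3, dm M k.+2);
  dR : bool -> 'M[F]_(dm M k.+4, dm M k.+3);
  dthK : forall j, (j <= k.+2)%N -> dthi j *m dth j = 1%:M;
  dthiK : forall j, (j <= k.+2)%N -> dth j *m dthi j = 1%:M;
  dkaK : forall j, (k.+2 < j)%N -> dkai j *m dka j = 1%:M;
  dkaiK : forall j, (k.+2 < j)%N -> dka j *m dkai j = 1%:M;
  dLa : dL true *m ar M true k.+2 + dL false *m ar M false k.+2 = 1%:M;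
  daR : ar M true k.+3 *m dR true + ar M false k.+3 *m dR false = 1%:M;
  dk2 : forall s, ar N s k.+2 *m dka k.+3 = dth k.+2 *m ar M s k.+2 *m ar M (~~ s) k.+3;
  dlo : forall s j, (j < k.+2)%N -> ar N s j *m dth j.+1 = dth j *m ar M s j;
  dhi : forall s j, (k.+2 < j)%N -> ar N s j *m dka j.+1 = dka j *m ar M (~~ s) j.+1
}.

Definition del_rel M N : Prop := inhabited (del_data M N).

Section Cancel.
Variables (M N : obj F) (D : del_data M N).

Lemma cancel_dth j p (A B : 'M[F]_(p, dm N j)) : (j <= k.+2)%N ->
  A *m dth D j = B *m dth D j -> A = B.
Proof.
by move=> le /(congr1 (mulmx^~ (dthi D j))); rewrite -!mulmxA dthiK // !mulmx1.
Qed.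

Lemma cancel_dka j p (A B : 'M[F]_(p, dm N j)) : (k.+2 < j)%N ->
  A *m dka D j = B *m dka D j -> A = B.
Proof.
by move=> le /(congr1 (mulmx^~ (dkai D j))); rewrite -!mulmxA dkaiK // !mulmx1.
Qed.

Lemma cancel_dthi j p (A B : 'M[F]_(dm M j, p)) : (j <= k.+2)%N ->
  dth D j *m A = dth D j *m B -> A = B.
Proof.
by move=> le /(congr1 (mulmx (dthi D j))); rewrite !mulmxA dthK // !mul1mx.
Qed.

Lemma cancel_dkai j p (A B : 'M[F]_(dm M j.+1, p)) : (k.+2 < j)%N ->
  dka D j *m A = dka D j *m B -> A = B.
Proof.
by move=> le /(congr1 (mulmx (dkai D j))); rewrite !mulmxA dkaK // !mul1mx.
Qed.

Lemma cancel_dL p (A B : 'M[F]_(dm M k.+3, p)) :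
  (forall s, ar M s k.+2 *m A = ar M s k.+2 *m B) -> A = B.
Proof.
by move=> e; rewrite -[A]mul1mx -[B]mul1mx -(dLa D) !mulmxDl -!mulmxA !e.
Qed.

Lemma dk2' s : ar M s k.+2 *m ar M (~~ s) k.+3 = dthi D k.+2 *m ar N s k.+2 *m dka D k.+3.
Proof. by rewrite -mulmxA dk2 !mulmxA dthK // mul1mx. Qed.

Lemma daRs s : ar M s k.+2 *m ar M (~~ s) k.+3 *m dR D (~~ s) = ar M s k.+2.
Proof.
rewrite -[RHS]mulmx1 -(daR D) mulmxDr !mulmxA.
by case: s; rewrite ar0 mul0mx ?addr0 ?add0r.
Qed.

End Cancel.

Section Homs.
Variables (M N M' N' : obj F) (D : del_data M N) (D' : del_data M' N').

Definition rel_dhom (f : forall j, 'M[F]_(dm M' j, dm M j))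
    (g : forall j, 'M[F]_(dm N' j, dm N j)) : Prop :=
  (forall j, (j <= k.+2)%N -> g j *m dth D j = dth D' j *m f j) /\
  (forall j, (k.+2 < j)%N -> g j *m dka D j = dka D' j *m f j.+1).

Lemma dhom_down f : @ohom F M M' f -> exists g, @ohom F N N' g /\ rel_dhom f g.
Proof.
move=> hf.
pose g j : 'M[F]_(dm N' j, dm N j) := if (j <= k.+2)%N then dth D' j *m f j *m dthi D j
  else dka D' j *m f j.+1 *m dkai D j.
have glo j : (j <= k.+2)%N -> g j *m dth D j = dth D' j *m f j.
  by move=> le; rewrite /g le -mulmxA dthK // mulmx1.
have ghi j : (k.+2 < j)%N -> g j *m dka D j = dka D' j *m f j.+1.
  by move=> gt; rewrite /g leqNgt gt /= -mulmxA dkaK // mulmx1.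
exists g; split=> // s j; case: (ltngtP j k.+2) => [lt|gt|->].
- apply: (@cancel_dth _ _ D) => //.
  rewrite -!mulmxA dlo // glo // mulmxA glo ?(ltnW lt) //.
  by rewrite -mulmxA hf !mulmxA dlo.
- apply: (@cancel_dka _ _ D); first by lia.
  rewrite -!mulmxA dhi // ghi; last exact: ltnW.
  rewrite mulmxA ghi //.
  by rewrite -mulmxA hf !mulmxA dhi.
- apply: (@cancel_dka _ _ D); first by [].
  rewrite -!mulmxA dk2 ghi // !mulmxA glo // dk2.
  by rewrite -(mulmxA _ (f _)) hf !mulmxA -(mulmxA _ (f _)) hf !mulmxA.
Qed.

(** F_{k+3} is the image of the map from two copies of F_{k+4} to two copies of F_{k+2}. The entries
    of that map with equal labels vanish and the other two are the arrows of N, so it commutes with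
    [g], and [fX] is the map induced on the image. *)
Lemma dhom_up g : @ohom F N N' g -> exists f, @ohom F M M' f /\ rel_dhom f g.
Proof.
move=> hg.
have [f4 f4E] : exists h, h = dkai D' k.+3 *m g k.+3 *m dka D k.+3 by eexists.
have [f2 f2E] : exists h, h = dthi D' k.+2 *m g k.+2 *m dth D k.+2 by eexists.
pose fX := ar M' true k.+3 *m f4 *m dR D true + ar M' false k.+3 *m f4 *m dR D false.
have key s : ar M' s k.+2 *m ar M' (~~ s) k.+3 *m f4 = f2 *m ar M s k.+2 *m ar M (~~ s) k.+3.
  rewrite (dk2' D') f4E !mulmxA -(mulmxA _ (dka D' _)) dkaiK // mulmx1 -(mulmxA _ (ar N' _ _)) -hg.
  by rewrite f2E -!(mulmxA _ (dth D _)) -(mulmxA _ (dth D _ *m _)) -dk2 !mulmxA.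
have afX s : ar M' s k.+2 *m fX = f2 *m ar M s k.+2.
  rewrite -(daRs D) !mulmxA -key mulmxDr !mulmxA.
  by case: s; rewrite ar0 !mul0mx ?addr0 ?add0r.
have [f [flo f3 fhi]] := splice (fun j => dthi D' j *m g j *m dth D j) fX
  (fun j => dkai D' j *m g j *m dka D j).
have thf j : (j <= k.+2)%N -> dth D' j *m f j = g j *m dth D j.
  by move=> le; rewrite flo // !mulmxA dthiK // mul1mx.
have kaf j : (k.+2 < j)%N -> dka D' j *m f j.+1 = g j *m dka D j.
  by move=> le; rewrite fhi // !mulmxA dkaiK // mul1mx.
exists f; split; last by split=> j le; rewrite ?thf ?kaf.
move=> s j; case: (ltngtP j k.+2) => [lt|gt|->].
- apply: (@cancel_dthi _ _ D'); first exact: ltnW.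
  by rewrite !mulmxA -dlo // thf ?(ltnW lt) // -!mulmxA -dlo // thf // !mulmxA hg.
- move: gt; rewrite leq_eqVlt => /orP [/eqP <-|].
    apply: (@cancel_dL _ _ D') => t; rewrite f3 !mulmxA afX fhi // -f4E.
    have [->|] := eqVneq s t.
      by rewrite -mulmxA !ar0 mulmx0 mul0mx.
    by rewrite bool_neqE => /eqP->; rewrite key.
  case: j => // j gt; rewrite -(negbK s); move: (~~ s) => t.
  apply: (@cancel_dkai _ _ D'); first by lia.
  rewrite !mulmxA -dhi // ?kaf -?mulmxA -?dhi // ?kaf ?mulmxA ?hg //; lia.
- by rewrite flo // f3 -f2E afX.
Qed.

End Homs.

Lemma rel_dhom_comp M N M' N' M'' N'' (D : del_data M N) (D' : del_data M' N')
    (D'' : del_data M'' N'') f g f' g' :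
  rel_dhom D D' f g -> rel_dhom D' D'' f' g' ->
  rel_dhom D D'' (fun j => f' j *m f j) (fun j => g' j *m g j).
Proof.
move=> [r e] [r' e']; split=> j n2.
  by rewrite -mulmxA r // !mulmxA r'.
by rewrite -mulmxA e // !mulmxA e'.
Qed.

Lemma rel_dhom_id_down M N (D : del_data M N) f g :
  rel_dhom D D f g -> (forall j, f j = 1%:M) -> forall j, g j = 1%:M.
Proof.
move=> [r e] f1 j; case: (leqP j k.+2) => h.
  by apply: (@cancel_dth _ _ D) => //; rewrite r // f1 mulmx1 mul1mx.
by apply: (@cancel_dka _ _ D) => //; rewrite e // f1 mulmx1 mul1mx.
Qed.

Lemma rel_dhom_id_up M N (D : del_data M N) f g :
  @ohom F M M f -> rel_dhom D D f g -> (forall j, g j = 1%:M) -> forall j, f j = 1%:M.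
Proof.
move=> hf [r e] g1.
have lo j : (j <= k.+2)%N -> f j = 1%:M.
  by move=> h; apply: (@cancel_dthi _ _ D) => //; rewrite -r // g1 mulmx1 mul1mx.
move=> j; case: (leqP j k.+2) => h; first exact: lo.
move: h; rewrite leq_eqVlt => /orP [/eqP <-|].
  by apply: (@cancel_dL _ _ D) => s; rewrite -hf lo // mul1mx mulmx1.
case: j => // j h.
by apply: (@cancel_dkai _ _ D) => //; rewrite -e // g1 mulmx1 mul1mx.
Qed.

Lemma del_iso_down M N M' N' : del_rel M N -> del_rel M' N' -> iso M M' -> iso N N'.
Proof.
move=> [D] [D'] [f [f' [hf f'f ff']]]; have hf' := ohom_inv hf f'f ff'.
have [g [hg r]] := dhom_down D D' hf; have [g' [hg' r']] := dhom_down D' D hf'.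
exists g, g'; split=> //.
- exact: (rel_dhom_id_down (rel_dhom_comp r r')).
- exact: (rel_dhom_id_down (rel_dhom_comp r' r)).
Qed.

Lemma del_iso_up M N M' N' : del_rel M N -> del_rel M' N' -> iso N N' -> iso M M'.
Proof.
move=> [D] [D'] [f [f' [hf f'f ff']]]; have hf' := ohom_inv hf f'f ff'.
have [g [hg r]] := dhom_up D D' hf; have [g' [hg' r']] := dhom_up D' D hf'.
exists g, g'; split=> //.
- apply: (rel_dhom_id_up _ (rel_dhom_comp r r')) => // s j.
  by rewrite -mulmxA hg mulmxA hg' -mulmxA.
- apply: (rel_dhom_id_up _ (rel_dhom_comp r' r)) => // s j.
  by rewrite -mulmxA hg' mulmxA hg -mulmxA.
Qed.

Lemma del_dims M N : del_rel M N ->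
  (forall j, (j <= k.+2)%N -> dm N j = dm M j) /\ (forall j, (k.+2 < j)%N -> dm N j = dm M j.+1).
Proof.
move=> [D]; split=> j h; first exact: mulmx1_dim (dthiK D h) (dthK D h).
exact: mulmx1_dim (dkaiK D h) (dkaK D h).
Qed.

Definition good_del M := good_inj k M /\ good_surj k.+1 M.

Lemma del_good M N : del_rel M N -> good_del M.
Proof. by move=> [D]; split; [exists (dL D); apply: dLa | exists (dR D); apply: daR]. Qed.

Lemma good_del_sum M M1 M2 : iso M (osum M1 M2) -> good_del M -> good_del M1 /\ good_del M2.
Proof.
move=> e [g1 g2]; have [? ?] := good_inj_sum e g1; have [? ?] := good_surj_sum e g2.
by split; split.
Qed.

Lemma del_sum M1 M2 N1 N2 :
  del_rel M1 N1 -> del_rel M2 N2 -> del_rel (osum M1 M2) (osum N1 N2).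
Proof.
move=> [D1] [D2]; constructor.
apply: (@DelData (osum M1 M2) (osum N1 N2)
  (fun j => block_mx (dth D1 j) 0 0 (dth D2 j)) (fun j => block_mx (dthi D1 j) 0 0 (dthi D2 j))
  (fun j => block_mx (dka D1 j) 0 0 (dka D2 j)) (fun j => block_mx (dkai D1 j) 0 0 (dkai D2 j))
  (fun s => block_mx (dL D1 s) 0 0 (dL D2 s)) (fun s => block_mx (dR D1 s) 0 0 (dR D2 s))) => /=.
- by move=> j h; rewrite !block0E !dthK // -scalar_mx_block.
- by move=> j h; rewrite !block0E !dthiK // -scalar_mx_block.
- by move=> j h; rewrite !block0E !dkaK // -scalar_mx_block.
- by move=> j h; rewrite !block0E !dkaiK // -scalar_mx_block.
- by rewrite !block0E add_block_mx !dLa !addr0 -scalar_mx_block.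
- by rewrite !block0E add_block_mx !daR !addr0 -scalar_mx_block.
- by move=> s; rewrite !block0E !dk2.
- by move=> s j h; rewrite !block0E !dlo.
- by move=> s j h; rewrite !block0E !dhi.
Qed.

(** The images of the two upper arrows span F_{k+3} and the lower arrow of label [s] kills one of
    them, so its image is that of the composite with the other. The dual argument handles the upper
    arrows. *)
Lemma del_rank M N : del_rel M N -> forall s,
  [/\ \rank (ar M s k.+2) = \rank (ar N s k.+2),
      \rank (ar M s k.+3) = \rank (ar N (~~ s) k.+2),
      forall j, (j < k.+2)%N -> \rank (ar N s j) = \rank (ar M s j) &
      forall j, (k.+2 < j)%N -> \rank (ar N s j) = \rank (ar M (~~ s) j.+1)].
Proof.
move=> [D] s.
have thl j p (W : 'M[F]_(dm M j, p)) : (j <= k.+2)%N -> \rank (dth D j *m W) = \rank W.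
  move=> h; have f : row_full (dth D j) by apply/row_fullP; exists (dthi D j); apply: dthK.
  by rewrite (eqmxMfull _ f).
have thf j p (W : 'M[F]_(p, dm N j)) : (j <= k.+2)%N -> \rank (W *m dth D j) = \rank W.
  by move=> h; apply: mxrankMfree; apply/row_freeP; exists (dthi D j); apply: dthiK.
have kal j p (W : 'M[F]_(dm M j.+1, p)) : (k.+2 < j)%N -> \rank (dka D j *m W) = \rank W.
  move=> h; have f : row_full (dka D j) by apply/row_fullP; exists (dkai D j); apply: dkaK.
  by rewrite (eqmxMfull _ f).
have kaf j p (W : 'M[F]_(p, dm N j)) : (k.+2 < j)%N -> \rank (W *m dka D j) = \rank W.
  by move=> h; apply: mxrankMfree; apply/row_freeP; exists (dkai D j); apply: dkaiK.
have rN u : \rank (ar N u k.+2) = \rank (ar M u k.+2 *m ar M (~~ u) k.+3).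
  by rewrite -(kaf k.+3) // dk2 -mulmxA thl.
have La u : dL D u *m ar M u k.+2 *m ar M (~~ u) k.+3 = ar M (~~ u) k.+3.
  rewrite -[RHS]mul1mx -(dLa D) mulmxDl.
  by case: u => /=; rewrite -[X in _ + X]mulmxA -?[X in X + _]mulmxA ar0 mulmx0 ?addr0 ?add0r ?mulmxA.
split.
- apply/eqP; rewrite rN eqn_leq mxrankM_maxl andbT.
  by rewrite -{1}(daRs D) mxrankM_maxl.
- apply/eqP; rewrite rN negbK eqn_leq mxrankM_maxr andbT.
  by apply: (rank_lmul1 (B := dL D (~~ s))); have := La (~~ s); rewrite negbK.
- by move=> j h; rewrite -(thf j.+1) // dlo // thl // ltnW.
- by move=> j h; rewrite -(kaf j.+1) ?dhi ?kal // ltnW.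
Qed.

(** At most, because the two lower arrows are jointly injective. At least, because two consecutive
    arrows of equal label have product zero, so their ranks add up to at most the dimension between
    them. *)
Lemma del_dimX M N : del_rel M N ->
  dm M k.+3 = (\rank (ar N true k.+2) + \rank (ar N false k.+2))%N.
Proof.
move=> r; have [e1 e2 _ _] := del_rank r true; have [e3 e4 _ _] := del_rank r false.
case: r => D; apply/eqP; rewrite eqn_leq; apply/andP; split.
  rewrite -{1}(mxrank1 F (dm M k.+3)) -(dLa D) -e1 -e3.
  by apply: leq_trans (mxrank_add _ _) _; apply: leq_add; apply: mxrankM_maxr.
rewrite -e1 -[X in (_ + X)%N]/(\rank (ar N (~~ true) k.+2)) -e2.
by apply: mulmx0_rank_max; apply: ar0.
Qed.

Lemma del_zero M N : del_rel M N -> (zero M <-> zero N).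
Proof.
move=> r; have [lo hi] := del_dims r; have dX := del_dimX r.
split=> z j.
  by case: (leqP j k.+2) => h; [rewrite lo | rewrite hi].
case: (leqP j k.+2) => h; first by rewrite -lo.
move: h; rewrite leq_eqVlt => /orP [/eqP <-|].
  rewrite dX; have := rank_leq_row (ar N true k.+2); have := rank_leq_row (ar N false k.+2).
  by have := z k.+2; move: (\rank (ar N true _)) (\rank (ar N false _)) => u v; move: (dm N k.+2) => w; lia.
by case: j => // j h; rewrite -hi.
Qed.

End Deletion.

Section DeletionBands.
Variables (F : fieldType) (k : nat).

Section Families.
Variables (d : nat -> nat) (W : bool -> forall j, 'M[F]_(d j, d j.+1)).

Definition del_dim j := if (j <= k.+2)%N then d j else d j.+1.

(** Above the gap the labels have to be exchanged: the composite [W s k.+2 *m W (~~ s) k.+3] is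
    annihilated by the next arrow of label [~~ s]. *)
Definition del_fam s j : 'M[F]_(del_dim j, del_dim j.+1) :=
  if (j < k.+2)%N then sw _ _ (W s j)
  else if j == k.+2 then sw _ _ (W s k.+2 *m W (~~ s) k.+3)
  else sw _ _ (W (~~ s) j.+1).

Lemma del_dimlo j : (j <= k.+2)%N -> del_dim j = d j.
Proof. by rewrite /del_dim => ->. Qed.
Lemma del_dimhi j : (k.+2 < j)%N -> del_dim j = d j.+1.
Proof. by move=> h; rewrite /del_dim ifF //; lia. Qed.

Lemma del_famlo s j : (j < k.+2)%N -> del_fam s j = sw _ _ (W s j).
Proof. by rewrite /del_fam => ->. Qed.
Lemma del_fam2 s : del_fam s k.+2 = sw _ _ (W s k.+2 *m W (~~ s) k.+3).
Proof. by rewrite /del_fam ltnn eqxx. Qed.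
Lemma del_famhi s j : (k.+2 < j)%N -> del_fam s j = sw _ _ (W (~~ s) j.+1).
Proof. by move=> h; rewrite /del_fam !ifF //; lia. Qed.

Hypothesis WW : forall s j, W s j *m W s j.+1 = 0.

Lemma del_fam0 s j : del_fam s j *m del_fam s j.+1 = 0.
Proof.
case: (ltngtP j k.+2) => [lt|gt|->].
- rewrite (del_famlo _ lt); move: (lt); rewrite leq_eqVlt => /orP [/eqP e|lt'].
    case: e lt => -> _; rewrite del_fam2 sw_mul; last exact: del_dimlo.
    by rewrite mulmxA WW mul0mx sw0.
  by rewrite del_famlo // sw_mul ?WW ?sw0 //; apply: del_dimlo; apply: ltnW.
- rewrite del_famhi // del_famhi; last exact: ltnW.
  by rewrite sw_mul ?WW ?sw0 //; apply: del_dimhi; apply: ltnW.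
- rewrite del_fam2 del_famhi // sw_mul; last exact: del_dimhi.
  by rewrite -mulmxA WW mulmx0 sw0.
Qed.

Variables (x : nat) (a : bool -> 'M[F]_(d k.+2, x)) (b : bool -> 'M[F]_(x, d k.+3)).

Definition ins_dim j := if (j <= k.+2)%N then d j else if j == k.+3 then x else d j.-1.

Definition ins_fam s j : 'M[F]_(ins_dim j, ins_dim j.+1) :=
  if (j < k.+2)%N then sw _ _ (W s j) else if j == k.+2 then sw _ _ (a s)
  else if j == k.+3 then sw _ _ (b s) else sw _ _ (W (~~ s) j.-1).

Lemma ins_dimlo j : (j <= k.+2)%N -> ins_dim j = d j.
Proof. by rewrite /ins_dim => ->. Qed.
Lemma ins_dim3 : ins_dim k.+3 = x.
Proof. by rewrite /ins_dim ltnn eqxx. Qed.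
Lemma ins_dimhi j : (k.+2 < j)%N -> ins_dim j.+1 = d j.
Proof. by move=> h; rewrite /ins_dim !ifF //; lia. Qed.

Lemma ins_famlo s j : (j < k.+2)%N -> ins_fam s j = sw _ _ (W s j).
Proof. by rewrite /ins_fam => ->. Qed.
Lemma ins_fam2 s : ins_fam s k.+2 = sw _ _ (a s).
Proof. by rewrite /ins_fam ltnn eqxx. Qed.
Lemma ins_fam3 s : ins_fam s k.+3 = sw _ _ (b s).
Proof. by rewrite /ins_fam eqxx !ifF //; lia. Qed.
Lemma ins_famhi s j : (k.+2 < j)%N -> ins_fam s j.+1 = sw _ _ (W (~~ s) j).
Proof. by move=> h; rewrite /ins_fam !ifF //; lia. Qed.

Hypothesis Wa : forall s, W s k.+1 *m a s = 0.
Hypothesis ab : forall s, a s *m b s = 0.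
Hypothesis bW : forall s, b s *m W (~~ s) k.+3 = 0.

Lemma ins_fam0 s j : ins_fam s j *m ins_fam s j.+1 = 0.
Proof.
case: (ltngtP j k.+2) => [lt|gt|->].
- rewrite (ins_famlo _ lt); move: (lt); rewrite leq_eqVlt => /orP [/eqP e|lt'].
    by case: e lt => -> _; rewrite ins_fam2 sw_mul ?Wa ?sw0 //; apply: ins_dimlo.
  by rewrite ins_famlo // sw_mul ?WW ?sw0 //; apply: ins_dimlo; apply: ltnW.
- move: gt; rewrite leq_eqVlt => /orP [/eqP <-|].
    by rewrite ins_fam3 ins_famhi // sw_mul ?bW ?sw0 //; apply: ins_dimhi.
  case: j => // j gt.
  rewrite ins_famhi; last by lia.
  rewrite ins_famhi; last by lia.
  by rewrite sw_mul ?WW ?sw0 //; apply: ins_dimhi; lia.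
- by rewrite ins_fam2 ins_fam3 sw_mul ?ab ?sw0 //; apply: ins_dim3.
Qed.

End Families.

Definition odel (M : obj F) := Obj (del_fam0 (@ar0 F M)).

Lemma del_exists_down (M : obj F) : good_del k M -> del_rel k M (odel M).
Proof.
move=> [[L La] [R aR]]; constructor.
pose dlo := del_dimlo (dm M); pose dhi := del_dimhi (dm M).
apply: (@DelData F k M (odel M) (fun j => idm F _ _) (fun j => idm F _ _)
  (fun j => idm F _ _) (fun j => idm F _ _) L R) => //=.
- by move=> j h; apply/idmK/esym/dlo.
- by move=> j h; apply/idmK/dlo.
- by move=> j h; apply/idmK/esym/dhi.
- by move=> j h; apply/idmK/dhi.
- by move=> s; rewrite del_fam2 sw_idm ?mulmxA //; apply: dhi.
- by move=> s j h; rewrite del_famlo // sw_idm //; apply: dlo.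
- by move=> s j h; rewrite del_famhi // sw_idm //; apply: dhi; apply: ltnW.
Qed.

(** Each arrow of N across the gap is factored through its image, and the inserted space is the sum
    of the two images. The lower arrow of label [s] reads summand [s], the upper one fills summand
    [~~ s], so equal labels compose to zero. *)
Lemma del_exists_up (N : obj F) : exists M, del_rel k M N.
Proof.
have [r [R [C [R' [C' h]]]]] : exists (r : bool -> nat) (R : forall s, 'M[F]_(dm N k.+2, r s))
    (C : forall s, 'M[F]_(r s, dm N k.+3)) (R' : forall s, 'M[F]_(r s, dm N k.+2))
    (C' : forall s, 'M[F]_(dm N k.+3, r s)),
    forall s, [/\ R s *m C s = ar N s k.+2, R' s *m R s = 1%:M & C s *m C' s = 1%:M].
  exists (fun s => \rank (ar N s k.+2)), (fun s => col_base _), (fun s => row_base _).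
  exists (fun s => pinvmx (col_base (ar N s k.+2))), (fun s => pinvmx (row_base (ar N s k.+2))).
  move=> s; split; [exact: mulmx_base | by apply: mulVpmx; apply: col_base_full
    | by apply: mulmxVp; apply: row_base_free].
pose a s : 'M[F]_(dm N k.+2, r true + r false) := if s then row_mx (R true) 0 else row_mx 0 (R false).
pose b s : 'M[F]_(r true + r false, dm N k.+3) := if s then col_mx 0 (C false) else col_mx (C true) 0.
pose L s : 'M[F]_(r true + r false, dm N k.+2) := if s then col_mx (R' true) 0 else col_mx 0 (R' false).
pose T s : 'M[F]_(dm N k.+3, r true + r false) := if s then row_mx 0 (C' false) else row_mx (C' true) 0.
have NR s : ar N s k.+1 *m R s = 0.
  have [e _ c] := h s; rewrite -[R s]mulmx1 -c (mulmxA (R s)) e !mulmxA ar0 mul0mx //.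
have CN s : C s *m ar N s k.+3 = 0.
  by have [e c _] := h s; rewrite -[C s]mul1mx -c -!mulmxA (mulmxA (R s)) e ar0 mulmx0.
have ab s : a s *m b (~~ s) = ar N s k.+2.
  by have [e _ _] := h s; rewrite -e; case: s {e}; rewrite /a /b /= mul_row_col !(mulmx0, mul0mx, addr0, add0r).
have h0 := @ins_fam0 _ (ar N) (@ar0 F N) _ a b.
have {}h0 s j : ins_fam (ar N) a b s j *m ins_fam (ar N) a b s j.+1 = 0.
  apply: h0 => {j}{}s.
  - by have := NR s; case: s => e; rewrite /a /= mul_mx_row mulmx0 e row_mx0.
  - by case: s; rewrite /a /b /= mul_row_col !(mulmx0, mul0mx, addr0, add0r).
  - by have := CN (~~ s); case: s => e; rewrite /b /= mul_col_mx mul0mx e col_mx0.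
exists (Obj h0); constructor.
pose ilo := ins_dimlo (dm N) (r true + r false); pose ihi := ins_dimhi (dm N) (r true + r false).
have i3 := ins_dim3 (dm N) (r true + r false).
apply: (@DelData F k (Obj h0) N (fun j => idm F _ _) (fun j => idm F _ _)
  (fun j => idm F _ _) (fun j => idm F _ _) (fun s => idm F _ _ *m L s *m idm F _ _)
  (fun s => idm F _ _ *m T s *m idm F _ _)) => /=.
- by move=> j le; apply/idmK/ilo.
- by move=> j le; apply/idmK/esym/ilo.
- by move=> j le; apply/idmK/ihi.
- by move=> j le; apply/idmK/esym/ihi.
- rewrite !ins_fam2.
  have e : sw (ins_dim (dm N) (r true + r false) k.+3) (ins_dim (dm N) (r true + r false) k.+3) (L true *m a true + L false *m a false) = 1%:M.
    have [_ e1 _] := h true; have [_ e2 _] := h false.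
    rewrite /L /a /= !mul_col_row e1 e2 !(mulmx0, mul0mx) add_block_mx !(addr0, add0r) -scalar_mx_block.
    by rewrite sw1.
  by apply: (etrans _ e); rewrite /sw mulmxDr mulmxDl; congr (_ + _); apply: sw_mul; apply: ilo.
- rewrite !ins_fam3.
  have e : sw (ins_dim (dm N) (r true + r false) k.+3) (ins_dim (dm N) (r true + r false) k.+3) (b true *m T true + b false *m T false) = 1%:M.
    have [_ _ e1] := h true; have [_ _ e2] := h false.
    rewrite /T /b /= !mul_col_row e1 e2 !(mulmx0, mul0mx) add_block_mx !(addr0, add0r) -scalar_mx_block.
    by rewrite sw1.
  by apply: (etrans _ e); rewrite /sw mulmxDr mulmxDl; congr (_ + _); apply: sw_mul; apply: ihi.
- by move=> s; rewrite ins_fam2 ins_fam3 -mulmxA sw_mul // ab idm_sw //; apply: ilo.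
- by move=> s j lt; rewrite ins_famlo // idm_sw //; apply: ilo; apply: ltnW.
- by move=> s j lt; rewrite ins_famhi // negbK idm_sw //; apply: ihi.
Qed.

(** The ranks must be exact: the inserted space has the sum of the two ranks as its dimension, and
    this has to be twice [c k.+3]. *)
Lemma del_oband (M N : obj F) (c c' : nat -> nat) : del_rel k M N -> oband c N ->
  (forall s, \rank (ar N s k.+2) = c k.+3) ->
  (forall j, (j <= k.+3)%N -> c' j = c j) -> (forall j, (k.+2 < j)%N -> c' j.+1 = c j) ->
  oband c' M.
Proof.
move=> r [d rk] ex clo chi; have [lo hi] := del_dims r; have dX := del_dimX r.
split=> [j|s j].
  case: (leqP j k.+2) => h; first by rewrite -lo // d !clo // ltnW.
  move: h; rewrite leq_eqVlt => /orP [/eqP <-|].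
    by rewrite dX !ex clo // chi.
  by case: j => // j h; rewrite -hi // d !chi // ltnW.
have [e1 e2 e3 _] := del_rank r s.
case: (ltngtP j k.+2) => [lt|gt|->]; last by rewrite e1 ex clo.
  by rewrite -e3 // clo // ltnW.
move: gt; rewrite leq_eqVlt => /orP [/eqP <-|]; first by rewrite e2 ex chi.
case: j => // j h; have [_ _ _ e4] := del_rank r (~~ s).
by rewrite -(negbK s) -e4 // chi // ltnW.
Qed.

Lemma place_dup n (c : n.-tuple nat) i p : (0 < i <= n)%N ->
  place (dup_place c i) p = if (p <= i)%N then place c p else place c p.-1.
Proof.
move=> /andP [i0 iN]; rewrite /dup_place (place_tuple _ (fun j => place c (if (j.+1 <= i)%N then j.+1 else j))).
case: p => [|p]; first by [].
case: ltnP => // h; first by case: ifP.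
rewrite ifF; last by lia.
by rewrite place_out.
Qed.

Lemma pl_dup n (c : n.-tuple nat) i p : (0 < i <= n)%N ->
  pl (dup_place c i) p = if (p <= i.+2)%N then pl c p else pl c p.-1.
Proof.
move=> h; case: p => [|[|p]] //; rewrite plE place_dup // !ltnS.
by case: ifP => e; rewrite ?plE //; case: p e => [|p] //= e; rewrite plE.
Qed.

Lemma del_odec n (D : seq (n.-tuple nat)) (M N : obj F) : (k < n)%N ->
  del_rel k M N -> odec (@exactP F k.+2) D N ->
  odec (@noP F) [seq dup_place c k.+1 | c <- D] M.
Proof.
move=> kn; apply: (odec_transfer (Rl := del_rel k)).
- apply: (lift_sum (G := fun _ => True)) => //.
  + by move=> Y _; apply: del_exists_up.
  + exact: del_sum.
  + by move=> X X' Y Y' r r'; apply: del_iso_up r r'.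
- move=> X Y X1 X2 r e.
  have [] := lift_sum (Rl := fun Y X => del_rel k X Y) (G := good_del k) _ _ _ _ _ r e.
  + by move=> Z g; exists (odel Z); apply: del_exists_down.
  + by move=> ? ?; apply: del_good.
  + exact: good_del_sum.
  + by move=> U1 U2 V1 V2; apply: del_sum.
  + by move=> ? ? ? ? r1 r2; apply: (del_iso_down r1 r2).
  by move=> Y1 [Y2 [h1 h2 h3]]; exists Y1, Y2.
- exact: del_zero.
- move=> X Y c r b ex; apply: del_oband r b ex _ _ => j h; rewrite pl_dup //.
    by rewrite h.
  by rewrite ifF //; lia.
Qed.

End DeletionBands.

(** * Splitting off Kronecker modules *)

Section Biproducts.
Variable F : fieldType.
Implicit Types X Y Z : obj F.

Lemma biproduct M N K (f : forall j, 'M[F]_(dm N j, dm M j)) (g : forall j, 'M[F]_(dm M j, dm N j))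
    (p : forall j, 'M[F]_(dm K j, dm M j)) (i : forall j, 'M[F]_(dm M j, dm K j)) :
  @ohom F M N f -> @ohom F M K p -> (forall j, f j *m g j = 1%:M) -> (forall j, p j *m i j = 1%:M) ->
  (forall j, f j *m i j = 0) -> (forall j, p j *m g j = 0) ->
  (forall j, g j *m f j + i j *m p j = 1%:M) -> iso M (osum N K).
Proof.
move=> hf hp fg pi fi pg gf.
exists (fun j => col_mx (f j) (p j)), (fun j => row_mx (g j) (i j)); split=> [s j|j|j] /=.
- by rewrite mul_col_mx mul_block_col hf hp !mul0mx addr0 add0r.
- by rewrite mul_row_col gf.
- by rewrite mul_col_row fg fi pg pi -scalar_mx_block.
Qed.

(** Cancellation of K without Krull-Schmidt: [f] kills the copy of K in M, so its restriction to X
    is still onto in every degree, and equal dimensions make it an isomorphism. *)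
Lemma osum_cancel M X Y K (f : forall j, 'M[F]_(dm Y j, dm M j)) (g : forall j, 'M[F]_(dm M j, dm Y j))
    (u : forall j, 'M[F]_(dm M j, dm (osum X K) j)) (v : forall j, 'M[F]_(dm (osum X K) j, dm M j)) :
  @ohom F M Y f -> (forall j, f j *m g j = 1%:M) -> @ohom F (osum X K) M u ->
  (forall j, u j *m v j = 1%:M) ->
  (forall j, f j *m (u j *m (col_mx 0 1%:M : 'M_(dm X j + dm K j, dm K j))) = 0) ->
  (forall j, dm X j = dm Y j) -> iso X Y.
Proof.
move=> hf fg hu uv f0 d.
pose I1 j : 'M[F]_(dm X j + dm K j, dm X j) := col_mx 1%:M 0.
pose I2 j : 'M[F]_(dm X j + dm K j, dm K j) := col_mx 0 1%:M.
pose P1 j : 'M[F]_(dm X j, dm X j + dm K j) := row_mx 1%:M 0.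
pose P2 j : 'M[F]_(dm K j, dm X j + dm K j) := row_mx 0 1%:M.
have IP j : I1 j *m P1 j + I2 j *m P2 j = 1%:M.
  by rewrite !mul_col_row !(mulmx0, mul0mx, mulmx1) add_block_mx !(addr0, add0r) -scalar_mx_block.
pose a j := f j *m u j *m I1 j; pose b j := P1 j *m v j *m g j.
have ab j : a j *m b j = 1%:M.
  have -> : a j *m b j = f j *m u j *m (I1 j *m P1 j + I2 j *m P2 j) *m v j *m g j.
    by rewrite mulmxDr (mulmxA _ (I2 j)) -(mulmxA (f j) _ (I2 j)) f0 mul0mx addr0 !mulmxA.
  by rewrite IP mulmx1 -(mulmxA _ (u j)) uv mulmx1 fg.
exists a, b; split=> [s j|j|j] //; last exact: mulmx1C_dim (esym (d j)) (ab j).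
have hI : I1 j *m ar X s j = ar (osum X K) s j *m I1 j.+1.
  by rewrite /= mul_col_mx mul_block_col !(mulmx0, mul0mx, mulmx1, mul1mx, addr0).
by rewrite -mulmxA hI !mulmxA -(mulmxA (f j)) hu mulmxA hf -!mulmxA.
Qed.

Lemma osumA X Y Z : iso (osum (osum X Y) Z) (osum X (osum Y Z)).
Proof.
pose P1 a b : 'M[F]_(a, a + b) := row_mx 1%:M 0; pose P2 a b : 'M[F]_(b, a + b) := row_mx 0 1%:M.
pose I1 a b : 'M[F]_(a + b, a) := col_mx 1%:M 0; pose I2 a b : 'M[F]_(a + b, b) := col_mx 0 1%:M.
have P1I1 a b : P1 a b *m I1 a b = 1%:M by rewrite mul_row_col mulmx1 mulmx0 addr0.
have P1I2 a b : P1 a b *m I2 a b = 0 by rewrite mul_row_col mulmx0 mul0mx addr0.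
have P2I1 a b : P2 a b *m I1 a b = 0 by rewrite mul_row_col mulmx0 mul0mx addr0.
have P2I2 a b : P2 a b *m I2 a b = 1%:M by rewrite mul_row_col mulmx1 mul0mx add0r.
have IP a b : I1 a b *m P1 a b + I2 a b *m P2 a b = 1%:M.
  by rewrite !mul_col_row !(mulmx0, mul0mx, mulmx1) add_block_mx !(addr0, add0r) -scalar_mx_block.
have hP1 a b c d (U : 'M[F]_(a, c)) (V : 'M[F]_(b, d)) :
    P1 a b *m block_mx U 0 0 V = U *m P1 c d.
  by rewrite mul_row_block mul_mx_row !(mulmx0, mul0mx, mulmx1, mul1mx, addr0).
have hP2 a b c d (U : 'M[F]_(a, c)) (V : 'M[F]_(b, d)) :
    P2 a b *m block_mx U 0 0 V = V *m P2 c d.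
  by rewrite mul_row_block mul_mx_row !(mulmx0, mul0mx, mulmx1, mul1mx, add0r).
pose f j := P1 (dm X j) (dm Y j) *m P1 _ (dm Z j).
pose g j := I1 (dm X j + dm Y j)%N (dm Z j) *m I1 (dm X j) _.
pose p j := col_mx (P2 (dm X j) (dm Y j) *m P1 _ (dm Z j)) (P2 (dm X j + dm Y j)%N (dm Z j)).
pose i j := row_mx (I1 (dm X j + dm Y j)%N (dm Z j) *m I2 (dm X j) _) (I2 _ _).
apply: (@biproduct (osum (osum X Y) Z) X (osum Y Z) f g p i) => [s j|s j|j|j|j|j|j].
- by rewrite /f /= -mulmxA hP1 mulmxA hP1 -mulmxA.
- by rewrite /p /= mul_col_mx -mulmxA hP1 mulmxA !hP2 mul_block_col !mul0mx addr0 add0r -mulmxA.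
- by rewrite /f /g -mulmxA (mulmxA (P1 _ (dm Z j))) P1I1 mul1mx P1I1.
- rewrite /p /i mul_col_row -!mulmxA !(mulmxA (P1 _ (dm Z j))) !(mulmxA (P2 _ (dm Z j))).
  by rewrite P1I1 P1I2 P2I1 P2I2 mul1mx P2I2 mulmx0 mul0mx -scalar_mx_block.
- by rewrite /f /i mul_mx_row -!mulmxA (mulmxA (P1 _ (dm Z j))) P1I1 mul1mx P1I2 P1I2 mulmx0 row_mx0.
- rewrite /p /g mul_col_mx -!mulmxA (mulmxA (P1 _ (dm Z j))) (mulmxA (P2 _ (dm Z j))).
  by rewrite P1I1 mul1mx P2I1 P2I1 mul0mx col_mx0.
- rewrite /g /f /i /p mul_row_col addrA -!mulmxA -mulmxDr !(mulmxA _ _ (P1 _ (dm Z j))) -mulmxDl.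
  by rewrite IP mul1mx IP.
Qed.

Definition zobj : obj F := @Obj F (fun=> 0%N) (fun _ _ => 0) (fun _ _ => mulmx0 _ _).

Lemma osum0 X Y : zero X -> iso (osum X Y) Y.
Proof.
move=> z; have z' Z j p : dm Z j = 0%N -> forall A B : 'M[F]_(p, dm Z j), A = B.
  by move=> e A B; apply: mx0_eq; rewrite e orbT.
have z'' Z j p : dm Z j = 0%N -> forall A B : 'M[F]_(dm Z j, p), A = B.
  by move=> e A B; apply: mx0_eq; rewrite e.
exists (fun j => row_mx 0 1%:M), (fun j => col_mx 0 1%:M); split=> [s j|j|j] /=.
- by rewrite mul_row_block mul_mx_row !(mulmx0, mul0mx, mulmx1, mul1mx, add0r).
- rewrite mul_col_row !(mulmx0, mul0mx, mulmx1) scalar_mx_block.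
  by congr block_mx; apply: z'.
- by rewrite mul_row_col mulmx0 add0r mulmx1.
Qed.

Lemma odec_cat P n (D1 D2 : seq (n.-tuple nat)) X1 X2 Z :
  odec P D1 X1 -> odec P D2 X2 -> iso Z (osum X1 X2) -> odec P (D1 ++ D2) Z.
Proof.
elim: D1 X1 Z => [|c D IH] X1 Z /=.
  by move=> z d e; apply: iso_odec d; apply/iso_sym/(iso_trans e)/osum0.
move=> [N [X' [b i e d]]] d2 eZ; exists N, (osum X' X2); split=> //.
  apply: (iso_trans eZ); apply: iso_trans (osumA _ _ _).
  exact: osum_iso e (iso_refl _).
exact: IH d d2 (iso_refl _).
Qed.

End Biproducts.

Section Kronecker.
Variables (F : fieldType) (k : nat).

Section Def.
Variables (r : nat) (a : bool -> 'M[F]_r).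

Fact kron0 s j : srg_fam (k := k) (ar (zobj F)) (fun=> 0) a (fun=> 0) s j
  *m srg_fam (ar (zobj F)) (fun=> 0) a (fun=> 0) s j.+1 = 0.
Proof. by apply: srg0 => *; rewrite ?mulmx0 ?mul0mx. Qed.

Definition kron : obj F := Obj kron0.

Lemma kron_dimo j : j != k.+2 -> j != k.+3 -> dm kron j = 0%N.
Proof. by move=> n2 n3; rewrite /= srg_dimo. Qed.
Lemma kron_dim2 : dm kron k.+2 = r. Proof. exact: srg_dim2. Qed.
Lemma kron_dim3 : dm kron k.+3 = r. Proof. exact: srg_dim3. Qed.
Lemma kron_ar2 s : ar kron s k.+2 = sw _ _ (a s). Proof. exact: srg_fam2. Qed.

End Def.

Lemma kron_iso r (a : bool -> 'M[F]_r) X (P : 'M[F]_(dm X k.+2, r)) (P' : 'M[F]_(r, dm X k.+2))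
    (Q : 'M[F]_(dm X k.+3, r)) (Q' : 'M[F]_(r, dm X k.+3)) :
  P' *m P = 1%:M -> P *m P' = 1%:M -> Q' *m Q = 1%:M -> Q *m Q' = 1%:M ->
  (forall j, j != k.+2 -> j != k.+3 -> dm X j = 0%N) ->
  (forall s, P *m a s = ar X s k.+2 *m Q) -> iso (kron a) X.
Proof.
move=> P'P PP' Q'Q QQ' zX e.
have [f [fo f2 f3]] := override2 (k := k) (fun j => 0 : 'M[F]_(dm X j, dm (kron a) j))
  (P *m idm F _ _) (Q *m idm F _ _).
have [g [go g2 g3]] := override2 (k := k) (fun j => 0 : 'M[F]_(dm (kron a) j, dm X j))
  (idm F _ _ *m P') (idm F _ _ *m Q').
exists f, g; split=> [s j|j|j].
- have [->|n2] := eqVneq j k.+2.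
    rewrite f2 f3 kron_ar2 -mulmxA idm_sw ?kron_dim2 // !mulmxA e //.
  have [->|n3] := eqVneq j k.+3; last by apply: mx0_eq; rewrite zX.
  by apply: mx0_eq; apply/orP; right; apply/eqP/kron_dimo; lia.
- have [->|n2] := eqVneq j k.+2.
    by rewrite f2 g2 mulmxA -(mulmxA _ P') P'P mulmx1 idmK // kron_dim2.
  have [->|n3] := eqVneq j k.+3; last by apply: mx0_eq; rewrite kron_dimo.
  by rewrite f3 g3 mulmxA -(mulmxA _ Q') Q'Q mulmx1 idmK // kron_dim3.
- have [->|n2] := eqVneq j k.+2.
    by rewrite f2 g2 mulmxA -(mulmxA P) idmK ?mulmx1 // kron_dim2.
  have [->|n3] := eqVneq j k.+3; last by apply: mx0_eq; rewrite zX.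
  by rewrite f3 g3 mulmxA -(mulmxA Q) idmK ?mulmx1 // kron_dim3.
Qed.

Lemma kron_sum p q (a : bool -> 'M[F]_p) (b : bool -> 'M[F]_q) :
  iso (kron (fun s => block_mx (a s) 0 0 (b s))) (osum (kron a) (kron b)).
Proof.
have e2 : dm (osum (kron a) (kron b)) k.+2 = (p + q)%N by rewrite /= !srg_dim2.
have e3 : dm (osum (kron a) (kron b)) k.+3 = (p + q)%N by rewrite /= !srg_dim3.
apply: (@kron_iso _ _ _ (idm F _ _) (idm F _ _) (idm F _ _) (idm F _ _)).
- exact/idmK/esym.
- exact/idmK.
- exact/idmK/esym.
- exact/idmK.
- by move=> j n2 n3; rewrite [LHS]/= !srg_dimo.
move=> s; rewrite [ar (osum _ _) s _]/= !srg_fam2.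
rewrite -sw_block ?srg_dim2 ?srg_dim3 // sw_idm //.
Qed.

Lemma kron_oband n (a : bool -> 'M[F]_1) : (k < n)%N -> oband (pl (unit_place n k.+1)) (kron a).
Proof.
move=> kn; have e j : pl (unit_place n k.+1) j = nat_of_bool (j == k.+3).
  case: j => [|[|j]] //; rewrite plE /unit_place (place_tuple n (fun j => nat_of_bool (j.+1 == k.+1))).
  by case: j => // j; case: ltnP => //; case: eqP => // -[->]; lia.
split=> [j|s j]; rewrite !e.
  have [->|n2] := eqVneq j k.+2; first by rewrite kron_dim2 eqxx; lia.
  have [->|n3] := eqVneq j k.+3; first by rewrite kron_dim3; lia.
  by rewrite kron_dimo //; lia.
have [->|n2] := eqVneq j k.+2.
  by rewrite eqxx; apply: leq_trans (rank_leq_row _) _; rewrite kron_dim2.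
have [->|n3] := eqVneq j k.+3.
  by apply: leq_trans (rank_leq_col _) _; rewrite kron_dimo; lia.
by apply: leq_trans (rank_leq_row _) _; rewrite kron_dimo.
Qed.

(** The arrow of rank one joins the two one-dimensional spaces; its rank lies in a single summand,
    which therefore contains both spaces. *)
Lemma kron_indec (a : bool -> 'M[F]_1) : a false = 1%:M -> oindec (kron a).
Proof.
move=> a1; split=> [/(_ k.+2)|X1 X2 e]; first by rewrite kron_dim2.
have d := iso_dim e; have := iso_rank e false k.+2; rewrite rank_osum kron_ar2 a1.
have -> : \rank (sw (dm (kron a) k.+2) (dm (kron a) k.+3) (1%:M : 'M[F]_1)) = 1%N.
  by rewrite rank_sw ?mxrank1 ?kron_dim2 ?kron_dim3.
have := d k.+2; have := d k.+3; rewrite kron_dim2 kron_dim3 /= => d3 d2.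
have := rank_leq_row (ar X1 false k.+2); have := rank_leq_row (ar X2 false k.+2).
have := rank_leq_col (ar X1 false k.+2); have := rank_leq_col (ar X2 false k.+2).
move: (\rank _) (\rank _) => u v h1 h2 h3 h4 h5.
have z j : j != k.+2 -> j != k.+3 -> dm X1 j = 0%N /\ dm X2 j = 0%N.
  by move=> n2 n3; have := d j; rewrite kron_dimo //=; lia.
have [zz|nz] := eqVneq (dm X1 k.+2) 0%N.
  left=> j; have [->|n2] := eqVneq j k.+2; first by [].
  have [->|n3] := eqVneq j k.+3; first by lia.
  by case: (z j n2 n3).
right=> j; have [->|n2] := eqVneq j k.+2; first by lia.
have [->|n3] := eqVneq j k.+3; first by lia.
by case: (z j n2 n3).
Qed.

Lemma kron_odec n r (d : 'rV[F]_r) (a : bool -> 'M[F]_r) : (k < n)%N ->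
  a true = diag_mx d -> a false = 1%:M ->
  odec (@noP F) (nseq r (unit_place n k.+1)) (kron a).
Proof.
move=> kn; elim: r d a => [|r IH] d a at_ af.
  move=> j; have [->|n2] := eqVneq j k.+2; first by rewrite kron_dim2.
  have [->|n3] := eqVneq j k.+3; first by rewrite kron_dim3.
  by rewrite kron_dimo.
pose d1 := lsubmx (d : 'rV_(1 + r)); pose d2 := rsubmx (d : 'rV_(1 + r)).
pose a1 s : 'M[F]_1 := if s then diag_mx d1 else 1%:M.
pose a2 s : 'M[F]_r := if s then diag_mx d2 else 1%:M.
exists (kron a1), (kron a2); split.
- by split=> //; apply: kron_oband.
- exact: kron_indec.
- apply: (iso_trans _ (kron_sum a1 a2)).
  apply: (@kron_iso _ _ (kron _) (idm F _ _) (idm F _ _) (idm F _ _) (idm F _ _)).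
  + exact/idmK/esym/kron_dim2.
  + exact/idmK/kron_dim2.
  + exact/idmK/esym/kron_dim3.
  + exact/idmK/kron_dim3.
  + by move=> j n2 n3; rewrite kron_dimo.
  move=> s; rewrite kron_ar2 sw_idm ?kron_dim3 //; congr (_ *m _).
  case: s => /=; last by rewrite af -[RHS](@scalar_mx_block F 1 r).
  by rewrite at_ -diag_mx_row hsubmxK.
- exact: (IH d2 a2 erefl erefl).
Qed.

End Kronecker.

Section BandSplitting.
Variables (F : fieldType) (k p r : nat).

(** The rank of [A] is exactly p, so A = R C with inner dimension p, and both factors of (B R) (C V)
    are invertible. *)
Lemma rank_factor m n (A : 'M[F]_(m, n)) (B : 'M[F]_(p, m)) (V : 'M[F]_(n, p)) :
  (\rank A <= p)%N -> B *m A *m V \in unitmx ->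
  A *m V *m invmx (B *m A *m V) *m B *m A = A.
Proof.
move=> rA uD; have e : \rank A = p.
  apply/eqP; rewrite eqn_leq rA /=.
  have := mxrank_unit uD => <-.
  by apply: leq_trans (mxrankM_maxl _ _) _; apply: mxrankM_maxr.
have AE := mulmx_base A; move: (col_base A) (row_base A) AE.
rewrite e => R C AE.
have DE : B *m A *m V = (B *m R) *m (C *m V) by rewrite -AE !mulmxA.
have /andP[uB uV] : (B *m R \in unitmx) && (C *m V \in unitmx).
  by rewrite -unitmx_mul -DE.
have h : (C *m V) *m invmx (B *m A *m V) *m (B *m R) = 1%:M.
  apply: (can_inj (mulKmx uB)); rewrite mulmx1 (mulmxA (B *m R)) (mulmxA (B *m R) (C *m V)).
  by rewrite -DE mulmxV // mul1mx.
have := congr1 (fun Z => R *m Z *m C) h.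
by rewrite mulmx1 AE !mulmxA AE -!mulmxA AE !mulmxA.
Qed.

Definition inj2 (s : bool) : 'M[F]_(p + p, p) := if s then col_mx 1%:M 0 else col_mx 0 1%:M.
Definition prj2 (s : bool) : 'M[F]_(p, p + p) := if s then row_mx 1%:M 0 else row_mx 0 1%:M.

Lemma prj2K s t : prj2 s *m inj2 t = (s == t)%:R%:M.
Proof.
by case: s; case: t; rewrite /= mul_row_col !(mulmx0, mul0mx, mulmx1, addr0, add0r) ?mulr0n ?raddf0.
Qed.

Lemma inj2K : inj2 true *m prj2 true + inj2 false *m prj2 false = 1%:M.
Proof.
by rewrite !mul_col_row !(mulmx0, mul0mx, mulmx1) add_block_mx !(addr0, add0r) -scalar_mx_block.
Qed.

Definition sumF m (f : bool -> 'M[F]_(p, m)) := inj2 true *m f true + inj2 false *m f false.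
Definition sumG m (g : bool -> 'M[F]_(m, p)) := g true *m prj2 true + g false *m prj2 false.

Lemma prj2F m (f : bool -> 'M[F]_(p, m)) s : prj2 s *m sumF f = f s.
Proof.
rewrite mulmxDr !mulmxA !prj2K !mul_scalar_mx.
by case: s; rewrite /= !scale1r !scale0r ?addr0 ?add0r.
Qed.

Lemma sumG_inj2 m (g : bool -> 'M[F]_(m, p)) s : sumG g *m inj2 s = g s.
Proof.
rewrite mulmxDl -!mulmxA !prj2K !mul_mx_scalar.
by case: s; rewrite /= !scale1r !scale0r ?addr0 ?add0r.
Qed.

Lemma sumFG m (f : bool -> 'M[F]_(p, m)) (g : bool -> 'M[F]_(m, p)) :
  (forall s t, f s *m g t = (s == t)%:R%:M) -> sumF f *m sumG g = 1%:M.
Proof.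
move=> e; rewrite mulmxDl !mulmxDr -!mulmxA !(mulmxA (f _)) !e !mul_scalar_mx.
by rewrite /= !scale1r !scale0r !mulmx0 addr0 add0r inj2K.
Qed.

(** The idempotent complementary to the retract given by [sumF] and [sumG]; [cplr] is the left
    inverse of [cpl f g *m G], that is, coordinates on its image. *)
Definition cpl m (f : bool -> 'M[F]_(p, m)) (g : bool -> 'M[F]_(m, p)) : 'M[F]_m :=
  1%:M - sumG g *m sumF f.
Definition cplr m (f : bool -> 'M[F]_(p, m)) (g : bool -> 'M[F]_(m, p))
    (G : 'M[F]_(m, r)) (H : 'M[F]_(r, m)) : 'M[F]_(r, m) :=
  invmx (H *m (cpl f g *m G)) *m H *m cpl f g.

Lemma complement_idem m (f : 'M[F]_(p + p, m)) (g : 'M[F]_(m, p + p)) (G : 'M[F]_(m, r))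
    (H : 'M[F]_(r, m)) (e := 1%:M - g *m f) (q := invmx (H *m (e *m G)) *m H *m e) :
  f *m g = 1%:M -> H *m (e *m G) \in unitmx -> m = (p + p + r)%N ->
  [/\ q *m (e *m G) = 1%:M, f *m (e *m G) = 0, q *m g = 0 & g *m f + (e *m G) *m q = 1%:M].
Proof.
move=> fg u d.
have fe : f *m e = 0 by rewrite mulmxBr mulmx1 mulmxA fg mul1mx subrr.
have eg : e *m g = 0 by rewrite mulmxBl mul1mx -mulmxA fg mulmx1 subrr.
have ee : e *m e = e by rewrite {2}/e mulmxBr mulmx1 mulmxA eg mul0mx subr0.
have q1 : q *m (e *m G) = 1%:M.
  by rewrite /q -!mulmxA (mulmxA e) ee mulVmx.
have f0 : f *m (e *m G) = 0 by rewrite mulmxA fe mul0mx.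
have q0 : q *m g = 0 by rewrite -mulmxA eg mulmx0.
split=> //.
have : col_mx f q *m row_mx g (e *m G) = 1%:M.
  by rewrite mul_col_row fg q1 f0 q0 -scalar_mx_block.
by move/(mulmx1C_dim (esym d)); rewrite mul_row_col.
Qed.

(** The outer arrows factor through the retract, so its complement carries nothing but a pair of r
    by r matrices. The projection onto the retract is returned as well: the converse construction
    needs it to recognize the retract inside a given sum. *)
Lemma retract_split (M : obj F) (f3 : bool -> 'M[F]_(p, dm M k.+3)) (g3 : bool -> 'M[F]_(dm M k.+3, p))
    (f2 : bool -> 'M[F]_(p, dm M k.+2)) (g2 : bool -> 'M[F]_(dm M k.+2, p))
    (q3 : 'M[F]_(r, dm M k.+3)) (i3 : 'M[F]_(dm M k.+3, r))
    (q2 : 'M[F]_(r, dm M k.+2)) (i2 : 'M[F]_(dm M k.+2, r)) :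
  (forall s t, f3 s *m g3 t = (s == t)%:R%:M) ->
  (forall s t, f2 s *m g2 t = (s == t)%:R%:M) ->
  (forall s, g3 s *m f3 s *m ar M s k.+3 = ar M s k.+3) ->
  (forall s, ar M s k.+1 *m g2 s *m f2 s = ar M s k.+1) ->
  (forall s, f3 (~~ s) *m ar M s k.+3 = 0) ->
  (forall s, ar M s k.+1 *m g2 (~~ s) = 0) ->
  (forall s t, ar M s k.+2 *m g3 t = (t == ~~ s)%:R *: g2 (~~ s)) ->
  (forall s t, f2 t *m ar M s k.+2 = (t == ~~ s)%:R *: f3 (~~ s)) ->
  [/\ q3 *m i3 = 1%:M, sumF f3 *m i3 = 0, q3 *m sumG g3 = 0 & sumG g3 *m sumF f3 + i3 *m q3 = 1%:M] ->
  [/\ q2 *m i2 = 1%:M, sumF f2 *m i2 = 0, q2 *m sumG g2 = 0 & sumG g2 *m sumF f2 + i2 *m q2 = 1%:M] ->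
  let fam := srg_fam (k := k) (ar M) (fun s => ar M s k.+1 *m g2 s *m prj2 s)
    (fun s => inj2 (~~ s) *m prj2 (~~ s)) (fun s => inj2 s *m f3 s *m ar M s k.+3) in
  exists h0 : forall s j, fam s j *m fam s j.+1 = 0,
    iso M (osum (Obj h0) (kron k (fun s => q2 *m ar M s k.+2 *m i3))) /\
    exists f : forall j, 'M_(dm (Obj h0) j, dm M j), exists g,
      [/\ @ohom F M (Obj h0) f, forall j, f j *m g j = 1%:M,
          f k.+2 = idm F _ _ *m sumF f2 & f k.+3 = idm F _ _ *m sumF f3].
Proof.
move=> f3g3 f2g2 agf ogf f3a og mg fm [q3i f3i q3g c3] [q2i f2i q2g c2] fam.
have F3a s : sumF f3 *m ar M s k.+3 = inj2 s *m f3 s *m ar M s k.+3.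
  rewrite mulmxDl -!mulmxA; have := f3a s.
  by case: s => /= ->; rewrite mulmx0 ?addr0 ?add0r.
have F2m s : sumF f2 *m ar M s k.+2 = inj2 (~~ s) *m prj2 (~~ s) *m sumF f3.
  rewrite -mulmxA prj2F mulmxDl -!mulmxA !fm.
  by case: s; rewrite /= !scale1r !scale0r mulmx0 ?addr0 ?add0r.
have mG3 s : ar M s k.+2 *m sumG g3 = sumG g2 *m inj2 (~~ s) *m prj2 (~~ s).
  rewrite sumG_inj2 mulmxDr !mulmxA !mg.
  by case: s; rewrite /= !scale1r !scale0r mul0mx ?addr0 ?add0r.
have oF2 s : ar M s k.+1 *m g2 s *m prj2 s *m sumF f2 = ar M s k.+1 by rewrite -mulmxA prj2F ogf.
have GFa s : sumG g3 *m sumF f3 *m ar M s k.+3 = ar M s k.+3.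
  by rewrite -mulmxA F3a !mulmxA sumG_inj2 agf.
have h0 s j : fam s j *m fam s j.+1 = 0.
  apply: srg0 => {j}{}s.
  - exact: ar0.
  - by rewrite !mulmxA ar0 !mul0mx.
  - by rewrite -!mulmxA (mulmxA (prj2 s)) prj2K; case: s; rewrite /= mulr0n raddf0 mul0mx !mulmx0.
  - by rewrite -!mulmxA (mulmxA (prj2 _)) prj2K; case: s; rewrite /= mulr0n raddf0 mul0mx !mulmx0.
  - by rewrite -!mulmxA ar0 !mulmx0.
exists h0; set N := Obj h0; set K := kron k _.
have d2 : dm N k.+2 = (p + p)%N by apply: srg_dim2.
have d3 : dm N k.+3 = (p + p)%N by apply: srg_dim3.
have do_ j : j != k.+2 -> j != k.+3 -> dm N j = dm M j by apply: srg_dimo.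
have [f [fo fY fX]] := override2 (k := k) (fun j => idm F (dm N j) (dm M j))
  (idm F _ _ *m sumF f2) (idm F _ _ *m sumF f3).
have [g [go gY gX]] := override2 (k := k) (fun j => idm F (dm M j) (dm N j))
  (sumG g2 *m idm F _ _) (sumG g3 *m idm F _ _).
have [q [qo qY qX]] := override2 (k := k) (fun j => 0 : 'M[F]_(dm K j, dm M j))
  (idm F _ _ *m q2) (idm F _ _ *m q3).
have [i [io iY iX]] := override2 (k := k) (fun j => 0 : 'M[F]_(dm M j, dm K j))
  (i2 *m idm F _ _) (i3 *m idm F _ _).
have three (P : nat -> Prop) : (forall j, j != k.+2 -> j != k.+3 -> P j) ->
    P k.+2 -> P k.+3 -> forall j, P j.
  move=> Po P2 P3 j; have [->|n2] := eqVneq j k.+2; first by [].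
  by have [->|n3] := eqVneq j k.+3; [|apply: Po].
have hf : @ohom F M N f.
  move=> s j; have [->|n1] := eqVneq j k.+1.
    rewrite fY fo; try lia.
    rewrite [ar N _ _]srg_fam1 mulmxA sw_idm; last exact: srg_dim2.
    by rewrite -mulmxA oF2.
  have [->|n2] := eqVneq j k.+2.
    rewrite fY fX [ar N _ _]srg_fam2 mulmxA sw_idm; last exact: srg_dim3.
    by rewrite -!mulmxA F2m !mulmxA.
  have [->|n3] := eqVneq j k.+3.
    rewrite fX fo; try lia.
    rewrite [ar N _ _]srg_fam3 -mulmxA F3a sw_idm //; apply: do_; lia.
  rewrite !fo; try lia.
  rewrite [ar N _ _]srg_famo // sw_idm //; apply: do_; lia.
have fg j : f j *m g j = 1%:M.
  move: j; apply: three => [j n2 n3||]; first by rewrite fo // go // idmK // do_.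
    by rewrite fY gY mulmxA -(mulmxA _ (sumF f2)) (sumFG f2g2) mulmx1 idmK.
  by rewrite fX gX mulmxA -(mulmxA _ (sumF f3)) (sumFG f3g3) mulmx1 idmK.
split; last by exists f, g.
apply: (@biproduct _ M N K f g q i) => //.
- move=> s j; have [->|n1] := eqVneq j k.+1.
    by apply: mx0_eq; rewrite kron_dimo //; lia.
  have [->|n2] := eqVneq j k.+2.
    rewrite qY qX kron_ar2 mulmxA sw_idm; last exact: kron_dim3.
    rewrite -(mulmxA (idm F _ _)) -(mulmxA _ _ q3); congr (_ *m _).
    rewrite -[LHS]mulmx1 -c3 mulmxDr !mulmxA -(mulmxA q2 _ (sumG g3)) mG3 !mulmxA q2g.
    by rewrite !mul0mx add0r.
  have [->|n3] := eqVneq j k.+3; last by apply: mx0_eq; rewrite kron_dimo.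
  rewrite qX qo; try lia.
  by rewrite mulmx0 -GFa !mulmxA -(mulmxA _ q3) q3g mulmx0 !mul0mx.
- apply: three => [j n2 n3||]; first by apply: mx0_eq; rewrite kron_dimo.
    by rewrite qY iY mulmxA -(mulmxA _ q2) q2i mulmx1 idmK // kron_dim2.
  by rewrite qX iX mulmxA -(mulmxA _ q3) q3i mulmx1 idmK // kron_dim3.
- apply: three => [j n2 n3||]; first by rewrite io // mulmx0.
    by rewrite fY iY mulmxA -(mulmxA _ (sumF f2)) f2i mulmx0 mul0mx.
  by rewrite fX iX mulmxA -(mulmxA _ (sumF f3)) f3i mulmx0 mul0mx.
- apply: three => [j n2 n3||]; first by rewrite qo // mul0mx.
    by rewrite qY gY mulmxA -(mulmxA _ q2) q2g mulmx0 mul0mx.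
  by rewrite qX gX mulmxA -(mulmxA _ q3) q3g mulmx0 mul0mx.
- apply: three => [j n2 n3||].
  + by rewrite fo // go // io // mul0mx addr0 idmK // do_.
  + rewrite fY gY iY qY !mulmxA -(mulmxA (sumG g2)) idmK // mulmx1.
    by rewrite -(mulmxA i2) idmK ?mulmx1 ?c2 // kron_dim2.
  + rewrite fX gX iX qX !mulmxA -(mulmxA (sumG g3)) idmK // mulmx1.
    by rewrite -(mulmxA i3) idmK ?mulmx1 ?c3 // kron_dim3.
Qed.

(* U and V are chosen so that the path bsD of length three is invertible; then *)
(* sumF and sumG of the f and g split 2p-dimensional parts off F_{k+2} and    *)
(* F_{k+3}, and G, H coordinatize the r-dimensional complements.              *)
Section Formulas.
Variables (d : nat -> nat) (W : bool -> forall j, 'M[F]_(d j, d j.+1)).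
Variables (U : bool -> 'M[F]_(p, d k.+1)) (V : bool -> 'M[F]_(d k.+4, p)).
Variables (G2 : 'M[F]_(d k.+2, r)) (H2 : 'M[F]_(r, d k.+2)).
Variables (G3 : 'M[F]_(d k.+3, r)) (H3 : 'M[F]_(r, d k.+3)).

Definition bsD s : 'M[F]_p := U s *m W s k.+1 *m W (~~ s) k.+2 *m W s k.+3 *m V s.
Definition bsf3 s := invmx (bsD s) *m (U s *m W s k.+1 *m W (~~ s) k.+2).
Definition bsg3 s := W s k.+3 *m V s.
Definition bsf2 s := invmx (bsD s) *m (U s *m W s k.+1).
Definition bsg2 s := W (~~ s) k.+2 *m bsg3 s.

Definition bs_fam := srg_fam (k := k) W (fun s => W s k.+1 *m bsg2 s *m prj2 s)
  (fun s => inj2 (~~ s) *m prj2 (~~ s)) (fun s => inj2 s *m bsf3 s *m W s k.+3).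

Definition bsK s := cplr bsf2 bsg2 G2 H2 *m W s k.+2 *m (cpl bsf3 bsg3 *m G3).

End Formulas.

(** Invertibility of [bsD s] forces rank exactly p on the outer arrows, so [rank_factor] recovers
    them from the path of length three. The mixed products vanish because they contain two
    consecutive arrows of equal label. *)
Lemma band_split (M : obj F) U V G2 H2 G3 H3 :
  (forall s, bsD (ar M) U V s \in unitmx) ->
  H2 *m (cpl (bsf2 (ar M) U V) (bsg2 (ar M) V) *m G2) \in unitmx ->
  H3 *m (cpl (bsf3 (ar M) U V) (bsg3 (ar M) V) *m G3) \in unitmx ->
  (forall s, (\rank (ar M s k.+1) <= p)%N) -> (forall s, (\rank (ar M s k.+3) <= p)%N) ->
  dm M k.+2 = (p + p + r)%N -> dm M k.+3 = (p + p + r)%N ->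
  exists h0 : forall s j, bs_fam (ar M) U V s j *m bs_fam (ar M) U V s j.+1 = 0,
    iso M (osum (Obj h0) (kron k (bsK (ar M) U V G2 H2 G3))) /\
    exists f : forall j, 'M_(dm (Obj h0) j, dm M j), exists g,
      [/\ @ohom F M (Obj h0) f, forall j, f j *m g j = 1%:M,
          f k.+2 = idm F _ _ *m sumF (bsf2 (ar M) U V)
        & f k.+3 = idm F _ _ *m sumF (bsf3 (ar M) U V)].
Proof.
move=> uD u2 u3 r1 r3 d2 d3.
have bneq (s t : bool) : s != t -> t = ~~ s by case: s; case: t.
have f3g3 s t : bsf3 (ar M) U V s *m bsg3 (ar M) V t = (s == t)%:R%:M.
  rewrite /bsf3 /bsg3 -!mulmxA.
  have [<-|/bneq->] := eqVneq s t.
    by have := mulVmx (uD s); rewrite /bsD -!mulmxA => ->.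
  by rewrite (mulmxA (ar M (~~ s) k.+2)) ar0 mul0mx !mulmx0 raddf0.
have f2g2 s t : bsf2 (ar M) U V s *m bsg2 (ar M) V t = (s == t)%:R%:M.
  rewrite /bsf2 /bsg2 /bsg3 -!mulmxA.
  have [<-|/bneq->] := eqVneq s t.
    by have := mulVmx (uD s); rewrite /bsD -!mulmxA => ->.
  by rewrite negbK (mulmxA (ar M s k.+1)) ar0 mul0mx !mulmx0 raddf0.
apply: retract_split => //.
- move=> s; have := @rank_factor _ _ (ar M s k.+3) (U s *m ar M s k.+1 *m ar M (~~ s) k.+2) (V s) (r3 s) (uD s).
  by rewrite /bsg3 /bsf3 /bsD !mulmxA.
- move=> s; have := @rank_factor _ _ (ar M s k.+1) (U s) (ar M (~~ s) k.+2 *m ar M s k.+3 *m V s) (r1 s).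
  by rewrite !mulmxA => /(_ (uD s)).
- by move=> s; rewrite /bsf3 negbK -!mulmxA ar0 !mulmx0.
- by move=> s; rewrite /bsg2 negbK mulmxA ar0 mul0mx.
- move=> s t; rewrite /bsg2 negbK /bsg3.
  have [->|] := eqVneq t (~~ s); first by rewrite scale1r.
  by rewrite bool_neqE negbK => /eqP->; rewrite scale0r mulmxA ar0 mul0mx.
- move=> s t; rewrite /bsf2 /bsf3 negbK.
  have [->|] := eqVneq t (~~ s); first by rewrite scale1r !mulmxA.
  by rewrite bool_neqE negbK => /eqP->; rewrite scale0r -!mulmxA ar0 !mulmx0.
- exact: (complement_idem (sumFG f3g3) u3 d3).
- exact: (complement_idem (sumFG f2g2) u2 d2).
Qed.

End BandSplitting.

(** * Diagonalizability from traces of powers *)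

Section Hankel.
Variable L : closedFieldType.

(** All eigenvalues vanish, so the characteristic polynomial is a power of 'X, and the trace is up
    to sign one of its lower coefficients. *)
Lemma nilpotent_trace r (N : 'M[L]_r.+1) m : N ^+ m = 0 -> \tr N = 0.
Proof.
move=> Nm; have [rs prs] := closed_field_poly_normal (char_poly N).
move: prs; rewrite (monicP (char_poly_monic N)) scale1r => prs.
have rs0 z : z \in rs -> z = 0.
  move=> zrs; have : eigenvalue N z.
    by rewrite eigenvalue_root_char prs root_prod_XsubC.
  move=> /eigenvalueP [v vN nz].
  have vNk k : v *m N ^+ k = z ^+ k *: v.
    elim: k => [|k IH]; first by rewrite !expr0 mulmx1 scale1r.
    by rewrite exprSr mulmxA IH -scalemxAl vN scalerA exprSr.
  have := vNk m; rewrite Nm mulmx0 => /esym/eqP; rewrite scaler_eq0 (negPf nz) orbF.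
  by rewrite expf_eq0 => /andP[_ /eqP].
have e : char_poly N = 'X^(size rs).
  rewrite prs; elim: rs rs0 {prs} => [|z rs IH] rs0; first by rewrite big_nil expr0.
  rewrite big_cons (rs0 z) ?mem_head // subr0 IH -?exprS // => y yrs.
  by apply: rs0; rewrite in_cons yrs orbT.
have sz : size rs = r.+1.
  by apply: succn_inj; rewrite -(size_char_poly N) e size_polyXn.
have := @char_poly_trace _ r.+1 N (ltn0Sn r); rewrite e sz coefXn /= => /esym/eqP.
by rewrite (ltn_eqF (ltnSn r)) oppr_eq0 => /eqP.
Qed.

(* The Hankel determinant of the power sums of the eigenvalues is the *)
(* discriminant of the characteristic polynomial. *)
Lemma hankel_diagonal r (A : 'M[L]_r) :
  \det (\matrix_(i < r, j < r) \tr (A ^+ (i + j))) != 0 ->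
  exists2 P, P \in unitmx & exists d, P *m A = diag_mx d *m P.
Proof.
case: r A => [|r] A h.
  by exists 1%:M; [exact: unitmx1 | exists 0; apply: mx0_eq].
have [rs prs] := closed_field_poly_normal (char_poly A).
move: prs; rewrite (monicP (char_poly_monic A)) scale1r => prs.
have sz : size rs = r.+1.
  by apply: succn_inj; rewrite -(size_char_poly A) prs size_prod_XsubC.
(* The radical of the characteristic polynomial: by Cayley-Hamilton its value at [A] is
   nilpotent. *)
pose q := \prod_(z <- undup rs) ('X - z%:P).
have dq : char_poly A %| q ^+ (size rs).
  have : forall z, z \in rs -> 'X - z%:P %| q.
    move=> z zrs; rewrite dvdp_XsubCl root_prod_XsubC mem_undup //.
  rewrite prs; elim: rs {prs sz} q => [|z rs IH] q dz; first by rewrite big_nil dvd1p.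
  rewrite big_cons exprS dvdp_mul ?dz ?mem_head //.
  by apply: IH => y yrs; apply: dz; rewrite in_cons yrs orbT.
have qA : horner_mx A q ^+ r.+1 = 0.
  have [u e] := dvdpP _ _ dq; rewrite -rmorphXn -sz e rmorphM /= Cayley_Hamilton mulr0 //.
(* With a repeated eigenvalue [q] has degree at most r, and its coefficient vector is a null vector
   of the Hankel matrix: entry j of the product is the trace of q(A) A^j, which is nilpotent. The
   vector is nonzero as [q] is monic. *)
have urs : uniq rs.
  apply: contraNT h; rewrite -ltn_size_undup sz ltnS => le.
  pose v : 'rV[L]_r.+1 := \row_i q`_i.
  apply/det0P; exists v.
    apply/eqP => /rowP /(_ (Ordinal (le : (size (undup rs) < r.+1)%N))).
    rewrite !mxE /=; have /monicP := monic_prod_XsubC (undup rs) predT id.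
    by rewrite lead_coefE size_prod_XsubC /= -/q => -> /eqP; rewrite oner_eq0.
  apply/rowP => j; rewrite !mxE.
  transitivity (\tr (horner_mx A (q * 'X^j))).
    have sq : (size q <= r.+1)%N by rewrite size_prod_XsubC ltnS.
    rewrite (_ : q = \sum_(i < r.+1) q`_i *: 'X^i).
      rewrite mulr_suml rmorph_sum raddf_sum; apply: eq_bigr => i _; rewrite !mxE.
      by rewrite -scalerAl -exprD /= horner_mxZ rmorphXn /= horner_mx_X mxtraceZ.
    rewrite -poly_def; apply/polyP=> i; rewrite coef_poly; case: ltnP => // gi.
    by rewrite nth_default // (leq_trans sq).
  apply: (@nilpotent_trace _ _ r.+1); rewrite -rmorphXn exprMn rmorphM /= rmorphXn /= qA mul0r //.
have e : undup rs = rs by apply: undup_id.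
have : exists2 rs' : seq L, uniq rs' & (mxminpoly A %| \prod_(x <- rs') ('X - x%:P))%R.
  by exists rs => //; rewrite -prs; apply/mxminpoly_min/Cayley_Hamilton.
move=> /diagonalizableP [P uP]; rewrite /similar_to conjumx // => /diag_mxP [d PA].
by exists P => //; exists d; rewrite -PA mulmxKV.
Qed.
End Hankel.

(** * Polynomial and rational functions *)

Section PolynomialFunctions.
Variables (K L : fieldType) (em : {rmorphism K -> L}).

(* Polynomial functions over K, in variables from V, with values in L. *)
Inductive pf (V : Type) : ((V -> L) -> L) -> Prop :=
| pf_var x : pf (fun v => v x)
| pf_cst c : pf (fun=> em c)
| pf_add f g : pf f -> pf g -> pf (fun v => f v + g v)
| pf_mul f g : pf f -> pf g -> pf (fun v => f v * g v)
| pf_eq f g : pf f -> f =1 g -> pf g.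

Lemma pf_ext V (f : (V -> L) -> L) v w : pf f -> v =1 w -> f v = f w.
Proof.
move=> pff e; elim: pff => //.
- by move=> f' g _ -> _ ->.
- by move=> f' g _ -> _ ->.
- by move=> f' g _ h fg; rewrite -!fg.
Qed.

Lemma pf_subst V V' (h : V -> (V' -> L) -> L) f :
  pf f -> (forall x, pf (h x)) -> pf (fun v => f (fun x => h x v)).
Proof.
move=> pff ph; elim: pff => [x|c|f' g _ pf' _ pg|f' g _ pf' _ pg|f' g _ pf' e] //.
- exact: pf_cst.
- exact: pf_add.
- exact: pf_mul.
- by apply: pf_eq pf' _.
Qed.

(** The parameters are indexed by an infinite type, but a polynomial function depends on finitely
    many of them, so that they can be specialized one after another. *)
Lemma pf_supp (U : eqType) C (f : (U + C -> L) -> L) : pf f -> exists s : seq U,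
  forall v w : U + C -> L, (forall c, v (inr c) = w (inr c)) ->
    (forall x, x \in s -> v (inl x) = w (inl x)) -> f v = f w.
Proof.
elim=> [[x|x]|c|f' g _ [s hs] _ [t ht]|f' g _ [s hs] _ [t ht]|f' g _ [s hs] e].
- by exists [:: x] => v w _ h; apply/h/mem_head.
- by exists [::] => v w h _.
- by exists [::].
- exists (s ++ t) => v w h h'; congr (_ + _).
    by apply: hs => // x xs; apply: h'; rewrite mem_cat xs.
  by apply: ht => // x xs; apply: h'; rewrite mem_cat xs orbT.
- exists (s ++ t) => v w h h'; congr (_ * _).
    by apply: hs => // x xs; apply: h'; rewrite mem_cat xs.
  by apply: ht => // x xs; apply: h'; rewrite mem_cat xs orbT.
- by exists s => v w h h1; rewrite -!e; apply: hs.
Qed.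

Lemma pf_line V (f : (V -> L) -> L) (a b : V -> L) : pf f ->
  exists p : {poly L}, forall t, f (fun x => a x + t * b x) = p.[t].
Proof.
elim=> [x|c|f' g _ [p hp] _ [q hq]|f' g _ [p hp] _ [q hq]|f' g _ [p hp] e].
- by exists ((a x)%:P + (b x) *: 'X) => t; rewrite !hornerE mulrC.
- by exists (em c)%:P => t; rewrite hornerC.
- by exists (p + q) => t; rewrite hornerD hp hq.
- by exists (p * q) => t; rewrite hornerM hp hq.
- by exists p => t; rewrite -e.
Qed.

Lemma pf_exp V (f : (V -> L) -> L) m : pf f -> pf (fun v => f v ^+ m).
Proof.
move=> pff; elim: m => [|m IH].
  by apply: pf_eq (pf_cst _ 1) _ => v; rewrite rmorph1.
by apply: pf_eq (pf_mul pff IH) _ => v; rewrite exprS.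
Qed.

Lemma pf_prod V (I : Type) (r : seq I) (F : I -> (V -> L) -> L) :
  (forall i, pf (F i)) -> pf (fun v => \prod_(i <- r) F i v).
Proof.
move=> pF; elim: r => [|i r IH].
  by apply: pf_eq (pf_cst _ 1) _ => v; rewrite rmorph1 big_nil.
by apply: pf_eq (pf_mul (pF i) IH) _ => v; rewrite big_cons.
Qed.

Lemma pf_sum V (I : Type) (r : seq I) (F : I -> (V -> L) -> L) :
  (forall i, pf (F i)) -> pf (fun v => \sum_(i <- r) F i v).
Proof.
move=> pF; elim: r => [|i r IH].
  by apply: pf_eq (pf_cst _ 0) _ => v; rewrite rmorph0 big_nil.
by apply: pf_eq (pf_add (pF i) IH) _ => v; rewrite big_cons.
Qed.

Section Kpoints.
Hypothesis charK0 : [pchar K] =i pred0.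

(** In characteristic 0 the integers give more distinct elements of K than the polynomial has
    roots. *)
Lemma nonroot_K (p : {poly L}) : p != 0 -> exists c : K, p.[em c] != 0.
Proof.
move=> nz; pose rs := [seq em n%:R | n <- iota 0 (size p)].
have [/allP h|] := boolP (all (root p) rs); last first.
  by rewrite -has_predC => /hasP [x /mapP [n _ ->] /= h]; exists n%:R.
have : (size rs < size p)%N.
  apply: max_poly_roots => //; first exact/allP.
  rewrite map_inj_in_uniq ?iota_uniq // => m n _ _ /fmorph_inj e.
  suff inj : forall m n, (m <= n)%N -> m%:R = n%:R :> K -> m = n.
    by case/orP: (leq_total m n) => le; [apply: inj | apply/esym/inj].
  move=> {}m {}n le {}e; have := (pcharf0P K).1 charK0 (n - m)%N.
  by rewrite natrB // e subrr eqxx => /esym/eqP; lia.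
by rewrite size_map size_iota ltnn.
Qed.

(** The parameters in the support are moved into K one at a time. On the line that varies a single
    parameter the function is a nonzero polynomial in one variable, hence nonzero at some element of
    K. *)
Lemma Kpoint (U : eqType) C (f : (U + C -> L) -> L) v0 : pf f -> f v0 != 0 ->
  exists u : U -> K, f (fun x => match x with inl a => em (u a) | inr c => v0 (inr c) end) != 0.
Proof.
move=> pff f0; have [s hs] := pf_supp pff.
pose mix (t : seq U) (u : U -> K) x := match x with
  | inl a => if a \in t then em (u a) else v0 (inl a) | inr c => v0 (inr c) end.
suff [u hu] : exists u, f (mix s u) != 0.
  by exists u; rewrite (hs _ (mix s u)) // => x /= ->.
elim: s {hs} => [|a s [u hu]].
  by exists (fun=> 0); rewrite (pf_ext (w := v0) pff) //; case.
pose e (x : U + C) : L := match x with inl b => (b == a)%:R | inr _ => 0 end.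
pose b x := mix s u x - mix s u (inl a) * e x.
have [p hp] := pf_line b e pff.
have nz : p != 0.
  apply: contraNneq hu => p0.
  rewrite (pf_ext (w := fun x => b x + mix s u (inl a) * e x) pff).
    by rewrite hp p0 horner0.
  by move=> x; rewrite subrK.
have [c hc] := nonroot_K nz.
exists (fun b => if b == a then c else u b).
rewrite (pf_ext (w := fun x => b x + em c * e x) pff) ?hp // => -[y|y]; rewrite /b /=.
  rewrite in_cons; case: (eqVneq y a) => [->|_] /=; last by rewrite !mulr0 subr0 addr0.
  by rewrite !mulr1 subrr add0r.
by rewrite !mulr0 subr0 addr0.
Qed.

End Kpoints.

Lemma pf_mpoly (V : finType) (f : (V -> L) -> L) : pf f ->
  exists q : {mpoly K[#|V|]}, forall v, mmap em (fun k => v (enum_val k)) q = f v.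
Proof.
elim=> [x|c|f' g _ [p hp] _ [q hq]|f' g _ [p hp] _ [q hq]|f' g _ [p hp] e].
- by exists ('X_(enum_rank x)) => v; rewrite mmapX mmap1U enum_rankK.
- by exists (c%:MP) => v; rewrite mmapC.
- by exists (p + q) => v; rewrite mmapD hp hq.
- by exists (p * q) => v; rewrite rmorphM /= hp hq.
- by exists p => v; rewrite -e.
Qed.

(** One numerator and one denominator serve for all of [D]. Hence the locus in a principal open set
    where a rational function does not vanish is again principal open, see [popen_rfn]. *)
Definition rfn V (D : (V -> L) -> Prop) (f : (V -> L) -> L) : Prop :=
  exists p q, [/\ pf p, pf q & forall v, D v -> q v != 0 /\ f v = p v / q v].

Definition popen V (D : (V -> L) -> Prop) : Prop :=
  exists2 q, pf q & forall v, D v <-> q v != 0.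

Section Rational.
Variables (V : Type) (D : (V -> L) -> Prop).

Lemma rfn_pf f : pf f -> rfn D f.
Proof.
move=> h; exists f, (fun=> em 1); split=> //; first exact: pf_cst.
by move=> v _; rewrite rmorph1 oner_neq0 divr1.
Qed.

Lemma rfn_eq f g : rfn D f -> (forall v, D v -> f v = g v) -> rfn D g.
Proof.
by move=> [p [q [pp pq h]]] e; exists p, q; split=> // v dv; rewrite -e //; apply: h.
Qed.

Lemma rfn_cst c : rfn D (fun=> em c).
Proof. exact/rfn_pf/pf_cst. Qed.

Lemma rfn_nat m : rfn D (fun=> m%:R).
Proof. by apply: rfn_eq (rfn_cst m%:R) _ => v _; rewrite rmorph_nat. Qed.

Lemma rfn_add f g : rfn D f -> rfn D g -> rfn D (fun v => f v + g v).
Proof.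
move=> [p [q [pp pq h]]] [p' [q' [pp' pq' h']]].
exists (fun v => p v * q' v + p' v * q v), (fun v => q v * q' v); split.
- by apply: pf_add; apply: pf_mul.
- exact: pf_mul.
move=> v dv; have [n e] := h v dv; have [n' e'] := h' v dv.
by rewrite mulf_neq0 // e e' addf_div.
Qed.

Lemma rfn_mul f g : rfn D f -> rfn D g -> rfn D (fun v => f v * g v).
Proof.
move=> [p [q [pp pq h]]] [p' [q' [pp' pq' h']]].
exists (fun v => p v * p' v), (fun v => q v * q' v); split; try exact: pf_mul.
move=> v dv; have [n e] := h v dv; have [n' e'] := h' v dv.
by rewrite mulf_neq0 // e e' mulf_div.
Qed.

Lemma rfn_inv f : rfn D f -> (forall v, D v -> f v != 0) -> rfn D (fun v => (f v)^-1).
Proof.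
move=> [p [q [pp pq h]]] nz; exists q, p; split=> // v dv.
have [n e] := h v dv; have := nz v dv; rewrite e mulf_eq0 negb_or => /andP[-> _].
by rewrite invf_div.
Qed.

Lemma rfn_opp f : rfn D f -> rfn D (fun v => - f v).
Proof.
by move=> h; apply: rfn_eq (rfn_mul (rfn_cst (-1)) h) _ => v _; rewrite rmorphN1 mulN1r.
Qed.

Lemma rfn_sum I (r : seq I) (P : pred I) F :
  (forall i, P i -> rfn D (F i)) -> rfn D (fun v => \sum_(i <- r | P i) F i v).
Proof.
move=> pF; elim: r => [|i r IH].
  by apply: rfn_eq (rfn_nat 0) _ => v _; rewrite big_nil.
case: (boolP (P i)) => Pi; last by apply: rfn_eq IH _ => v _; rewrite big_cons (negPf Pi).
by apply: rfn_eq (rfn_add (pF i Pi) IH) _ => v _; rewrite big_cons Pi.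
Qed.

Lemma rfn_prod I (r : seq I) (P : pred I) F :
  (forall i, P i -> rfn D (F i)) -> rfn D (fun v => \prod_(i <- r | P i) F i v).
Proof.
move=> pF; elim: r => [|i r IH].
  by apply: rfn_eq (rfn_nat 1) _ => v _; rewrite big_nil.
case: (boolP (P i)) => Pi; last by apply: rfn_eq IH _ => v _; rewrite big_cons (negPf Pi).
by apply: rfn_eq (rfn_mul (pF i Pi) IH) _ => v _; rewrite big_cons Pi.
Qed.

Lemma rfn_pf_comp W (f : (W -> L) -> L) (h : W -> (V -> L) -> L) :
  pf f -> (forall x, rfn D (h x)) -> rfn D (fun v => f (fun x => h x v)).
Proof.
move=> pff ph; elim: pff => [x|c|f' g _ pf' _ pg|f' g _ pf' _ pg|f' g _ pf' e] //.
- exact: rfn_cst.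
- exact: rfn_add.
- exact: rfn_mul.
- by apply: rfn_eq pf' _.
Qed.

Lemma popen_rfn f : popen D -> rfn D f -> popen (fun v => D v /\ f v != 0).
Proof.
move=> [d pd Dd] [p [q [pp pq h]]]; exists (fun v => d v * p v); first exact: pf_mul.
move=> v; rewrite mulf_eq0 negb_or; split=> [[dv]|/andP[/Dd dv nz]].
  have [n ->] := h v dv; rewrite mulf_eq0 negb_or => /andP[-> _].
  by rewrite andbT; apply/Dd.
by split=> //; have [n ->] := h v dv; rewrite mulf_neq0 // invr_eq0.
Qed.

Lemma rfn_sub (E : (V -> L) -> Prop) f : (forall v, E v -> D v) -> rfn D f -> rfn E f.
Proof. by move=> s [p [q [pp pq h]]]; exists p, q; split=> // v /s; apply: h. Qed.

Definition rmx m n (F : (V -> L) -> 'M[L]_(m, n)) : Prop :=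
  forall i j, rfn D (fun v => F v i j).

Lemma rmx_eq m n (F G : (V -> L) -> 'M[L]_(m, n)) :
  rmx F -> (forall v, D v -> F v = G v) -> rmx G.
Proof. by move=> h e i j; apply: rfn_eq (h i j) _ => v dv; rewrite e. Qed.

Lemma rmx_var p q (c : 'I_p -> 'I_q -> V) : rmx (fun v => \matrix_(i, j) v (c i j)).
Proof. by move=> i j; apply: rfn_eq (rfn_pf (pf_var (c i j))) _ => v _; rewrite mxE. Qed.

Lemma rmx_mul m n p (F : (V -> L) -> 'M[L]_(m, n)) (G : (V -> L) -> 'M[L]_(n, p)) :
  rmx F -> rmx G -> rmx (fun v => F v *m G v).
Proof.
move=> hF hG i j; apply: (@rfn_eq (fun v => \sum_k F v i k * G v k j)).
  by apply: rfn_sum => k _; apply: rfn_mul.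
by move=> v _; rewrite mxE.
Qed.

Lemma rmx_add m n (F G : (V -> L) -> 'M[L]_(m, n)) :
  rmx F -> rmx G -> rmx (fun v => F v + G v).
Proof.
by move=> hF hG i j; apply: rfn_eq (rfn_add (hF i j) (hG i j)) _ => v _; rewrite mxE.
Qed.

Lemma rmx_sub m n (F G : (V -> L) -> 'M[L]_(m, n)) :
  rmx F -> rmx G -> rmx (fun v => F v - G v).
Proof.
move=> hF hG; apply: rmx_add => // i j.
by apply: rfn_eq (rfn_opp (hG i j)) _ => v _; rewrite mxE.
Qed.

Lemma rmx_row m n p (F : (V -> L) -> 'M[L]_(m, n)) (G : (V -> L) -> 'M[L]_(m, p)) :
  rmx F -> rmx G -> rmx (fun v => row_mx (F v) (G v)).
Proof.
move=> hF hG i j; case: (splitP j) => k jk.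
  by apply: rfn_eq (hF i k) _ => v _; rewrite (_ : j = lshift _ k) ?row_mxEl //; apply: val_inj.
by apply: rfn_eq (hG i k) _ => v _; rewrite (_ : j = rshift _ k) ?row_mxEr //; apply: val_inj.
Qed.

Lemma rmx_col m n p (F : (V -> L) -> 'M[L]_(m, n)) (G : (V -> L) -> 'M[L]_(p, n)) :
  rmx F -> rmx G -> rmx (fun v => col_mx (F v) (G v)).
Proof.
move=> hF hG i j; case: (splitP i) => k ik.
  by apply: rfn_eq (hF k j) _ => v _; rewrite (_ : i = lshift _ k) ?col_mxEu //; apply: val_inj.
by apply: rfn_eq (hG k j) _ => v _; rewrite (_ : i = rshift _ k) ?col_mxEd //; apply: val_inj.
Qed.

Lemma rmx_usub p1 p2 q (F : (V -> L) -> 'M[L]_(p1 + p2, q)) :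
  rmx F -> rmx (fun v => usubmx (F v)).
Proof. by move=> h i j; apply: rfn_eq (h (lshift _ i) j) _ => v _; rewrite mxE. Qed.

Lemma rmx_dsub p1 p2 q (F : (V -> L) -> 'M[L]_(p1 + p2, q)) :
  rmx F -> rmx (fun v => dsubmx (F v)).
Proof. by move=> h i j; apply: rfn_eq (h (rshift _ i) j) _ => v _; rewrite mxE. Qed.

Lemma rmx_lsub p1 p2 q (F : (V -> L) -> 'M[L]_(q, p1 + p2)) :
  rmx F -> rmx (fun v => lsubmx (F v)).
Proof. by move=> h i j; apply: rfn_eq (h i (lshift _ j)) _ => v _; rewrite mxE. Qed.

Lemma rmx_rsub p1 p2 q (F : (V -> L) -> 'M[L]_(q, p1 + p2)) :
  rmx F -> rmx (fun v => rsubmx (F v)).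
Proof. by move=> h i j; apply: rfn_eq (h i (rshift _ j)) _ => v _; rewrite mxE. Qed.

Lemma rmx_bool m n (A : 'M[L]_(m, n)) : (forall i j, exists b : bool, A i j = b%:R) -> rmx (fun=> A).
Proof.
by move=> h i j; have [b e] := h i j; apply: rfn_eq (rfn_nat b) _ => v _; rewrite e.
Qed.

Lemma rmx_idm m n : rmx (fun=> idm L m n).
Proof. by apply: rmx_bool => i j; rewrite mxE; eexists. Qed.

Lemma rmx_1 m : rmx (fun=> 1%:M : 'M[L]_m).
Proof. by apply: rmx_bool => i j; rewrite mxE -mulr_natr mul1r; eexists. Qed.

Lemma rmx_0 m n : rmx (fun=> 0 : 'M[L]_(m, n)).
Proof. by apply: rmx_bool => i j; rewrite mxE; exists false. Qed.

Lemma rmx_sw m n m' n' (F : (V -> L) -> 'M[L]_(m, n)) : rmx F -> rmx (fun v => sw m' n' (F v)).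
Proof.
by move=> h; apply: rmx_mul; [apply: rmx_mul => // | ]; apply: rmx_idm.
Qed.

Lemma rfn_sign e : rfn D (fun=> (-1) ^+ e).
Proof. by apply: rfn_eq (rfn_cst ((-1) ^+ e)) _ => v _; rewrite rmorphXn rmorphN1. Qed.

Lemma rfn_det m (F : (V -> L) -> 'M[L]_m) : rmx F -> rfn D (fun v => \det (F v)).
Proof.
move=> h.
apply: rfn_sum => s _; apply: rfn_mul; last by apply: rfn_prod => i _; apply: h.
exact: rfn_sign.
Qed.

Lemma rfn_tr m (F : (V -> L) -> 'M[L]_m) : rmx F -> rfn D (fun v => \tr (F v)).
Proof. by move=> h; apply: rfn_sum => i _; apply: h. Qed.

Lemma rmx_inv m (F : (V -> L) -> 'M[L]_m) :
  rmx F -> (forall v, D v -> F v \in unitmx) -> rmx (fun v => invmx (F v)).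
Proof.
move=> h u i j; apply: (@rfn_eq (fun v => (\det (F v))^-1 * cofactor (F v) j i)); last first.
  by move=> v dv; rewrite /invmx u // !mxE.
apply: rfn_mul.
  apply: rfn_inv; first exact: rfn_det.
  by move=> v dv; have := u v dv; rewrite unitmxE unitfE.
apply: rfn_mul.
  exact: rfn_sign.
by apply: rfn_det => a b; apply: rfn_eq (h (lift j a) (lift i b)) _ => v _; rewrite !mxE.
Qed.

Lemma rmx_exp m (F : (V -> L) -> 'M[L]_m) e : rmx F -> rmx (fun v => F v ^+ e).
Proof.
move=> h; elim: e => [|e IH]; first exact: rmx_1.
by apply: rmx_eq (rmx_mul h IH) _ => v _; rewrite exprS.
Qed.

Lemma popen_unit m (F : (V -> L) -> 'M[L]_m) :
  popen D -> rmx F -> popen (fun v => D v /\ F v \in unitmx).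
Proof.
move=> pD h; have [q pq e] := popen_rfn pD (rfn_det h); exists q => // v.
by rewrite -e unitmxE unitfE.
Qed.

End Rational.
End PolynomialFunctions.

Lemma pf_weaken (K L : fieldType) (em : {rmorphism K -> L}) V (f : (V -> L) -> L) :
  pf em f -> pf (idfun : {rmorphism L -> L}) f.
Proof.
elim=> [x|c|f' g _ pf' _ pg|f' g _ pf' _ pg|f' g _ pf' e].
- exact: pf_var.
- exact: (pf_cst (idfun : {rmorphism L -> L}) V (em c)).
- exact: pf_add.
- exact: pf_mul.
- exact: pf_eq pf' e.
Qed.

(** Irreducibility of affine space, seen on the line through [a] and [b]: both restrictions are
    nonzero polynomials in one variable, and so is their product. *)
Lemma pf_common (K : fieldType) (L : closedFieldType) (em : {rmorphism K -> L}) V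
    (f g : (V -> L) -> L) a b :
  pf em f -> pf em g -> f a != 0 -> g b != 0 -> exists2 c, f c != 0 & g c != 0.
Proof.
move=> pff pfg fa gb; pose e x := b x - a x.
have [p hp] := pf_line a e pff; have [q hq] := pf_line a e pfg.
have p0 : p.[0] != 0 by rewrite -hp (pf_ext (w := a) pff) // => x; rewrite mul0r addr0.
have q1 : q.[1] != 0 by rewrite -hq (pf_ext (w := b) pfg) // => x; rewrite mul1r addrC subrK.
have : p * q != 0.
  rewrite mulf_neq0 //; first by apply: contraNneq p0 => ->; rewrite horner0.
  by apply: contraNneq q1 => ->; rewrite horner0.
move=> /closed_nonrootP [t]; rewrite rootM negb_or => /andP[h1 h2].
by exists (fun x => a x + t * e x); rewrite ?hp ?hq.
Qed.

(** * Irreducibility of the band components *)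

Section Irreducibility.
Variable L : fieldType.

(** Rows of [B] outside the row space are added one by one; each raises the rank by exactly one. *)
Lemma mid_space N m1 m2 (A : 'M[L]_(m1, N)) (B : 'M[L]_(m2, N)) q :
  (A <= B)%MS -> (\rank A <= q <= \rank B)%N ->
  exists W : 'M[L]_(q, N), [/\ row_free W, (A <= W)%MS & (W <= B)%MS].
Proof.
move=> AB /andP[]; move eD : (q - \rank A)%N => d.
elim: d m1 A eD AB => [|d IH] m1 A eD AB rA rB.
  have e : \rank A = q by lia.
  have := eq_row_base A; have := row_base_free A; move: (row_base A); rewrite e => W fW eW.
  by exists W; split; rewrite ?eW.
have /row_subPn [i Bi] : ~~ (B <= A)%MS.
  by apply: contraTN (rB) => /mxrankS le; lia.
have le1 : (\rank (A + row i B)%MS <= (\rank A).+1)%N.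
  by apply: leq_trans (mxrank_adds_leqif _ _).1 _; have := rank_leq_row (row i B); lia.
have lt1 : (\rank A < \rank (A + row i B)%MS)%N.
  apply: rank_ltmx; rewrite /ltmx addsmxSl /=; apply: contra Bi => h.
  exact: submx_trans (addsmxSr _ _) h.
have [W [fW AW WB]] : exists W : 'M[L]_(q, N), [/\ row_free W, (A + row i B <= W)%MS & (W <= B)%MS].
  by apply: IH => //; rewrite ?addsmx_sub ?AB ?row_sub //; lia.
by exists W; split=> //; apply: submx_trans AW; apply: addsmxSl.
Qed.

Lemma inv_off p q (g : 'M[L]_(p + q)) : g \in unitmx -> usubmx (invmx g) *m rsubmx g = 0.
Proof.
move=> u; have := mulVmx u; rewrite -[X in X *m _]vsubmxK -[X in _ *m X]hsubmxK.
by rewrite mul_col_row scalar_mx_block => /eq_block_mx [].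
Qed.

Lemma inv_sum p q (g : 'M[L]_(p + q)) : g \in unitmx ->
  lsubmx g *m usubmx (invmx g) + rsubmx g *m dsubmx (invmx g) = 1%:M.
Proof. by move=> u; rewrite -mul_row_col vsubmxK hsubmxK mulmxV. Qed.

(* A basis of F = L^(p+q) whose last q vectors span a space between the image *)
(* of A and the kernel of B. *)
Lemma adapted_basis p q m n (A : 'M[L]_(p + q, n)) (B : 'M[L]_(m, p + q)) :
  B *m A = 0 -> (\rank A <= q)%N -> (\rank B <= p)%N ->
  exists g : 'M[L]_(p + q), [&& g \in unitmx, B *m rsubmx g == 0 & usubmx (invmx g) *m A == 0].
Proof.
move=> BA rA rB.
have AK : (A^T <= kermx B^T)%MS by apply/sub_kermxP; rewrite -trmx_mul BA trmx0.
have [|W [fW AW WK]] := mid_space (q := q) AK.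
  by rewrite mxrank_tr rA mxrank_ker mxrank_tr; have := rank_leq_col B; lia.
have rW : \rank W = q by apply/eqP.
have := row_base_free W^C%MS; have := eq_row_base W^C%MS; move: (row_base W^C%MS).
rewrite mxrank_compl rW addnK => C eC fC.
pose h := col_mx C W.
have uh : h \in unitmx.
  rewrite -row_full_unit -sub1mx -addsmxE (adds_eqmx eC (eqmx_refl W)).
  by rewrite addsmxC sub1mx; apply: addsmx_compl_full.
have uh' : h^T \in unitmx by rewrite unitmx_tr.
exists h^T; apply/and3P; split=> //.
  rewrite /h tr_col_mx row_mxKr; apply/eqP/trmx_inj; rewrite trmx_mul trmxK trmx0.
  exact/sub_kermxP.
have /submxP [Z AZ] := AW.
have -> : A = rsubmx h^T *m Z^T by rewrite /h tr_col_mx row_mxKr -trmx_mul -AZ trmxK.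
by rewrite mulmxA inv_off // mul0mx.
Qed.

Lemma adapted_form p q q' t (A : 'M[L]_(p + q, q' + t)) (g : 'M[L]_(p + q)) (g' : 'M[L]_(q' + t)) :
  g \in unitmx -> g' \in unitmx -> usubmx (invmx g) *m A = 0 -> A *m rsubmx g' = 0 ->
  rsubmx g *m (dsubmx (invmx g) *m A *m lsubmx g') *m usubmx (invmx g') = A.
Proof.
move=> u u' e e'.
have h := inv_sum u; have h' := inv_sum u'.
rewrite !mulmxA.
have -> : rsubmx g *m dsubmx (invmx g) *m A = A.
  by rewrite -[RHS]mul1mx -h mulmxDl -(mulmxA (lsubmx g)) e mulmx0 add0r.
by rewrite -[RHS]mulmx1 -h' mulmxDr !mulmxA e' mul0mx addr0.
Qed.

(** Entries indexed by natural numbers, with value 0 out of range, so that matrices of all sizes can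
    be read from one family of parameters. *)
Definition ent p q (A : 'M[L]_(p, q)) (r t : nat) : L :=
  if insub r is Some i then if insub t is Some j then A i j else 0 else 0.

Lemma entK p q (A : 'M[L]_(p, q)) : \matrix_(i, j) ent A i j = A.
Proof. by apply/matrixP => i j; rewrite mxE /ent !valK. Qed.

Definition rcoord n (beta : nat -> nat) (W : bool -> forall i : 'I_n, 'M[L]_(beta i, beta i.+1))
  (c : Defs.coord n beta) : L := W c.1 (tag c.2) (tagged c.2).1 (tagged c.2).2.

Definition rawm n (beta : nat -> nat) (v : Defs.coord n beta -> L) s (i : 'I_n) : 'M[L]_(beta i, beta i.+1) :=
  \matrix_(r, t) v (s, Tagged (fun i : 'I_n => ('I_(beta i) * 'I_(beta i.+1))%type) (r, t)).

Lemma rcoord_arr n beta (M : rep L n beta) : coord_val M =1 rcoord (arr M).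
Proof. by move=> [s [i [r t]]]; rewrite /coord_val /rcoord /arr /=; case: s. Qed.

Lemma rawm_coord n beta (M : rep L n beta) s i : rawm (coord_val M) s i = arr M s i.
Proof. by apply/matrixP => r t; rewrite mxE rcoord_arr. Qed.

Lemma mkrep n (beta : nat -> nat) (W : bool -> forall i : 'I_n, 'M[L]_(beta i, beta i.+1)) :
  (forall s j, tarr W s j *m tarr W s j.+1 = 0) -> exists M : rep L n beta, forall s i, arr M s i = W s i.
Proof.
move=> h.
have h0 s (i : nat) (lt : (i.+1 < n)%N) : W s (Ordinal (ltnW lt)) *m W s (Ordinal lt) = 0.
  by have := h s i; rewrite (tarr_lt _ _ lt) (tarr_lt _ _ (ltnW lt)).
by exists (Rep (h0 true) (h0 false)); case.
Qed.

Variables (n : nat) (m : n.-tuple nat).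
Notation pvar := (bool * bool * nat * nat * nat)%type.

(* The modules with arrows par, where the matrices parg are invertible and    *)
(* pard is arbitrary, fill the component, so it is the image of an open subset *)
(* of an affine space.                                                        *)
Definition parg (v : pvar -> L) s j : 'M[L]_(place m j + place m j.+1) :=
  \matrix_(r, t) v (s, false, j, r : nat, t : nat).
Definition pard (v : pvar -> L) s j : 'M[L]_(place m j.+1) :=
  \matrix_(r, t) v (s, true, j, r : nat, t : nat).
Definition par (v : pvar -> L) s (i : 'I_n) : 'M[L]_(band_dim m i, band_dim m i.+1) :=
  rsubmx (parg v s i) *m pard v s i *m usubmx (invmx (parg v s i.+1)).

Lemma par_rep v : (forall s j, (j <= n)%N -> parg v s j \in unitmx) ->
  exists2 M : rep L n (band_dim m), band_component M & forall s i, arr M s i = par v s i.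
Proof.
move=> u; have [s j|M hM] := @mkrep n (band_dim m) (par v).
  have [h|h] := ltnP j.+1 n; last by rewrite [X in _ *m X]tarr_out // mulmx0.
  rewrite (tarr_lt _ _ h) (tarr_lt _ _ (ltnW h)) /par /= !mulmxA.
  by rewrite -(mulmxA _ (usubmx _)) inv_off ?u ?(ltnW h) // mulmx0 !mul0mx.
exists M => // i.
have le s : (\rank (arr M s i) <= place m i.+1)%N.
  by rewrite hM; apply: leq_trans (mxrankM_maxl _ _) (leq_trans (mxrankM_maxr _ _) (rank_leq_row _)).
by split; [exact: (le true) | exact: (le false)].
Qed.

(** The two labels get independent bases. In bases adapted to a space lying between the image of the
    incoming arrow and the kernel of the outgoing one, each arrow is concentrated in one square
    block. *)
Lemma par_onto (M : rep L n (band_dim m)) : band_component M ->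
  exists2 v, forall s j, parg v s j \in unitmx & forall s i, par v s i = arr M s i.
Proof.
move=> bM.
have rk s j : (\rank (tarr (arr M) s j) <= place m j.+1)%N.
  have [h|h] := ltnP j n; last by rewrite tarr_out // mxrank0.
  rewrite (tarr_lt _ _ h); have [ha hb] := bM (Ordinal h); by case: s.
(* The arrow leaving F_j; at j = 0 it is the zero map to a zero space, so the bottom needs no
   separate argument. *)
pose into s j : 'M[L]_(if j is j'.+1 then band_dim m j' else 0%N, band_dim m j) :=
  match j with 0 => 0 | j'.+1 => tarr (arr M) s j' end.
have ex s j : exists g : 'M[L]_(place m j + place m j.+1),
    [&& g \in unitmx, into s j *m rsubmx g == 0 & usubmx (invmx g) *m tarr (arr M) s j == 0].
  apply: adapted_basis => //.
    by case: j => [|j]; [exact: mul0mx | apply: tarr0].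
  exact: rk.
  by case: j => [|j]; [exact: rank_leq_row (into s 0%N) | apply: rk].
pose g s j := sval (sigW (ex s j)).
have gP s j : [/\ g s j \in unitmx, into s j *m rsubmx (g s j) = 0 & usubmx (invmx (g s j)) *m tarr (arr M) s j = 0].
  by have /and3P[u /eqP e1 /eqP e2] := svalP (sigW (ex s j)).
pose D s j := dsubmx (invmx (g s j)) *m tarr (arr M) s j *m lsubmx (g s j.+1).
pose v (x : pvar) : L := let: (s, b, j, r, t) := x in
  if b then ent (D s j) r t else ent (g s j) r t.
have eg s j : parg v s j = g s j by rewrite /parg entK.
have ed s j : pard v s j = D s j by rewrite /pard entK.
exists v => [s j|s i]; first by rewrite eg; case: (gP s j).
rewrite /par ed !eg /D -[RHS](tarr_ord (arr M) s i).
have [u1 _ e1] := gP s i; have [u2 e2 _] := gP s i.+1.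
exact: adapted_form.
Qed.

End Irreducibility.

(** * Nonempty open conditions on a band component *)

Section CommonPoint.
Variables (L : closedFieldType) (n : nat) (m : n.-tuple nat).
Notation idL := (idfun : {rmorphism L -> L}).
Notation crd := (Defs.coord n (band_dim m)).

Lemma popen_True (K : fieldType) (em : {rmorphism K -> L}) V : popen em (fun _ : V -> L => True).
Proof.
by exists (fun=> em 1); [apply: pf_cst | move=> v; rewrite rmorph1 oner_neq0].
Qed.

(** Along the parametrization [par] both functions become rational on the domain where all base
    changes are invertible, and nonempty principal open sets of an affine space meet. *)
Lemma comp_common (f g : (crd -> L) -> L) (M N : rep L n (band_dim m)) :
  pf idL f -> pf idL g -> band_component M -> band_component N ->
  f (coord_val M) != 0 -> g (coord_val N) != 0 ->
  exists P : rep L n (band_dim m), [/\ band_component P, f (coord_val P) != 0 & g (coord_val P) != 0].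
Proof.
move=> pff pfg bM bN fM gN.
pose V := (bool * bool * nat * nat * nat)%type.
pose F v : L := \prod_(x : bool * 'I_n.+1) \det (parg m v x.1 x.2).
have rg T s j : rmx idL T (fun v => parg m v s j).
  exact: (rmx_var idL T (fun r t => (s, false, j, r : nat, t : nat))).
have rd T s j : rmx idL T (fun v => pard m v s j).
  exact: (rmx_var idL T (fun r t => (s, true, j, r : nat, t : nat))).
pose D (v : V -> L) := True /\ F v != 0.
have pD : popen idL D.
  apply: popen_rfn; first exact: popen_True.
  by apply: rfn_prod => x _; apply: rfn_det; apply: rg.
have Du v : D v <-> forall s j, (j <= n)%N -> parg m v s j \in unitmx.
  split=> [[_ nz] s j le|u]; last first.
    split=> //; apply/prodf_neq0 => x _; rewrite -unitfE -unitmxE; apply: u.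
    by rewrite -ltnS.
  move/prodf_neq0: nz => /(_ (s, Ordinal (le : (j < n.+1)%N)) isT) /=.
  by rewrite -unitfE -unitmxE.
have rp h : pf idL h -> rfn idL D (fun v => h (rcoord (par m v))).
  move=> ph; apply: (rfn_pf_comp (h := fun c v => rcoord (par m v) c)) => // -[s [i [r t]]].
  apply: (rmx_mul (F := fun v => rsubmx (parg m v s i) *m pard m v s i)
    (G := fun v => usubmx (invmx (parg m v s i.+1)))).
    by apply: rmx_mul; [apply: rmx_rsub; apply: rg | apply: rd].
  apply: rmx_usub; apply: rmx_inv; first exact: rg.
  by move=> v /Du; apply; apply: ltn_ord.
have [a ua ea] := par_onto bM; have [b ub eb] := par_onto bN.
have co (Q : rep L n (band_dim m)) v h : pf idL h -> (forall s i, par m v s i = arr Q s i) ->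
    h (rcoord (par m v)) = h (coord_val Q).
  move=> ph e; apply: (pf_ext ph) => c; rewrite rcoord_arr /rcoord e //.
have [qf pqf hf] := popen_rfn pD (rp _ pff); have [qg pqg hg] := popen_rfn pD (rp _ pfg).
have [||v] := pf_common pqf pqg (a := a) (b := b).
- apply/hf; split; first by apply/Du => s j _; apply: ua.
  by rewrite (co M).
- apply/hg; split; first by apply/Du => s j _; apply: ub.
  by rewrite (co N).
move=> /hf [/Du u fv] /hg [_ gv].
have [P bP eP] := par_rep u; exists P.
by rewrite -!(co P v) //.
Qed.

(** Coefficients in L are allowed, as these conditions only help to select a module over L; they
    never become part of an open set over K. *)
Definition opL (P : rep L n (band_dim m) -> Prop) := exists f : (crd -> L) -> L,
  [/\ pf idL f, exists2 M : rep L n (band_dim m), band_component M & f (coord_val M) != 0 &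
    forall M : rep L n (band_dim m), band_component M -> f (coord_val M) != 0 -> P M].

Lemma opL_and P Q : opL P -> opL Q -> opL (fun M => P M /\ Q M).
Proof.
move=> [f [pff [M bM fM] hf]] [g [pfg [N bN gN] hg]].
exists (fun v => f v * g v); split; first exact: pf_mul.
- have [R [bR fR gR]] := comp_common pff pfg bM bN fM gN.
  by exists R => //; rewrite mulf_neq0.
- by move=> R bR; rewrite mulf_eq0 negb_or => /andP[fR gR]; split; [apply: hf | apply: hg].
Qed.

Lemma opL_imp P Q : opL P -> (forall M : rep L n (band_dim m), band_component M -> P M -> Q M) -> opL Q.
Proof. by move=> [f [pff h hf]] PQ; exists f; split=> // M bM fM; apply: PQ => //; apply: hf. Qed.

Lemma opL_all (I : finType) (P : I -> rep L n (band_dim m) -> Prop) (M : rep L n (band_dim m)) :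
  band_component M -> (forall i, opL (P i)) -> opL (fun M => forall i, P i M).
Proof.
move=> bM h; suff : opL (fun M => forall i, i \in enum I -> P i M).
  by move=> h1; apply: (opL_imp h1) => N _ hN i; apply: hN; rewrite mem_enum.
elim: (enum I) => [|i s IH].
  exists (fun=> idL 1); split; first exact: pf_cst.
    by exists M => //; rewrite rmorph1 oner_neq0.
  by [].
apply: opL_imp (opL_and (h i) IH) _ => N _ [h1 h2] j.
by rewrite in_cons => /orP [/eqP->|/h2].
Qed.

Lemma rank_minor p q (A : 'M[L]_(p, q)) r : (r <= \rank A)%N ->
  exists (U : 'M[L]_(r, p)) (V : 'M[L]_(q, r)), U *m A *m V = 1%:M.
Proof.
move=> le; have e := mulmx_base A.
have [V' hV] := row_freeP (row_base_free A); have [U' hU] := row_fullP (col_base_full A).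
move: (\rank A) (col_base A) (row_base A) e le U' V' hU hV => k C R <- le U' V' hU hV.
exists ((pid_mx r : 'M_(r, k)) *m U'), (V' *m (pid_mx r : 'M_(k, r))).
rewrite !mulmxA -(mulmxA _ U') hU mulmx1 -(mulmxA _ R) hV mulmx1.
by rewrite pid_mx_id // pid_mx_1.
Qed.

(** Lower semicontinuity of the rank: [U] and [V] are frozen at [M], and invertibility of
    [U *m A *m V] is the open condition. *)
Lemma opL_rank p q (A : (crd -> L) -> 'M[L]_(p, q)) r (M : rep L n (band_dim m)) :
  rmx idL (fun=> True) A -> band_component M -> (r <= \rank (A (coord_val M)))%N ->
  opL (fun N => (r <= \rank (A (coord_val N)))%N).
Proof.
move=> rA bM /rank_minor [U [V e]].
have rc p' q' (B : 'M[L]_(p', q')) : rmx idL (fun _ : crd -> L => True) (fun=> B).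
  by move=> i j; apply: rfn_pf; apply: (pf_cst idL).
have := popen_unit (@popen_True _ idL crd) (rmx_mul (rmx_mul (rc _ _ U) rA) (rc _ _ V)).
move=> [f pff hf]; exists f; split=> //; first by exists M => //; apply/hf; rewrite e unitmx1.
move=> N _ /hf [_ u]; rewrite -(mxrank_unit u).
by apply: leq_trans (mxrankM_maxl _ _) (mxrankM_maxr _ _).
Qed.

End CommonPoint.

(** * A module in general position *)

Section GenericExample.
Variable L : fieldType.

(* Two exact complexes in general position: A has image the last q and kernel *)
(* the last t coordinates, B the first q and the first t. *)
Definition exA p q t : 'M[L]_(p + q, q + t) := col_mx 0 1%:M *m row_mx 1%:M 0.
Definition exv q t : 'M[L]_(q, q + t) := \matrix_(i, j) (nat_of_ord j == i + t)%N%:R.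
Definition exB p q t : 'M[L]_(p + q, q + t) := pid_mx q *m exv q t.

Lemma exAA p q t u : exA p q t *m exA q t u = 0.
Proof.
rewrite /exA !mulmxA -(mulmxA _ (row_mx _ _)) mul_row_col mulmx0 mul0mx addr0.
by rewrite mulmx0 mul0mx.
Qed.

Lemma exBB p q t u : exB p q t *m exB q t u = 0.
Proof.
rewrite /exB !mulmxA -(mulmxA _ (exv _ _)).
have -> : exv q t *m (pid_mx t : 'M_(q + t, t)) = 0.
  apply/matrixP => i j; rewrite !mxE big1 // => k _; rewrite !mxE.
  case: eqP => [e|_]; last by rewrite mul0r.
  by rewrite mul1r; case: eqP => //= e'; have := ltn_ord j; lia.
by rewrite mulmx0 mul0mx.
Qed.

Lemma exvK q t : exists C, exv q t *m C = 1%:M.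
Proof.
exists (exv q t)^T; apply/matrixP => i j; rewrite !mxE.
have lt : (i + t < q + t)%N by rewrite ltn_add2r.
rewrite (bigD1 (Ordinal lt)) //= !mxE /= eqxx mul1r eqn_add2r big1 ?addr0 // => k nk.
rewrite !mxE; case: eqP => [e|_]; last by rewrite mul0r.
by case/eqP: nk; apply: val_inj.
Qed.

Lemma pid_left p q : (pid_mx q : 'M[L]_(q, p + q)) *m (pid_mx q : 'M_(p + q, q)) = 1%:M.
Proof. by rewrite mul_pid_mx minnn (minn_idPr (leq_addl _ _)) pid_mx_1. Qed.

Lemma ex_rank p q t : \rank (exA p q t) = q /\ \rank (exB p q t) = q.
Proof.
have le m n (A : 'M[L]_(m, q)) (B : 'M_(q, n)) U V : U *m A = 1%:M -> B *m V = 1%:M -> \rank (A *m B) = q.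
  move=> UA BV; apply/eqP; rewrite eqn_leq; apply/andP; split.
    by apply: leq_trans (mxrankM_maxl _ _) (rank_leq_col _).
  rewrite -{1}(mxrank1 L q) -[1%:M]mulmx1 -{1}UA -BV mulmxA -(mulmxA U).
  by apply: leq_trans (mxrankM_maxl _ _) (mxrankM_maxr _ _).
split.
  apply: (le _ _ _ _ (row_mx 0 1%:M) (col_mx 1%:M 0)).
    by rewrite mul_row_col mulmx0 mulmx1 add0r.
  by rewrite mul_row_col mulmx0 mulmx1 addr0.
have [C vC] := exvK q t; exact: (le _ _ _ _ (pid_mx q) C (pid_left p q) vC).
Qed.

(** The images of A and B are the last and the first q coordinates, which together cover all p + q
    of them when p <= q; [Z] is an explicit right inverse. *)
Lemma ex_surj p q t : (p <= q)%N -> (p + q <= \rank (row_mx (exA p q t) (exB p q t)))%N.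
Proof.
move=> pq; have [C vC] := exvK q t.
pose Z := col_mx (col_mx 1%:M 0 *m row_mx 0 1%:M) (C *m (pid_mx p *m row_mx 1%:M 0)) : 'M[L]_(q + t + (q + t), p + q).
suff e : row_mx (exA p q t) (exB p q t) *m Z = 1%:M.
  by rewrite -{1}(mxrank1 L (p + q)) -e mxrankM_maxl.
rewrite mul_row_col /exA /exB !mulmxA -(mulmxA _ (row_mx _ _) (col_mx _ _)) mul_row_col mulmx0 mulmx1 addr0 mulmx1.
rewrite -(mulmxA _ (exv _ _)) vC mulmx1 mul_pid_mx (minn_idPr pq) (minn_idPr pq).
rewrite pid_mx_col !mul_col_row !(mulmx0, mul0mx, mulmx1) add_block_mx !(add0r, addr0).
by rewrite -scalar_mx_block.
Qed.

(** The kernels of A and B are the last and the first t coordinates, which are independent when t <=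
    q. The rows of [exv] chosen by [S] read off the last t coordinates that A misses. *)
Lemma ex_inj p q t : (t <= q)%N -> (q + t <= \rank (col_mx (exA p q t) (exB p q t)))%N.
Proof.
move=> tq.
have lt (i : 'I_t) : (q + i - t < q)%N by have := ltn_ord i; lia.
pose S : 'M[L]_(t, q) := rowsub (fun i => Ordinal (lt i)) 1%:M.
have Sv : S *m exv q t = row_mx 0 1%:M.
  rewrite mul_rowsub_mx mul1mx; apply/matrixP => i j; rewrite !mxE /=.
  have -> : (nat_of_ord j == q + i - t + t)%N = (nat_of_ord j == q + i)%N by rewrite subnK //; lia.
  case: (splitP j) => k jk; rewrite !mxE.
    by case: eqP => // e; have := ltn_ord k; lia.
  by rewrite jk eqn_add2l eq_sym.
pose Z := row_mx (col_mx 1%:M 0 *m row_mx 0 1%:M) (col_mx 0 1%:M *m S *m pid_mx q) : 'M[L]_(q + t, p + q + (p + q)).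
suff e : Z *m col_mx (exA p q t) (exB p q t) = 1%:M.
  by rewrite -{1}(mxrank1 L (q + t)) -e mxrankM_maxr.
rewrite mul_row_col /exA /exB !mulmxA -(mulmxA _ (row_mx _ _) (col_mx _ _)) mul_row_col mulmx0 mulmx1 add0r mulmx1.
rewrite -(mulmxA _ (pid_mx q) (pid_mx q)) pid_left mulmx1 -(mulmxA _ S) Sv.
rewrite !mul_col_row !(mulmx0, mul0mx, mulmx1) add_block_mx !(add0r, addr0).
by rewrite -scalar_mx_block.
Qed.

Lemma ex_rep n (m : n.-tuple nat) : exists M : rep L n (band_dim m),
  arr M true = (fun i : 'I_n => exA (place m i) (place m i.+1) (place m i.+2)) /\
  arr M false = (fun i : 'I_n => exB (place m i) (place m i.+1) (place m i.+2)).
Proof.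
pose W s (i : 'I_n) : 'M[L]_(band_dim m i, band_dim m i.+1) :=
  if s then exA (place m i) (place m i.+1) (place m i.+2)
  else exB (place m i) (place m i.+1) (place m i.+2).
have h0 s (i : nat) (lt : (i.+1 < n)%N) : W s (Ordinal (ltnW lt)) *m W s (Ordinal lt) = 0.
  by case: s; [apply: exAA | apply: exBB].
by exists (Rep (h0 true) (h0 false)).
Qed.

(* Open conditions under which the inverses of the moves are defined. *)
Definition gen n (m : n.-tuple nat) (M : rep L n (band_dim m)) := forall i : 'I_n,
  [/\ forall s, (place m i.+1 <= \rank (arr M s i))%N,
      (place m i <= place m i.+1)%N -> (band_dim m i <= \rank (row_mx (arr M true i) (arr M false i)))%N &
      (place m i.+2 <= place m i.+1)%N -> (band_dim m i.+1 <= \rank (col_mx (arr M true i) (arr M false i)))%N].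

End GenericExample.

(** Each condition of [gen] is open and holds at the explicit example, so irreducibility lets all of
    them hold at once with [f]. *)
Lemma gen_point (K : fieldType) (L : closedFieldType) (em : {rmorphism K -> L}) n (m : n.-tuple nat)
    (f : (Defs.coord n (band_dim m) -> L) -> L) (M : rep L n (band_dim m)) :
  pf em f -> band_component M -> f (coord_val M) != 0 ->
  exists N : rep L n (band_dim m), [/\ band_component N, f (coord_val N) != 0 & gen N].
Proof.
move=> /pf_weaken pff bM fM; have [E [Et Ef]] := ex_rep L m.
have bE : band_component E.
  move=> i; have [r1 r2] := ex_rank L (place m i) (place m i.+1) (place m i.+2).
  by split; [rewrite -[arr_a E i]/(arr E true i) Et r1 | rewrite -[arr_b E i]/(arr E false i) Ef r2].
suff [g [pfg [N bN gN] hg]] : opL (fun N : rep L n (band_dim m) => gen N).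
  have [P [bP fP gP]] := comp_common pff pfg bM bN fM gN.
  by exists P; split=> //; apply: hg.
have rA s i : rmx (idfun : {rmorphism L -> L}) (fun=> True) (fun v : Defs.coord n (band_dim m) -> L => rawm v s i).
  by move=> r t; apply: rfn_eq (rfn_pf _ (pf_var _ _)) _ => v _; rewrite mxE.
apply: (opL_all bE) => i.
have [r1 r2] := ex_rank L (place m i) (place m i.+1) (place m i.+2).
have o1 s : opL (fun N : rep L n (band_dim m) => place m i.+1 <= \rank (arr N s i))%N.
  have h : (place m i.+1 <= \rank (rawm (coord_val E) s i))%N.
    by rewrite rawm_coord; case: s; rewrite ?Et ?Ef ?r1 ?r2.
  by apply: (opL_imp (opL_rank (A := fun v => rawm v s i) (rA s i) bE h)) => N _; rewrite rawm_coord.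
have o2 : opL (fun N : rep L n (band_dim m) => (place m i <= place m i.+1)%N ->
    (band_dim m i <= \rank (row_mx (arr N true i) (arr N false i)))%N).
  have [le|gt] := leqP (place m i) (place m i.+1); last first.
    by apply: (opL_imp (o1 true)) => N _ _ le; move: gt; rewrite ltnNge le.
  have h : (band_dim m i <= \rank (row_mx (rawm (coord_val E) true i) (rawm (coord_val E) false i)))%N.
    by rewrite !rawm_coord Et Ef; apply: ex_surj.
  apply: (opL_imp (opL_rank (A := fun v => row_mx (rawm v true i) (rawm v false i))
    (rmx_row (rA true i) (rA false i)) bE h)) => N _.
  by rewrite !rawm_coord.
have o3 : opL (fun N : rep L n (band_dim m) => (place m i.+2 <= place m i.+1)%N ->
    (band_dim m i.+1 <= \rank (col_mx (arr N true i) (arr N false i)))%N).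
  have [le|gt] := leqP (place m i.+2) (place m i.+1); last first.
    by apply: (opL_imp (o1 true)) => N _ _ le; move: gt; rewrite ltnNge le.
  have h : (band_dim m i.+1 <= \rank (col_mx (rawm (coord_val E) true i) (rawm (coord_val E) false i)))%N.
    by rewrite !rawm_coord Et Ef; apply: ex_inj.
  apply: (opL_imp (opL_rank (A := fun v => col_mx (rawm v true i) (rawm v false i))
    (rmx_col (rA true i) (rA false i)) bE h)) => N _.
  by rewrite !rawm_coord.
apply: (opL_imp (opL_and (opL_and (o1 true) (o1 false)) (opL_and o2 o3))).
by move=> N _ [[h1 h2] [h3 h4]]; split=> // -[].
Qed.

(** * Transfer of generic decompositions *)

Section GaugeTransfer.
Variables (K : fieldType) (L : closedFieldType) (em : {rmorphism K -> L}).
Hypothesis charK0 : [pchar K] =i pred0.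

Lemma pf_mmap (V : finType) (f : {mpoly K[#|V|]}) :
  pf em (fun v : V -> L => mmap em (fun k => v (enum_val k)) f).
Proof.
rewrite /mmap; apply: pf_sum => mm; apply: pf_mul; first exact: pf_cst.
by apply: pf_prod => k; apply: pf_exp; apply: pf_var.
Qed.

Lemma rfn_subst V V' (h : V -> V') (D : (V -> L) -> Prop) f : rfn em D f ->
  rfn em (fun v => D (fun x => v (h x))) (fun v => f (fun x => v (h x))).
Proof.
move=> [p [q [pp pq e]]]; exists (fun v => p (fun x => v (h x))), (fun v => q (fun x => v (h x))).
split; [| | by move=> v; apply: e];
  by apply: (pf_subst (h := fun x v => v (h x))) => // x; apply: pf_var.
Qed.

Lemma popen_subst V V' (h : V -> V') (D : (V -> L) -> Prop) : popen em D ->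
  popen em (fun v => D (fun x => v (h x))).
Proof.
move=> [q pq e]; exists (fun v => q (fun x => v (h x))) => //.
by apply: (pf_subst (h := fun x v => v (h x))) => // x; apply: pf_var.
Qed.

Lemma decomposes_iso n (D : seq (n.-tuple nat)) beta gamma (M : rep L n beta) (N : rep L n gamma) :
  rep_iso M N -> decomposes_as D M -> decomposes_as D N.
Proof. by move=> /rep_iso_pad e /decomp_odec d; apply/decomp_odec; apply: iso_odec d. Qed.

Lemma rep_iso_sym n beta gamma (M : rep L n beta) (N : rep L n gamma) : rep_iso M N -> rep_iso N M.
Proof. by move=> /rep_iso_pad e; apply/rep_iso_pad/iso_sym. Qed.

Lemma arr_rel n beta (M : rep L n beta) s (i : nat) (lt : (i.+1 < n)%N) :
  arr M s (Ordinal (ltnW lt)) *m arr M s (Ordinal lt) = 0.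
Proof. by case: s; [apply: arr_aa0 | apply: arr_bb0]. Qed.

(* The values of Phi are modules in special bases, so f' might vanish on all   *)
(* of them; conjugating Phi by further parameters removes the restriction.    *)
Lemma transfer n (m : n.-tuple nat) n' (m' : n'.-tuple nat) D D'
    (V := (nat * nat * nat + Defs.coord n (band_dim m))%type)
    (Phi : (V -> L) -> bool -> forall i : 'I_n', 'M[L]_(band_dim m' i, band_dim m' i.+1))
    (Dom : (V -> L) -> Prop) :
  popen em Dom -> (forall s i, rmx em Dom (fun v => Phi v s i)) ->
  (forall v (M : rep L n (band_dim m)), band_component M -> (forall c, v (inr c) = coord_val M c) ->
    Dom v -> exists N : rep L n' (band_dim m'), [/\ band_component N, forall s i, arr N s i = Phi v s i &
      decomposes_as D' N -> decomposes_as D M]) ->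
  (forall N0 : rep L n' (band_dim m'), band_component N0 -> gen N0 ->
    exists v (M : rep L n (band_dim m)) (N : rep L n' (band_dim m')),
    [/\ band_component M, forall c, v (inr c) = coord_val M c, Dom v, forall s i, arr N s i = Phi v s i &
      rep_iso N N0]) ->
  generic_decomposition em m' D' -> generic_decomposition em m D.
Proof.
move=> pDom rPhi H1 H2 [f' [[N1 [bN1 fN1]] hf']].
pose ev (w : Defs.coord n' (band_dim m') -> L) := mmap em (fun k => w (enum_val k)) f'.
have pev : pf em ev by apply: pf_mmap.
have [N0 [bN0 fN0 gN0]] := gen_point pev bN1 fN1.
(* Two independent sets of parameters: the left one holds the base changes [g], the right one the
   parameters of [Phi]. *)
pose U := (nat * nat * nat + nat * nat * nat)%type.
pose V2 := (U + Defs.coord n (band_dim m))%type.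
pose h (x : V) : V2 := match x with inl a => inl (inr a) | inr c => inr c end.
pose rs (v : V2 -> L) : V -> L := fun x => v (h x).
pose g (v : V2 -> L) j : 'M[L]_(band_dim m' j) := \matrix_(r, t) v (inl (inl (j, r : nat, t : nat))).
have rg E j : rmx em E (fun v => g v j).
  exact: (rmx_var em E (fun r t => inl (inl (j, r : nat, t : nat)))).
pose D2 v := Dom (rs v) /\ \prod_(j < n'.+1) \det (g v j) != 0.
have pD2 : popen em D2.
  apply: popen_rfn; first exact: popen_subst.
  by apply: rfn_prod => j _; apply: rfn_det; apply: rg.
have D2u v : D2 v -> forall j, (j <= n')%N -> g v j \in unitmx.
  move=> [_ /prodf_neq0 nz] j le; have := nz (Ordinal (le : (j < n'.+1)%N)) isT.
  by rewrite -unitfE -unitmxE.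
pose Phi2 v s (i : 'I_n') := g v i *m Phi (rs v) s i *m invmx (g v i.+1).
have rP2 s i : rmx em D2 (fun v => Phi2 v s i).
  apply: rmx_mul; last first.
    apply: rmx_inv; first exact: rg.
    by move=> v /D2u; apply; apply: ltn_ord.
  apply: rmx_mul; first exact: rg.
  move=> r t; have := rfn_subst h (rPhi s i r t).
  by apply: rfn_sub => v [].
have [q pq hq] := popen_rfn pD2 (rfn_pf_comp (h := fun c v => rcoord (Phi2 v) c) pev
  (fun c => rP2 c.1 (tag c.2) (tagged c.2).1 (tagged c.2).2)).
have evE (N : rep L n' (band_dim m')) v : (forall s i, arr N s i = Phi2 v s i) ->
    ev (rcoord (Phi2 v)) = rep_eval em f' N.
  move=> e; rewrite [RHS]/(ev (coord_val N)); apply: (pf_ext pev) => c.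
  by rewrite rcoord_arr /rcoord e.
have [v [M [N [bM vM Dv NPhi [p [p' [hp pp']]]]]]] := H2 _ bN0 gN0.
(* The base changes are set to the isomorphism from the constructed module to [N0], so that [Phi2]
   takes the value [N0], where [f'] does not vanish. *)
pose v2 (x : V2) : L := match x with
  | inl (inl (j, r, t)) => ent (p j) r t | inl (inr a) => v (inl a) | inr c => v (inr c) end.
have gv2 j : g v2 j = p j by rewrite /g /v2 entK.
have q0 : q v2 != 0.
  have up j : (j <= n')%N -> p j \in unitmx.
    by move=> /pp' [_ e]; case: (mulmx1_unit e).
  have rsv : rs v2 =1 v by move=> [a|c].
  have rPhi2 s i : Phi (rs v2) s i = Phi v s i.
    apply/matrixP => r t; have [a [b [pa pb e]]] := rPhi s i r t.
    have [d pd ed] := pDom.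
    have dv : Dom (rs v2) by apply/ed; rewrite (pf_ext pd rsv); apply/ed.
    have [_ ->] := e _ Dv; have [_ ->] := e _ dv.
    by rewrite (pf_ext pa rsv) (pf_ext pb rsv).
  have [d pd ed] := pDom.
  have dv : Dom (rs v2) by apply/ed; rewrite (pf_ext pd rsv); apply/ed.
  apply/hq; split.
    split=> //; apply/prodf_neq0 => j _; rewrite -unitfE -unitmxE gv2; apply: up.
    by rewrite -ltnS.
  rewrite [X in X != 0](evE N0) // => s i.
  rewrite /Phi2 rPhi2 !gv2 -NPhi.
  have -> : p i *m arr N s i = arr N0 s i *m p i.+1.
    by have [h1 h2] := hp i; case: s.
  by rewrite -mulmxA mulmxV ?mulmx1 // up.
(* Only the auxiliary parameters are replaced by elements of K. The entries of the module remain
   variables, so [q] turns into a polynomial over K in these entries. *)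
have [u qu] := Kpoint charK0 pq q0.
pose mix (w : Defs.coord n (band_dim m) -> L) (x : V2) : L :=
  match x with inl a => em (u a) | inr c => w c end.
have pmix : pf em (fun w => q (mix w)).
  apply: (pf_subst (h := fun x w => mix w x)) => // -[a|c]; [exact: pf_cst | exact: pf_var].
have [f hf] := pf_mpoly pmix.
exists f; split.
  exists M; split=> //; rewrite /rep_eval hf.
  rewrite (pf_ext (w := fun x => match x with inl a => em (u a) | inr c => v2 (inr c) end) pq) //.
  by case=> //= c; rewrite vM.
move=> P bP; rewrite /rep_eval hf => /hq [d2 ne]; have d1 : Dom (rs (mix (coord_val P))) by case: d2.
have [Q [bQ eQ dQ]] := H1 _ _ bP (fun c => erefl) d1.
have uG := D2u _ d2.
pose W s (i : 'I_n') := Phi2 (mix (coord_val P)) s i.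
have W0 s (i : nat) (lt : (i.+1 < n')%N) : W s (Ordinal (ltnW lt)) *m W s (Ordinal lt) = 0.
  rewrite /W /Phi2 !mulmxA -(mulmxA _ (invmx _)) mulVmx ?mulmx1; last by apply: uG; apply: ltnW.
  by rewrite -!eQ -(mulmxA _ (arr Q s (Ordinal (ltnW lt)))) arr_rel mulmx0 mul0mx.
(* The constructed module in the bases prescribed by the specialized parameters; it is the one on
   which [f'] is known not to vanish. *)
pose Q' := Rep (W0 true) (W0 false).
have aQ' s i : arr Q' s i = W s i by case: s.
have QQ' : rep_iso Q Q'.
  exists (g (mix (coord_val P))), (fun j => invmx (g (mix (coord_val P)) j)); split=> [i|j le].
    have e s : g (mix (coord_val P)) i *m arr Q s i = arr Q' s i *m g (mix (coord_val P)) i.+1.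
      by rewrite aQ' /W /Phi2 mulmxKV ?eQ // uG.
    by split; [exact: (e true) | exact: (e false)].
  by rewrite mulVmx ?mulmxV ?uG.
apply: dQ; apply: decomposes_iso (rep_iso_sym QQ') _; apply: hf'.
  move=> i; have [r1 r2] := bQ i.
  have le s : (\rank (arr Q' s i) <= \rank (arr Q s i))%N.
    rewrite aQ' /W /Phi2 -eQ.
    by apply: leq_trans (mxrankM_maxl _ _) (mxrankM_maxr _ _).
  by split; [apply: leq_trans (le true) r1 | apply: leq_trans (le false) r2].
by rewrite -(evE Q' (mix (coord_val P))) //.
Qed.

End GaugeTransfer.

Section MoveLemmas.
Variable F : fieldType.

Lemma good_inj_iso k (X Y : obj F) : iso X Y -> good_inj k X -> good_inj k Y.
Proof.
move=> /iso_sym [g [f [hg fg gf]]] [L La]; exists (fun s => f k.+3 *m L s *m g k.+2).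
by rewrite -!mulmxA !hg -mulmxDr !(mulmxA (L _)) -mulmxDl La mul1mx fg.
Qed.

Lemma good_surj_iso k (X Y : obj F) : iso X Y -> good_surj k X -> good_surj k Y.
Proof.
move=> [f [g [hf gf fg]]] [R aR]; exists (fun s => f k.+3 *m R s *m g k.+2).
by rewrite !mulmxA -!hf -mulmxDl -!(mulmxA (f _)) -mulmxDr aR mulmx1 fg.
Qed.

Lemma ar_pad n beta (M : rep F n beta) s (k : nat) (kn : (k < n)%N) :
  ar (pad M) s k.+2 = sw _ _ (arr M s (Ordinal kn)).
Proof. by rewrite /= (tarr_lt _ _ kn). Qed.

Lemma good_surj_pad n beta (M : rep F n beta) (k : nat) (kn : (k < n)%N) :
  (beta k <= \rank (row_mx (arr M true (Ordinal kn)) (arr M false (Ordinal kn))))%N ->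
  good_surj k (pad M).
Proof.
move=> h; have : row_free (row_mx (arr M true (Ordinal kn)) (arr M false (Ordinal kn))).
  by rewrite /row_free eqn_leq rank_leq_row.
move=> /row_freeP [B]; rewrite -(vsubmxK B) mul_row_col => e.
exists (fun s => sw _ _ (colb B s)).
have eM s : ar (pad M) s k.+2 *m sw _ _ (colb B s) = sw _ _ (arr M s (Ordinal kn) *m colb B s).
  by rewrite (ar_pad _ _ kn) sw_mul //; apply: pdimE.
rewrite !eM /sw -mulmxDl -mulmxDr e mulmx1.
by apply: idmK; apply: pdimE; apply: ltnW.
Qed.

Lemma good_inj_pad n beta (M : rep F n beta) (k : nat) (kn : (k < n)%N) :
  (beta k.+1 <= \rank (col_mx (arr M true (Ordinal kn)) (arr M false (Ordinal kn))))%N ->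
  good_inj k (pad M).
Proof.
move=> h; have : row_full (col_mx (arr M true (Ordinal kn)) (arr M false (Ordinal kn))).
  by rewrite /row_full eqn_leq rank_leq_col.
move=> /row_fullP [B]; rewrite -(hsubmxK B) mul_row_col => e.
exists (fun s => sw _ _ (rowb B s)).
have eM s : sw _ _ (rowb B s) *m ar (pad M) s k.+2 = sw _ _ (rowb B s *m arr M s (Ordinal kn)).
  by rewrite (ar_pad _ _ kn) sw_mul //; apply: pdimE; apply: ltnW.
rewrite !eM /sw -mulmxDl -mulmxDr e mulmx1.
by apply: idmK; apply: pdimE.
Qed.

Lemma srg_fam_ext k z y d (W W' : bool -> forall j, 'M[F]_(d j, d j.+1)) q q' x x' p p' :
  (forall s j, W s j = W' s j) -> (forall s, q s = q' s) -> (forall s, x s = x' s) -> (forall s, p s = p' s) ->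
  forall s j, srg_fam (k := k) (z := z) (y := y) W q x p s j = srg_fam W' q' x' p' s j.
Proof. by move=> eW eq ex ep s j; rewrite /srg_fam eW eq ex ep. Qed.

Lemma pl_lt3 n (m : n.-tuple nat) j : (j < 3)%N -> pl m j = 0%N.
Proof. by case: j => [|[|[|j]]]. Qed.

End MoveLemmas.

(** * The cokernel move and its inverse on generic modules *)

Section Moves.
Variables (K : fieldType) (L : closedFieldType) (em : {rmorphism K -> L}).
Hypothesis charK0 : [pchar K] =i pred0.

Section Source.
Variables (n : nat) (m : n.-tuple nat).
Notation V := (nat * nat * nat + Defs.coord n (band_dim m))%type.

Definition parm (v : V -> L) (c : nat) p q : 'M[L]_(p, q) :=
  \matrix_(r, t) v (inl (c, r : nat, t : nat)).
Definition gfam (v : V -> L) s j : 'M[L]_(pdim n (band_dim m) j, pdim n (band_dim m) j.+1) :=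
  pfam (rawm (fun c => v (inr c))) s j.

Lemma rmx_parm Dom c p q : rmx em Dom (fun v => parm v c p q).
Proof. exact: (rmx_var em Dom (fun r t => inl (c, r : nat, t : nat))). Qed.

Lemma rmx_gfam Dom s j : rmx em Dom (fun v => gfam v s j).
Proof.
case: j => [|[|j]]; try exact: rmx_0.
apply: rmx_sw; case: (ltnP j n) => h; last first.
  by apply: (rmx_eq (F := fun=> 0)) => [|v _]; [apply: rmx_0 | rewrite tarr_out].
apply: (rmx_eq (F := fun v => rawm (fun c => v (inr c)) s (Ordinal h))); last first.
  by move=> v _; rewrite (tarr_lt _ _ h).
by move=> r t; apply: rfn_eq (rfn_pf _ (pf_var em (inr _))) _ => v _; rewrite mxE.
Qed.

Lemma gfam_pad v (M : rep L n (band_dim m)) : (forall c, v (inr c) = coord_val M c) ->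
  forall s j, gfam v s j = ar (pad M) s j.
Proof.
move=> e; apply: pfam_ext => s i; rewrite -rawm_coord.
by apply/matrixP => r t; rewrite !mxE e.
Qed.

Definition mkv (g : nat -> nat -> nat -> L) (M : rep L n (band_dim m)) (x : V) : L :=
  match x with inl (c, r, t) => g c r t | inr c => coord_val M c end.

Lemma rmx_srg k z y Dom (W : (V -> L) -> bool -> forall j, 'M[L]_(pdim n (band_dim m) j, pdim n (band_dim m) j.+1)) q x p :
  (forall s j, rmx em Dom (fun v => W v s j)) -> (forall s, rmx em Dom (fun v => q v s)) ->
  (forall s, rmx em Dom (fun v => x v s)) -> (forall s, rmx em Dom (fun v => p v s)) ->
  forall s j, rmx em Dom (fun v => srg_fam (k := k) (z := z) (y := y) (W v) (q v) (x v) (p v) s j).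
Proof.
move=> hW hq hx hp s j; rewrite /srg_fam; case: eqP => _; first exact: rmx_sw.
by case: eqP => _; [|case: eqP => _]; apply: rmx_sw.
Qed.

End Source.

Lemma rmx_colb V Dom p q (W : (V -> L) -> 'M[L]_(p + p, q)) s : rmx em Dom W -> rmx em Dom (fun v => colb (W v) s).
Proof. by case: s => h; [apply: rmx_usub | apply: rmx_dsub]. Qed.
Lemma rmx_rowb V Dom p q (W : (V -> L) -> 'M[L]_(q, p + p)) s : rmx em Dom W -> rmx em Dom (fun v => rowb (W v) s).
Proof. by case: s => h; [apply: rmx_lsub | apply: rmx_rsub]. Qed.

Section CokernelDown.
Variables (n k : nat) (m : n.-tuple nat).
Hypothesis kn : (k < n)%N.
Hypothesis le : (place m k.+2 <= place m k.+1)%N.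
Let m' := down_tuple k m.
Notation d := (pdim n (band_dim m)).
Notation d' := (pdim n (band_dim m')).
Notation V := (nat * nat * nat + Defs.coord n (band_dim m))%type.

Let pl'o j : j != k.+3 -> pl m' j = pl m j.
Proof. by move=> nj; rewrite pl_set // (negPf nj). Qed.
Let pl'3 : pl m' k.+3 = (pl m k.+3 + pl m k.+2 - pl m k.+4)%N.
Proof. by rewrite pl_set // eqxx !plE. Qed.
Let leq' : (pl m k.+4 <= pl m k.+3)%N. Proof. by rewrite !plE. Qed.

Let dz : (d k.+3 + d' k.+2 = d k.+2 + d k.+2)%N.
Proof. by rewrite !pdim_band pl'3 pl'o; lia. Qed.

Let srgE j : srg_dim k (d' k.+2) (d k.+2) d j = d' j.
Proof.
have [->|n2] := eqVneq j k.+2; first by rewrite srg_dim2.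
have [->|n3] := eqVneq j k.+3.
  by rewrite srg_dim3 !pdim_band pl'3 !pl'o; lia.
by rewrite srg_dimo // !pdim_band !pl'o //; lia.
Qed.

(** [G] completes the embedding [E] of X to a basis of Y + Y. The matrix [row_mx (E v) (G v)] is
    square only by a propositional equality of dimensions; multiplying by [H] makes [R0] literally
    square, and [W] is then the inverse of the completed matrix. *)
Let G v := @parm n m v 0 (d k.+2 + d k.+2) (d' k.+2).
Let H v := @parm n m v 1 (d k.+3 + d' k.+2) (d k.+2 + d k.+2).
Let E v := bcol (fun s => @gfam n m v s k.+2).
Let R0 v := H v *m row_mx (E v) (G v).
Let W v := invmx (R0 v) *m H v.
Let C v := rowb (dsubmx (W v)).
Let Dom (v : V -> L) := True /\ R0 v \in unitmx.
Let fam v := down_fam (k := k) (@gfam n m v) (C v) (colb (G v)).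
Let Phi v s (i : 'I_n) : 'M[L]_(band_dim m' i, band_dim m' i.+1) := sw _ _ (fam v s i.+2).

Let rE : rmx em (fun=> True) E.
Proof. by apply: rmx_col; apply: rmx_gfam. Qed.

Let rR0 T : rmx em T R0.
Proof.
apply: rmx_mul; first exact: rmx_parm.
by apply: rmx_row; [apply: rmx_col; apply: rmx_gfam | apply: rmx_parm].
Qed.

Let pDom : popen em Dom.
Proof. exact: popen_unit (popen_True em _) (rR0 _). Qed.

Let rPhi s i : rmx em Dom (fun v => Phi v s i).
Proof.
apply: rmx_sw; have rC t : rmx em Dom (fun v => C v t).
  apply: rmx_rowb; apply: rmx_dsub; apply: rmx_mul; last exact: rmx_parm.
  by apply: rmx_inv => [|v []]; first exact: rR0.
apply: rmx_srg => [t j|t|t|t].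
- exact: rmx_gfam.
- by apply: rmx_mul; [apply: rmx_gfam | apply: rmx_colb; apply: rmx_parm].
- exact: rC.
- by apply: rmx_mul; apply: rmx_gfam.
Qed.

Let point v (M : rep L n (band_dim m)) : band_component M ->
  (forall c, v (inr c) = coord_val M c) -> Dom v ->
  exists N : rep L n (band_dim m'), [/\ band_component N, forall s i, arr N s i = Phi v s i &
    exists2 Y, coker_rel k (pad M) Y & iso (pad N) Y].
Proof.
move=> bM vM [_ u]; have gE := gfam_pad vM.
have WE : W v *m row_mx (E v) (G v) = 1%:M by rewrite -mulmxA mulVmx.
have EE : E v = bcol (fun s => ar (pad M) s k.+2) by rewrite /E /bcol !gE.
have se : split_eqs (fun s => ar (pad M) s k.+2) (C v) (rowb (usubmx (W v))) (colb (G v)).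
  by apply: split_of_square => //; rewrite !browK bcolK vsubmxK -EE.
have [h0 r] := coker_down se.
have dX j : dm (Obj h0) j = pdim n (band_dim m') j by apply: srgE.
exists (unpad dX); split.
- apply/pad_oband; apply: iso_oband (iso_sym (pad_unpad dX)) _.
  by apply: (coker_oband_down r (proj1 (pad_oband M) bM)).
- move=> s i; rewrite arr_unpad /Phi; congr (sw _ _ _); apply: srg_fam_ext => *; rewrite ?gE //.
- by exists (Obj h0) => //; apply: pad_unpad.
Qed.

Lemma generic_down D : generic_decomposition em m' D ->
  generic_decomposition em m [seq up_tuple k c | c <- D].
Proof.
apply: (transfer charK0 pDom rPhi) => [v M bM vM Dv|N0 bN0 gN0].
  have [N [bN aN [Y r e]]] := point bM vM Dv; exists N; split=> //.
  move=> /decomp_odec dN; apply/decomp_odec; apply: coker_odec_up r _ => //.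
  exact: iso_odec dN.
(* In [m'] place k is at most place k.+1, since [le] bounds what was subtracted; so a module in
   general position is in the range of the move. *)
have gs : good_surj k (pad N0).
  have [_ h _] := gN0 (Ordinal kn); apply: (good_surj_pad (kn := kn)); apply: h.
  by have := pl'3; have := pl'o (j := k.+2) ltac:(lia); have := leq'; rewrite !plE /=; lia.
have [X r] := coker_exists_up gs.
have bX : oband (pl m) X.
  apply: (coker_oband_up r (proj1 (pad_oband N0) bN0)) => [j nj|]; first by rewrite pl'o.
  by rewrite pl'3 !pl'o; lia.
have [M [bM eM]] := band_unpad bX.
have [Li La] := good_inj_iso (iso_sym eM) (coker_inj r).
have [z [C0 [Rr se]]] := split_of_L (a := fun s => ar (pad M) s k.+2) La.
have [sq dsq] := split_square se.
have ez : z = d' k.+2 by move: dsq dz => /=; lia.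
subst z.
(* The section and the two projections of the splitting serve as parameters, which makes [R0 v] the
   identity. *)
pose v : V -> L := mkv (fun c => if c is 0 then ent (bcol Rr) else ent (col_mx (brow Li) (brow C0))) M.
have Dv : Dom v.
  split=> //; suff -> : R0 v = 1%:M by apply: unitmx1.
  have EE : E v = bcol (fun s => ar (pad M) s k.+2).
    by rewrite /E /bcol !(gfam_pad (v := v) (M := M)).
  by rewrite /R0 EE /G /H /parm /v /mkv !entK.
have [N [bN aN [Y rY eN]]] := point bM (v := v) (fun c => erefl) Dv.
exists v, M, N; split=> //; apply/rep_iso_pad/(iso_trans eN).
exact: coker_iso_down rY r eM.
Qed.

End CokernelDown.

Section CokernelUp.
Variables (n k : nat) (m : n.-tuple nat).
Hypothesis kn : (k < n)%N.
Hypothesis le : (place m k <= place m k.+1)%N.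
Let m' := up_tuple k m.
Notation d := (pdim n (band_dim m)).
Notation d' := (pdim n (band_dim m')).
Notation V := (nat * nat * nat + Defs.coord n (band_dim m))%type.

Let pl'o j : j != k.+3 -> pl m' j = pl m j.
Proof. by move=> nj; rewrite pl_set // (negPf nj). Qed.
Let pl'3 : pl m' k.+3 = (pl m k.+3 + pl m k.+4 - pl m k.+2)%N.
Proof. by rewrite pl_set // eqxx !plE. Qed.
Let leq' : (pl m k.+2 <= pl m k.+3)%N. Proof. by rewrite !plE. Qed.

Let dx : (d' k.+3 + d k.+2 = d k.+3 + d k.+3)%N.
Proof. by rewrite !pdim_band pl'3 pl'o; lia. Qed.

Let srgE j : srg_dim k (d k.+3) (d' k.+3) d j = d' j.
Proof.
have [->|n2] := eqVneq j k.+2.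
  by rewrite srg_dim2 !pdim_band pl'3 !pl'o; lia.
have [->|n3] := eqVneq j k.+3; first by rewrite srg_dim3.
by rewrite srg_dimo // !pdim_band !pl'o //; lia.
Qed.

Let G v := @parm n m v 0 (d' k.+3) (d k.+3 + d k.+3).
Let H v := @parm n m v 1 (d k.+3 + d k.+3) (d' k.+3 + d k.+2).
Let B v := brow (fun s => @gfam n m v (~~ s) k.+2).
Let R0 v := col_mx (G v) (B v) *m H v.
Let W v := H v *m invmx (R0 v).
Let a v := colb (lsubmx (W v)).
Let Dom (v : V -> L) := True /\ R0 v \in unitmx.
Let fam v := up_fam (k := k) (@gfam n m v) (a v) (rowb (G v)).
Let Phi v s (i : 'I_n) : 'M[L]_(band_dim m' i, band_dim m' i.+1) := sw _ _ (fam v s i.+2).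

Let rR0 T : rmx em T R0.
Proof.
apply: rmx_mul; last exact: rmx_parm.
by apply: rmx_col; [apply: rmx_parm | apply: rmx_row; apply: rmx_gfam].
Qed.

Let pDom : popen em Dom.
Proof. exact: popen_unit (popen_True em _) (rR0 _). Qed.

Let rPhi s i : rmx em Dom (fun v => Phi v s i).
Proof.
apply: rmx_sw; have ra t : rmx em Dom (fun v => a v t).
  apply: rmx_colb; apply: rmx_lsub; apply: rmx_mul; first exact: rmx_parm.
  by apply: rmx_inv => [|v []]; first exact: rR0.
apply: rmx_srg => [t j|t|t|t].
- exact: rmx_gfam.
- by apply: rmx_mul; apply: rmx_gfam.
- exact: ra.
- by apply: rmx_mul; [apply: rmx_rowb; apply: rmx_parm | apply: rmx_gfam].
Qed.

Let point v (M : rep L n (band_dim m)) : band_component M ->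
  (forall c, v (inr c) = coord_val M c) -> Dom v ->
  exists N : rep L n (band_dim m'), [/\ band_component N, forall s i, arr N s i = Phi v s i &
    exists2 Y, coker_rel k Y (pad M) & iso (pad N) Y].
Proof.
move=> bM vM [_ u]; have gE := gfam_pad vM.
have WE : col_mx (G v) (B v) *m W v = 1%:M by rewrite mulmxA mulmxV.
have BE : B v = brow (fun s => ar (pad M) (~~ s) k.+2) by rewrite /B /brow !gE.
have se : split_eqs (a v) (fun s => ar (pad M) (~~ s) k.+2) (rowb (G v)) (colb (rsubmx (W v))).
  by apply: split_of_square => //; rewrite !bcolK browK hsubmxK -BE.
have [h0 r] := @coker_up L k (pad M) _ (a v) _ _ se.
have dX j : dm (Obj h0) j = pdim n (band_dim m') j by apply: srgE.
exists (unpad dX); split.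
- apply/pad_oband; apply: iso_oband (iso_sym (pad_unpad dX)) _.
  by apply: (coker_oband_up r (proj1 (pad_oband M) bM)).
- move=> s i; rewrite arr_unpad /Phi; congr (sw _ _ _); apply: srg_fam_ext => *; rewrite ?gE //.
- by exists (Obj h0) => //; apply: pad_unpad.
Qed.

Lemma generic_up D : generic_decomposition em m' D ->
  generic_decomposition em m [seq down_tuple k c | c <- D].
Proof.
apply: (transfer charK0 pDom rPhi) => [v M bM vM Dv|N0 bN0 gN0].
  have [N [bN aN [Y r e]]] := point bM vM Dv; exists N; split=> //.
  move=> /decomp_odec dN; apply/decomp_odec; apply: coker_odec_down r _ => //.
  exact: iso_odec dN.
have gi : good_inj k (pad N0).
  have [_ _ h] := gN0 (Ordinal kn); apply: (good_inj_pad (kn := kn)); apply: h.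
  by have := pl'3; have := pl'o (j := k.+4) ltac:(lia); have := leq'; rewrite !plE /=; lia.
have [X r] := coker_exists_down gi.
have bX : oband (pl m) X.
  apply: (coker_oband_down r (proj1 (pad_oband N0) bN0)) => [j nj|]; first by rewrite pl'o.
  by rewrite pl'3 !pl'o; lia.
have [M [bM eM]] := band_unpad bX.
have [Rs aR] := good_surj_iso (iso_sym eM) (coker_surj r).
have aR' : ar (pad M) (~~ true) k.+2 *m Rs (~~ true) + ar (pad M) (~~ false) k.+2 *m Rs (~~ false) = 1%:M.
  by rewrite addrC.
have [x [a0 [Li se]]] := split_of_R (C := fun s => ar (pad M) (~~ s) k.+2) (R := fun s => Rs (~~ s)) aR'.
have [sq dsq] := split_square se.
have ex : x = d' k.+3 by move: dsq dx => /=; lia.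
subst x.
pose v : V -> L := mkv (fun c => if c is 0 then ent (brow Li) else ent (row_mx (bcol a0) (bcol (fun s => Rs (~~ s))))) M.
have Dv : Dom v.
  split=> //; suff -> : R0 v = 1%:M by apply: unitmx1.
  have BE : B v = brow (fun s => ar (pad M) (~~ s) k.+2).
    by rewrite /B /brow !(gfam_pad (v := v) (M := M)).
  by rewrite /R0 BE /G /H /parm /v /mkv !entK.
have [N [bN aN [Y rY eN]]] := point bM (v := v) (fun c => erefl) Dv.
exists v, M, N; split=> //; apply/rep_iso_pad/(iso_trans eN).
exact: coker_iso_up rY r eM.
Qed.

End CokernelUp.
End Moves.

(** * Deletion of a space on generic modules *)

Section DeletionGeneric.
Variables (K : fieldType) (L : closedFieldType) (em : {rmorphism K -> L}).
Hypothesis charK0 : [pchar K] =i pred0.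

Lemma place_del n (m : n.+1.-tuple nat) i p : (0 < i <= n)%N ->
  place (del_place m i) p = place m (if (p < i)%N then p else p.+1).
Proof.
move=> /andP [i0 iN]; rewrite /del_place (place_tuple n (fun j => place m (if (j.+1 < i)%N then j.+1 else j.+2))).
case: p => [|p]; first by rewrite i0.
case: ltnP => // h; rewrite ifF; last by lia.
by rewrite place_out.
Qed.

(** Dimensions determine places by induction from the bottom, where all places vanish. *)
Lemma odec_pl n (D : seq (n.-tuple nat)) (c : n.-tuple nat) (Y : obj L) :
  (forall j, dm Y j = (pl c j + pl c j.+1)%N) -> odec (@noP L) D Y ->
  forall j, (\sum_(x <- D) pl x j = pl c j)%N.
Proof.
move=> d dY; elim=> [|j IH]; first by rewrite big1 // => x _; rewrite pl_lt3.
by have := odec_dim j dY; rewrite d IH => /addnI.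
Qed.

Variables (n k : nat) (m : n.+1.-tuple nat).
Hypothesis kn : (k < n)%N.
Hypothesis eqm : place m k.+2 = place m k.+1.
Let m' := del_place m k.+1.
Notation d := (pdim n.+1 (band_dim m)).
Notation d' := (pdim n (band_dim m')).
Notation V := (nat * nat * nat + Defs.coord n.+1 (band_dim m))%type.

Let pl'lo j : (j <= k.+3)%N -> pl m' j = pl m j.
Proof.
case: j => [|[|j]]; try by rewrite !pl_lt3.
move=> h; rewrite !plE place_del //; case: ltnP => // h'.
by have -> : j = k.+1 by lia.
Qed.
Let pl'hi j : (k.+2 < j)%N -> pl m' j = pl m j.+1.
Proof. by case: j => [|[|j]] // h; rewrite !plE place_del // ifF //; lia. Qed.

Let delE j : del_dim k d j = d' j.
Proof.
rewrite !pdim_band; case: (leqP j k.+2) => h.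
  by rewrite del_dimlo // pdim_band !pl'lo // ltnW.
by rewrite del_dimhi // pdim_band !pl'hi // ltnW.
Qed.

(** [P] and [Q] are candidates for a section above and a retraction below F_{k+3}; invertibility of
    [T1] and [T2] then yields [good_surj] and [good_inj]. *)
Let P v := @parm L n.+1 m v 0 (d k.+4 + d k.+4) (d k.+3).
Let Q v := @parm L n.+1 m v 1 (d k.+3) (d k.+2 + d k.+2).
Let T1 v := brow (fun s => @gfam L n.+1 m v s k.+3) *m P v.
Let T2 v := Q v *m bcol (fun s => @gfam L n.+1 m v s k.+2).
Let Dom (v : V -> L) := (True /\ T1 v \in unitmx) /\ T2 v \in unitmx.
Let Phi (v : V -> L) s (i : 'I_n) : 'M[L]_(band_dim m' i, band_dim m' i.+1) :=
  sw _ _ (del_fam k (gfam v) s i.+2).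

Let pDom : popen em Dom.
Proof.
apply: popen_unit; first apply: popen_unit; first exact: popen_True.
  by apply: rmx_mul; [apply: rmx_row; apply: rmx_gfam | apply: rmx_parm].
by apply: rmx_mul; [apply: rmx_parm | apply: rmx_col; apply: rmx_gfam].
Qed.

Let rPhi s i : rmx em Dom (fun v => Phi v s i).
Proof.
suff h j : rmx em Dom (fun v => del_fam k (gfam v) s j) by apply: rmx_sw.
rewrite /del_fam; case: (j < k.+2)%N; first by apply: rmx_sw; apply: rmx_gfam.
case: (j == k.+2); apply: rmx_sw; last exact: rmx_gfam.
by apply: rmx_mul; apply: rmx_gfam.
Qed.

Lemma del_fam_ext (F : fieldType) d0 (W W' : bool -> forall j, 'M[F]_(d0 j, d0 j.+1)) :
  (forall s j, W s j = W' s j) -> forall s j, del_fam k W s j = del_fam k W' s j.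
Proof.
move=> e s j; rewrite /del_fam; case: ifP => _; first by rewrite (e s j).
by case: ifP => _; [rewrite (e s k.+2) (e (~~ s) k.+3) | rewrite (e (~~ s) j.+1)].
Qed.

Let point v (M : rep L n.+1 (band_dim m)) : band_component M ->
  (forall c, v (inr c) = coord_val M c) -> Dom v ->
  exists N : rep L n (band_dim m'), [/\ band_component N, forall s i, arr N s i = Phi v s i &
    exists2 Y, del_rel k (pad M) Y & iso (pad N) Y].
Proof.
move=> bM vM [[_ u1] u2]; have gE := gfam_pad vM.
have r : del_rel k (pad M) (odel k (pad M)).
  apply: del_exists_down; split.
    exists (rowb (invmx (T2 v) *m Q v)).
    have -> : ar (pad M) true k.+2 = gfam v true k.+2 by rewrite gE.
    have -> : ar (pad M) false k.+2 = gfam v false k.+2 by rewrite gE.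
    have := brow_bcol (rowb (invmx (T2 v) *m Q v)) (fun s => gfam v s k.+2).
    by rewrite browK -mulmxA mulVmx.
  exists (colb (P v *m invmx (T1 v))).
  have -> : ar (pad M) true k.+3 = gfam v true k.+3 by rewrite gE.
  have -> : ar (pad M) false k.+3 = gfam v false k.+3 by rewrite gE.
  have := brow_bcol (fun s => gfam v s k.+3) (colb (P v *m invmx (T1 v))).
  by rewrite bcolK mulmxA mulmxV.
have dX j : dm (odel k (pad M)) j = pdim n (band_dim m') j by apply: delE.
exists (unpad dX); split.
- apply/pad_oband; apply: iso_oband (iso_sym (pad_unpad dX)) _.
  have [_ rk] := (proj1 (pad_oband M) bM).
  split=> [j|s j]; first by rewrite dX pdim_band.
  have [e1 e2 e3 e4] := del_rank r s.
  case: (ltngtP j k.+2) => [lt|gt|->].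
  + by rewrite e3 // pl'lo // ltnW.
  + by rewrite e4 // pl'hi // ltnW.
  + by rewrite -e1 pl'lo.
- move=> s i; rewrite arr_unpad /Phi; congr (sw _ _ _); apply: del_fam_ext => *; rewrite ?gE //.
- by exists (odel k (pad M)) => //; apply: pad_unpad.
Qed.

Lemma generic_del D : generic_decomposition em m' D ->
  generic_decomposition em m [seq dup_place c k.+1 | c <- D].
Proof.
apply: (transfer charK0 pDom rPhi) => [v M bM vM Dv|N0 bN0 gN0].
  have [N [bN aN [Y r e]]] := point bM vM Dv; exists N; split=> //.
  move=> /decomp_odec dN; apply/decomp_odec.
  have bY := iso_oband e (proj1 (pad_oband N) bN).
  have dY := iso_odec e dN.
  (* The two ranks across the gap are at most the common place and add up to twice that place by
     [del_dimX], so both are exact. *)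
  apply: (del_odec kn r); apply: (odec_exact dY) => s; rewrite (odec_pl (proj1 bY) dY).
  have := del_dimX r; have := (proj2 bY) true k.+2; have := (proj2 bY) false k.+2.
  rewrite [dm (pad M) _]pdim_band -(pl'hi (ltnSn k.+2)) -(pl'lo (leqnn k.+3)).
  case: s; move: (\rank (ar Y true _)) (\rank (ar Y false _)) => a b; lia.
have [X r] := del_exists_up k (pad N0).
have bX : oband (pl m) X.
  apply: (del_oband r (proj1 (pad_oband N0) bN0)) => [s|j h|j h];
    [rewrite pl'lo // | by rewrite pl'lo | by rewrite pl'hi].
  have [h _ _] := gN0 (Ordinal kn).
  apply/eqP; rewrite eqn_leq; apply/andP; split.
    by have := (proj2 (proj1 (pad_oband N0) bN0)) s k.+2; rewrite pl'lo.
  rewrite (ar_pad _ _ kn) rank_sw; [|by apply: pdimE; apply: ltnW|by apply: pdimE].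
  have h1 : (pl m k.+3 <= place m' k.+1)%N by rewrite -pl'lo // plE.
  exact: leq_trans h1 (h s).
have [M [bM eM]] := band_unpad bX.
have [gi gs] := del_good r.
have [Li La] := good_inj_iso (iso_sym eM) gi.
have [Rs aR] := good_surj_iso (iso_sym eM) gs.
pose v : V -> L := mkv (fun c => if c is 0 then ent (bcol Rs) else ent (brow Li)) M.
have Dv : Dom v.
  have gE s j : gfam v s j = ar (pad M) s j by apply: gfam_pad.
  split; [split=> // | ].
    suff -> : T1 v = 1%:M by apply: unitmx1.
    by rewrite /T1 /P /parm /v /mkv !entK brow_bcol !gE.
  suff -> : T2 v = 1%:M by apply: unitmx1.
  by rewrite /T2 /Q /parm /v /mkv !entK brow_bcol !gE.
have [N [bN aN [Y rY eN]]] := point bM (v := v) (fun c => erefl) Dv.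
exists v, M, N; split=> //; apply/rep_iso_pad/(iso_trans eN).
exact: del_iso_down rY r eM.
Qed.

End DeletionGeneric.

(** * Splitting off Kronecker modules generically *)

Lemma osumC (F : fieldType) (X Y : obj F) : iso (osum X Y) (osum Y X).
Proof.
exists (fun j => block_mx 0 1%:M 1%:M 0), (fun j => block_mx 0 1%:M 1%:M 0).
split=> [s j|j|j] /=; rewrite !(block0E, mul1mx, mulmx1) //;
  by rewrite -scalar_mx_block.
Qed.

(** Both spaces on the way are spanned by the two arrows entering them, and the arrow with the
    repeated label contributes zero, so prolonging by alternating labels loses no rank. *)
Lemma rank_path (F : fieldType) k (X : obj F) s : good_surj k X -> good_surj k.+1 X ->
  (\rank (ar X s k.+1) <= \rank (ar X s k.+1 *m ar X (~~ s) k.+2 *m ar X s k.+3))%N.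
Proof.
move=> [R1 e1] [R2 e2].
have E1 : ar X s k.+1 = ar X s k.+1 *m ar X (~~ s) k.+2 *m R1 (~~ s).
  rewrite -[LHS]mulmx1 -e1 mulmxDr !mulmxA.
  by case: s; rewrite ar0 mul0mx ?add0r ?addr0.
have E2 : ar X (~~ s) k.+2 = ar X (~~ s) k.+2 *m ar X s k.+3 *m R2 s.
  rewrite -[LHS]mulmx1 -e2 mulmxDr !mulmxA.
  by case: s {E1}; rewrite ar0 mul0mx ?add0r ?addr0.
have E3 : ar X s k.+1 = ar X s k.+1 *m ar X (~~ s) k.+2 *m ar X s k.+3 *m (R2 s *m R1 (~~ s)).
  by rewrite {1}E1 {1}E2 !mulmxA.
by rewrite {1}E3 mxrankM_maxl.
Qed.

Section SplitSum.
Variables (F : fieldType) (k p r : nat) (X : obj F) (a : bool -> 'M[F]_r).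
Variables (d : nat -> nat) (W : bool -> forall j, 'M[F]_(d j, d j.+1)).
Variables (pr : forall j, 'M[F]_(dm X j, d j)) (inn : forall j, 'M[F]_(d j, dm X j)).
Variables (prK : forall j, 'M[F]_(dm (kron k a) j, d j)) (inK : forall j, 'M[F]_(d j, dm (kron k a) j)).
Hypothesis pr_hom : forall s j, pr j *m W s j = ar X s j *m pr j.+1.
Hypothesis in_hom : forall s j, inn j *m ar X s j = W s j *m inn j.+1.
Hypothesis prK_hom : forall s j, prK j *m W s j = ar (kron k a) s j *m prK j.+1.
Hypothesis pr_in : forall j, pr j *m inn j = 1%:M.
Hypothesis pr_inK : forall j, pr j *m inK j = 0.
Hypothesis prK_in : forall j, prK j *m inn j = 0.
Hypothesis prK_inK : forall j, prK j *m inK j = 1%:M.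
Variables (U0 : bool -> 'M[F]_(p, dm X k.+1)) (V0 : bool -> 'M[F]_(dm X k.+4, p)).
Hypothesis UV : forall s, U0 s *m (ar X s k.+1 *m ar X (~~ s) k.+2 *m ar X s k.+3) *m V0 s = 1%:M.

Variables (U : bool -> 'M[F]_(p, d k.+1)) (V : bool -> 'M[F]_(d k.+4, p)).
Variables (G2 : 'M[F]_(d k.+2, r)) (H2 : 'M[F]_(r, d k.+2)).
Variables (G3 : 'M[F]_(d k.+3, r)) (H3 : 'M[F]_(r, d k.+3)).
Hypothesis UE : forall s, U s = U0 s *m pr k.+1.
Hypothesis VE : forall s, V s = inn k.+4 *m V0 s.
Hypothesis G2E : G2 = inK k.+2 *m idm F _ r.
Hypothesis H2E : H2 = idm F r _ *m prK k.+2.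
Hypothesis G3E : G3 = inK k.+3 *m idm F _ r.
Hypothesis H3E : H3 = idm F r _ *m prK k.+3.

Let f2 := bsf2 W U V.
Let f3 := bsf3 W U V.
Let g2 := bsg2 W V.
Let g3 := bsg3 W V.

(** On a module already split as X plus a Kronecker module, with parameters read off from that
    splitting, the formulas return the given pair [a]. This provides the point showing that the
    domain of the construction is nonempty. *)
Lemma bs_sum : [/\ forall s, bsD W U V s = 1%:M,
  sumF f2 *m inK k.+2 = 0 /\ sumF f3 *m inK k.+3 = 0,
  H2 *m (cpl f2 g2 *m G2) = 1%:M, H3 *m (cpl f3 g3 *m G3) = 1%:M &
  forall s, bsK W U V G2 H2 G3 s = a s].
Proof.
have D1 s : bsD W U V s = 1%:M.
  rewrite /bsD UE VE -(UV s) -!mulmxA (mulmxA (pr k.+1)) pr_hom -!mulmxA.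
  rewrite (mulmxA (pr k.+2)) pr_hom -!mulmxA (mulmxA (pr k.+3)) pr_hom -!mulmxA.
  by rewrite (mulmxA (pr k.+4)) pr_in mul1mx.
have f2E s : f2 s = U0 s *m ar X s k.+1 *m pr k.+2.
  by rewrite /f2 /bsf2 D1 invmx1 mul1mx UE -mulmxA pr_hom mulmxA.
have f3E s : f3 s = U0 s *m ar X s k.+1 *m ar X (~~ s) k.+2 *m pr k.+3.
  rewrite /f3 /bsf3 D1 invmx1 mul1mx UE -(mulmxA _ (pr _)) pr_hom -!mulmxA.
  by rewrite pr_hom.
have g3E s : g3 s = inn k.+3 *m ar X s k.+3 *m V0 s by rewrite in_hom -mulmxA -VE.
have g2E s : g2 s = inn k.+2 *m ar X (~~ s) k.+2 *m (ar X s k.+3 *m V0 s).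
  by rewrite in_hom -mulmxA [inn _ *m _]mulmxA -g3E.
have F2 : sumF f2 *m inK k.+2 = 0.
  by rewrite mulmxDl !f2E -!mulmxA pr_inK !mulmx0 addr0.
have F3 : sumF f3 *m inK k.+3 = 0.
  by rewrite mulmxDl !f3E -!mulmxA pr_inK !mulmx0 addr0.
have S2 : prK k.+2 *m sumG g2 = 0.
  by rewrite mulmxDr !g2E !mulmxA prK_in !mul0mx addr0.
have C3 : cpl f3 g3 *m G3 = G3.
  by rewrite mulmxBl mul1mx G3E -!mulmxA (mulmxA (sumF _)) F3 mul0mx mulmx0 subr0.
have C2 : cpl f2 g2 *m G2 = G2.
  by rewrite mulmxBl mul1mx G2E -!mulmxA (mulmxA (sumF _)) F2 mul0mx mulmx0 subr0.
have E2 : H2 *m G2 = 1%:M.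
  by rewrite H2E G2E -mulmxA (mulmxA (prK _)) prK_inK mul1mx idmK // kron_dim2.
have E3 : H3 *m G3 = 1%:M.
  by rewrite H3E G3E -mulmxA (mulmxA (prK _)) prK_inK mul1mx idmK // kron_dim3.
split; rewrite ?C2 ?C3 //.
move=> s; rewrite /bsK -/f2 -/f3 -/g2 -/g3 C3 /cplr C2 E2 invmx1 mul1mx.
have HS : H2 *m sumG g2 = 0 by rewrite H2E -mulmxA S2 mulmx0.
rewrite mulmxBr mulmx1 (mulmxA H2) HS mul0mx subr0.
rewrite H2E G3E -(mulmxA _ (prK _)) prK_hom -!mulmxA (mulmxA (prK _)) prK_inK mul1mx.
rewrite kron_ar2 sw_idm ?kron_dim3 // mulmxA idmK ?mul1mx // kron_dim2 //.
Qed.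

End SplitSum.

Section KroneckerGeneric.
Variables (K : fieldType) (L : closedFieldType) (em : {rmorphism K -> L}).
Hypothesis charK0 : [pchar K] =i pred0.

Definition hankel r (A : 'M[L]_r) : 'M[L]_r := \matrix_(i < r, j < r) \tr (A ^+ (i + j)).

(** For a diagonal matrix the Hankel matrix is the Vandermonde matrix times its transpose. *)
Lemma hankel_diag_mx r (a : 'rV[L]_r) : injective (a 0) -> \det (hankel (diag_mx a)) != 0.
Proof.
move=> inj.
have e : hankel (diag_mx a) = Vandermonde r a *m (Vandermonde r a)^T.
  have dexp e : (diag_mx a) ^+ e = diag_mx (\row_j a 0 j ^+ e).
    elim: e => [|e IH].
      have -> : \row_j a 0 j ^+ 0 = const_mx 1 by apply/rowP => j; rewrite !mxE expr0.
      by rewrite diag_const_mx expr0.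
    by rewrite exprS IH [_ * _]mulmx_diag; congr diag_mx; apply/rowP => j; rewrite !mxE exprS.
  apply/matrixP => i j; rewrite !mxE dexp mxtrace_diag; apply: eq_bigr => l _.
  by rewrite !mxE exprD.
rewrite e det_mulmx det_tr mulf_neq0 // det_Vandermonde;
  apply/prodf_neq0 => i _; apply/prodf_neq0 => j ij; rewrite subr_eq0;
  by apply: contraTneq ij => /inj ->; rewrite ltnn.
Qed.

Variables (n k : nat) (m : n.-tuple nat).
Hypothesis kn : (k < n)%N.
Hypothesis eqm : place m k = place m k.+2.
Hypothesis ltm : (place m k < place m k.+1)%N.
Let p := place m k.
Let r := (place m k.+1 - place m k)%N.
Let m' := set_place m k.+1 (place m k.+2).
Notation d := (pdim n (band_dim m)).
Notation d' := (pdim n (band_dim m')).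
Notation V := (nat * nat * nat + Defs.coord n (band_dim m))%type.

Let pl'o j : j != k.+3 -> pl m' j = pl m j.
Proof. by move=> nj; rewrite pl_set // (negPf nj). Qed.
Let pl'3 : pl m' k.+3 = p.
Proof. by rewrite pl_set // eqxx -eqm. Qed.
Let pl2 : pl m k.+2 = p. Proof. by rewrite plE. Qed.
Let pl3 : pl m k.+3 = (p + r)%N. Proof. by rewrite plE /r subnKC // ltnW. Qed.
Let pl4 : pl m k.+4 = p. Proof. by rewrite plE -eqm. Qed.
Let d2 : d k.+2 = (p + p + r)%N. Proof. by rewrite pdim_band pl2 pl3 addnA. Qed.
Let d3 : d k.+3 = (p + p + r)%N. Proof. by rewrite pdim_band pl3 pl4 addnAC. Qed.

Let srgE j : srg_dim k (p + p) (p + p) d j = d' j.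
Proof.
have [->|n2] := eqVneq j k.+2; first by rewrite srg_dim2 pdim_band pl'3 pl'o ?pl2 //; lia.
have [->|n3] := eqVneq j k.+3; first by rewrite srg_dim3 pdim_band pl'3 pl'o ?pl4 //; lia.
by rewrite srg_dimo // !pdim_band !pl'o //; lia.
Qed.

(** Labels coerce to 0 and 1, so the eight auxiliary matrices occupy the parameter numbers 0 to
    7. *)
Let U (v : V -> L) (s : bool) := @parm L n m v s p (d k.+1).
Let T (v : V -> L) (s : bool) := @parm L n m v (s + 2) (d k.+4) p.
Let G2 v := @parm L n m v 4 (d k.+2) r.
Let H2 v := @parm L n m v 5 r (d k.+2).
Let G3 v := @parm L n m v 6 (d k.+3) r.
Let H3 v := @parm L n m v 7 r (d k.+3).
Let g v := @gfam L n m v.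
Let f2 v := bsf2 (g v) (U v) (T v).
Let f3 v := bsf3 (g v) (U v) (T v).
Let g2 v := bsg2 (g v) (T v).
Let g3 v := bsg3 (g v) (T v).
Let KK v := bsK (g v) (U v) (T v) (G2 v) (H2 v) (G3 v).
Let D0 (v : V -> L) := (True /\ bsD (g v) (U v) (T v) true \in unitmx)
  /\ bsD (g v) (U v) (T v) false \in unitmx.
Let D1 v := (D0 v /\ H2 v *m (cpl (f2 v) (g2 v) *m G2 v) \in unitmx)
  /\ H3 v *m (cpl (f3 v) (g3 v) *m G3 v) \in unitmx.
Let D2 v := D1 v /\ KK v false \in unitmx.
Let Dom v := D2 v /\ hankel (KK v true *m invmx (KK v false)) \in unitmx.
Let Phi v s (i : 'I_n) : 'M[L]_(band_dim m' i, band_dim m' i.+1) :=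
  sw _ _ (bs_fam (g v) (U v) (T v) s i.+2).

Let rg E s j : rmx em E (fun v => g v s j). Proof. exact: rmx_gfam. Qed.
Let rU E s : rmx em E (fun v => U v s). Proof. exact: rmx_parm. Qed.
Let rT E s : rmx em E (fun v => T v s). Proof. exact: rmx_parm. Qed.
Let rD E s : rmx em E (fun v => bsD (g v) (U v) (T v) s).
Proof. by do 4![apply: rmx_mul => //]. Qed.
Let rg3 E s : rmx em E (fun v => g3 v s). Proof. exact: rmx_mul. Qed.
Let rg2 E s : rmx em E (fun v => g2 v s).
Proof. by do 2![apply: rmx_mul => //]. Qed.

Let rinj E s : rmx em E (fun _ : V -> L => inj2 L p s).
Proof. by case: s; apply: rmx_col; first [apply: rmx_1 | apply: rmx_0]. Qed.
Let rprj E s : rmx em E (fun _ : V -> L => prj2 L p s).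
Proof. by case: s; apply: rmx_row; first [apply: rmx_1 | apply: rmx_0]. Qed.

Let pD0 : popen em D0.
Proof. by apply: popen_unit => //; apply: popen_unit => //; apply: popen_True. Qed.

Let D0u v : D0 v -> forall s, bsD (g v) (U v) (T v) s \in unitmx.
Proof. by move=> [[_ h1] h2] []. Qed.

Let rf3 (E : (V -> L) -> Prop) s : (forall v, E v -> D0 v) -> rmx em E (fun v => f3 v s).
Proof.
move=> h; apply: rmx_mul; first by apply: rmx_inv => // v /h /D0u.
by do 2![apply: rmx_mul => //].
Qed.
Let rf2 (E : (V -> L) -> Prop) s : (forall v, E v -> D0 v) -> rmx em E (fun v => f2 v s).
Proof.
move=> h; apply: rmx_mul; first by apply: rmx_inv => // v /h /D0u.
exact: rmx_mul.
Qed.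

Let rcpl (E : (V -> L) -> Prop) q (f : (V -> L) -> bool -> 'M[L]_(p, q)) (h : (V -> L) -> bool -> 'M[L]_(q, p)) :
  (forall s, rmx em E (fun v => f v s)) -> (forall s, rmx em E (fun v => h v s)) ->
  rmx em E (fun v => cpl (f v) (h v)).
Proof.
move=> rf rh; apply: rmx_sub; first exact: rmx_1.
by apply: rmx_mul; apply: rmx_add; apply: rmx_mul.
Qed.

Let r2 (E : (V -> L) -> Prop) : (forall v, E v -> D0 v) ->
  rmx em E (fun v => H2 v *m (cpl (f2 v) (g2 v) *m G2 v)).
Proof.
move=> h; apply: rmx_mul; first exact: rmx_parm.
apply: rmx_mul; last exact: rmx_parm.
by apply: rcpl => // s; apply: rf2.
Qed.

Let r3 (E : (V -> L) -> Prop) : (forall v, E v -> D0 v) ->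
  rmx em E (fun v => cpl (f3 v) (g3 v) *m G3 v).
Proof.
move=> h; apply: rmx_mul; last exact: rmx_parm.
by apply: rcpl => // s; apply: rf3.
Qed.

Let pD1 : popen em D1.
Proof.
apply: popen_unit; first by apply: popen_unit => //; apply: r2.
by apply: rmx_mul; [apply: rmx_parm | apply: r3 => v []].
Qed.

Let rK (E : (V -> L) -> Prop) s : (forall v, E v -> D1 v) -> rmx em E (fun v => KK v s).
Proof.
move=> h; have h0 v : E v -> D0 v by move=> /h [[]].
apply: rmx_mul; last exact: r3.
apply: rmx_mul; last exact: rg.
apply: rmx_mul; last by apply: (rcpl (f := f2) (h := g2)) => // t; apply: rf2.
apply: rmx_mul; last exact: rmx_parm.
by apply: rmx_inv; [apply: r2 | move=> v /h [[]]].
Qed.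

Let pDom : popen em Dom.
Proof.
have pD2 : popen em D2 by apply: popen_unit => //; apply: rK.
apply: popen_unit => // i j; apply: rfn_eq (_ : rfn em D2 (fun v => \tr ((KK v true *m invmx (KK v false)) ^+ (i + j)))) _.
  apply: rfn_tr; apply: rmx_exp; apply: rmx_mul; first by apply: rK => v [].
  by apply: rmx_inv; [apply: rK => v [] | move=> v []].
by move=> v _; rewrite mxE.
Qed.

Let rPhi s i : rmx em Dom (fun v => Phi v s i).
Proof.
apply: rmx_sw; apply: rmx_srg => [t j|t|t|t].
- exact: rg.
- apply: rmx_mul => //; apply: rmx_mul; [exact: rg | exact: rg2].
- exact: rmx_mul.
- apply: rmx_mul => //; apply: rmx_mul => //; apply: rf3.
  by move=> v [[[[]]]].
Qed.

Let point v (M : rep L n (band_dim m)) : band_component M ->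
  (forall c, v (inr c) = coord_val M c) -> D1 v ->
  exists N : rep L n (band_dim m'), [/\ band_component N, forall s i, arr N s i = Phi v s i &
    exists Y (Q : bool -> 'M[L]_r), [/\ iso (pad N) Y, forall s, Q s = KK v s,
      iso (pad M) (osum Y (kron k Q)) &
      exists (f : forall j, 'M_(dm Y j, dm (pad M) j)) g,
      [/\ @ohom _ (pad M) Y f, forall j, f j *m g j = 1%:M,
          exists c, f k.+2 = c *m sumF (f2 v) & exists c, f k.+3 = c *m sumF (f3 v)]]].
Proof.
move=> bM vM [[Dv u2] u3]; have gE := gfam_pad vM.
have [_ rk] := proj1 (pad_oband M) bM.
have f2E s : f2 v s = bsf2 (ar (pad M)) (U v) (T v) s by rewrite /f2 /bsf2 /bsD /g !gE.
have f3E s : f3 v s = bsf3 (ar (pad M)) (U v) (T v) s by rewrite /f3 /bsf3 /bsD /g !gE.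
have g2E s : g2 v s = bsg2 (ar (pad M)) (T v) s by rewrite /g2 /bsg2 /bsg3 /g !gE.
have g3E s : g3 v s = bsg3 (ar (pad M)) (T v) s by rewrite /g3 /bsg3 /g !gE.
have c2E : cpl (f2 v) (g2 v) = cpl (bsf2 (ar (pad M)) (U v) (T v)) (bsg2 (ar (pad M)) (T v)).
  by rewrite /cpl /sumF /sumG !f2E !g2E.
have c3E : cpl (f3 v) (g3 v) = cpl (bsf3 (ar (pad M)) (U v) (T v)) (bsg3 (ar (pad M)) (T v)).
  by rewrite /cpl /sumF /sumG !f3E !g3E.
have [|||||||h0 [eM [f [g' [hf fg e2 e3]]]]] := @band_split L k p r (pad M) (U v) (T v) (G2 v) (H2 v) (G3 v) (H3 v).
- by move=> s; have := D0u Dv s; rewrite /bsD /g !gE.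
- by rewrite -c2E.
- by rewrite -c3E.
- by move=> s; rewrite -pl2.
- by move=> s; rewrite -pl4.
- exact: d2.
- exact: d3.
have [Y [dX rY aY eM' [f1 [g1 [hf1 fg1 e21 e31]]]]] : exists Y, [/\ forall j, dm Y j = pdim n (band_dim m') j,
    forall s, (\rank (ar Y s k.+2) <= p)%N,
    forall s (i : 'I_n), sw (band_dim m' i) (band_dim m' i.+1) (ar Y s i.+2) = Phi v s i,
    iso (pad M) (osum Y (kron k (bsK (ar (pad M)) (U v) (T v) (G2 v) (H2 v) (G3 v)))) &
    exists (f : forall j, 'M_(dm Y j, dm (pad M) j)) g,
      [/\ @ohom _ (pad M) Y f, forall j, f j *m g j = 1%:M,
          exists c, f k.+2 = c *m sumF (f2 v) & exists c, f k.+3 = c *m sumF (f3 v)]].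
  exists (Obj h0); split.
  - by move=> j; apply: srgE.
  - move=> s; rewrite [ar _ s _]srg_fam2 rank_sw; [|exact: srg_dim2|exact: srg_dim3].
    by apply: leq_trans (mxrankM_maxl _ _) (rank_leq_col _).
  - move=> s i; rewrite /Phi; congr (sw _ _ _).
    apply: srg_fam_ext => [t j|t|t|t]; rewrite -?g2E -?f3E /g ?gE //.
  - exact: eM.
  - exists f, g'; split; [exact: hf | exact: fg | | ].
      by exists (idm L _ _); rewrite e2 /sumF !f2E.
    by exists (idm L _ _); rewrite e3 /sumF !f3E.
clear h0 eM f g' hf fg e2 e3.
exists (unpad dX); split.
- apply/pad_oband; apply: (iso_oband (iso_sym (pad_unpad dX))); split=> [j|s j].
    by rewrite dX pdim_band.
  have [->|nj] := eqVneq j k.+2; first by rewrite pl'3.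
  have le : (\rank (ar Y s j) <= \rank (ar (pad M) s j))%N.
    by rewrite (iso_rank eM' s j) rank_osum; apply: leq_addr.
  rewrite (pl'o (j := j.+1) nj); exact: leq_trans le (rk s j).
- by move=> s i; rewrite arr_unpad aY.
- exists Y, (bsK (ar (pad M)) (U v) (T v) (G2 v) (H2 v) (G3 v)); split.
  + exact: pad_unpad.
  + by move=> s; rewrite /KK /bsK /cplr -/(f2 v) -/(g2 v) -/(f3 v) -/(g3 v) c2E c3E /g !gE.
  + exact: eM'.
  + by exists f1, g1; split; [exact: hf1 | exact: fg1 | exact: e21 | exact: e31].
Qed.

Let lower v (M : rep L n (band_dim m)) D : band_component M ->
  (forall c, v (inr c) = coord_val M c) -> Dom v ->
  exists N : rep L n (band_dim m'), [/\ band_component N, forall s i, arr N s i = Phi v s i &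
    decomposes_as D N -> decomposes_as (nseq r (unit_place n k.+1) ++ D) M].
Proof.
move=> bM vM [[D1v uK] uH].
have [N [bN aN [Y [Q [eN QK eM _]]]]] := point bM vM D1v.
exists N; split=> // /decomp_odec dN; apply/decomp_odec.
pose A := Q true *m invmx (Q false).
have Au : Q false \in unitmx by rewrite QK.
have [P uP [a Pa]] : exists2 P, P \in unitmx & exists a, P *m A = diag_mx a *m P.
  apply: hankel_diagonal; move: uH; rewrite -!QK unitmxE unitfE; congr (_ != 0).
pose a' (s : bool) := if s then diag_mx a else 1%:M.
have dK : odec (@noP L) (nseq r (unit_place n k.+1)) (kron k a') by apply: (kron_odec (d := a)).
apply: odec_cat dK (iso_odec eN dN) _.
apply: (iso_trans eM); apply: (iso_trans (osumC _ _)); apply: osum_iso (iso_refl _).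
apply/iso_sym; set X := kron k Q.
have X2 : dm X k.+2 = r by apply: kron_dim2.
have X3 : dm X k.+3 = r by apply: kron_dim3.
(* The base change [invmx P] below and [invmx (Q false) *m invmx P] above carry the pair of
   [diag_mx a] and 1 to [Q]; for the first matrix this is the diagonalization of [A]. *)
apply: (@kron_iso _ _ _ _ X (idm L _ _ *m invmx P) (P *m idm L _ _)
  (idm L _ _ *m (invmx (Q false) *m invmx P)) (P *m Q false *m idm L _ _)).
- by rewrite mulmxA -(mulmxA P) idmK // mulmx1 mulmxV.
- by rewrite mulmxA mulmxKV // idmK.
- by rewrite !mulmxA -(mulmxA (P *m _)) idmK // mulmx1 mulmxK // mulmxV.
- by rewrite !mulmxA mulmxKV // mulmxKV // idmK.
- exact: kron_dimo.
move=> s; rewrite kron_ar2 mulmxA sw_idm // -!mulmxA; congr (_ *m _).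
case: s; last by rewrite /a' mulmx1 mulKVmx.
apply: (can_inj (mulKmx uP)); rewrite /a' mulKVmx //.
by rewrite mulmxA (mulmxA (P *m _)) -(mulmxA P) Pa mulmxK.
Qed.

Let lift (N0 : rep L n (band_dim m')) : band_component N0 -> gen N0 ->
  exists v (M : rep L n (band_dim m)) (N : rep L n (band_dim m')),
    [/\ band_component M, forall c, v (inr c) = coord_val M c, Dom v, forall s i, arr N s i = Phi v s i &
      rep_iso N N0].
Proof.
move=> bN0 gN0; set X := pad N0; have [dX rX] : oband (pl m') X by apply/pad_oband.
(* The eigenvalues 0, ..., r - 1 are distinct in characteristic 0, so the Hankel determinant does
   not vanish. *)
pose a : 'rV[L]_r := \row_i i%:R.
pose a0 (s : bool) := if s then diag_mx a else 1%:M.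
set X' := kron k a0.
have bM0 : oband (pl m) (osum X X').
  split=> [j|s j].
    rewrite -[LHS]/(dm X j + dm X' j)%N dX.
    have [->|n2] := eqVneq j k.+2; first by rewrite [dm X' _]kron_dim2 pl'3 pl'o ?pl2 ?pl3 ?addnA //; lia.
    have [->|n3] := eqVneq j k.+3; first by rewrite [dm X' _]kron_dim3 pl'3 pl'o ?pl4 ?pl3 //; lia.
    by rewrite [dm X' _]kron_dimo // addn0 !pl'o //; lia.
  rewrite rank_osum; have [->|n2] := eqVneq j k.+2.
    rewrite pl3 -pl'3 leq_add //.
    by apply: leq_trans (rank_leq_row _) _; rewrite kron_dim2.
  rewrite -pl'o // -[X in (_ <= X)%N]addn0 leq_add //.
  have [->|n3] := eqVneq j k.+3; last by apply: leq_trans (rank_leq_row _) _; rewrite kron_dimo.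
  by apply: leq_trans (rank_leq_col _) _; rewrite kron_dimo //; lia.
have [M [bM eM]] := band_unpad bM0.
have UV s : exists (U0 : 'M[L]_(p, dm X k.+1)) (V0 : 'M[L]_(dm X k.+4, p)),
    U0 *m (ar X s k.+1 *m ar X (~~ s) k.+2 *m ar X s k.+3) *m V0 = 1%:M.
  (* If p is positive, then so are the places k and k.+2, hence both neighbouring arrows exist in
     the quiver and the conditions of [gen] apply to them. *)
  have [p0|p_gt0] := posnP p; first by exists 0, 0; apply: mx0_eq; rewrite p0.
  apply: rank_minor; have [k0 kE] : exists k0, k = k0.+1.
    by exists k.-1; move: p_gt0; rewrite /p; case: k.
  have k1n : (k.+1 < n)%N.
    by rewrite ltnNge; apply/negP => h; move: p_gt0; rewrite /p eqm place_out.
  have pl'E j : place m' j = if j == k.+1 then p else place m j.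
    by rewrite -(plE m') ; case: eqP => [->|/eqP nj]; rewrite ?pl'3 // pl'o // plE.
  have pl'k : place m' k = p by rewrite pl'E ifF //; lia.
  have pl'k1 : place m' k.+1 = p by rewrite pl'E eqxx.
  have pl'k2 : place m' k.+2 = p by rewrite pl'E -eqm ifF //; lia.
  have gs1 : good_surj k X.
    have [_ h _] := gN0 (Ordinal kn); apply: (good_surj_pad (kn := kn)); apply: h.
    by rewrite /= pl'k pl'k1.
  have gs2 : good_surj k.+1 X.
    have [_ h _] := gN0 (Ordinal k1n); apply: (good_surj_pad (kn := k1n)); apply: h.
    by rewrite /= pl'k1 pl'k2.
  have h0 : (p <= \rank (ar X s k.+1))%N.
    have k0n : (k0 < n)%N by lia.
    have [h _ _] := gN0 (Ordinal k0n); rewrite kE (ar_pad _ _ k0n) rank_sw; last by apply: pdimE.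
      by apply: leq_trans (h s); rewrite /= -kE pl'k.
    by apply: pdimE; apply: ltnW.
  exact: leq_trans h0 (rank_path s gs1 gs2).
have [Ut [Vt UVt]] := UV true; have [Uf [Vf UVf]] := UV false.
pose U0 s := if s then Ut else Uf; pose V0 s := if s then Vt else Vf.
have [phi [psi [hphi psiphi phipsi]]] := eM.
have hpsi := ohom_inv hphi psiphi phipsi.
pose I1 j : 'M[L]_(dm X j + dm X' j, dm X j) := col_mx 1%:M 0.
pose I2 j : 'M[L]_(dm X j + dm X' j, dm X' j) := col_mx 0 1%:M.
pose P1 j : 'M[L]_(dm X j, dm X j + dm X' j) := row_mx 1%:M 0.
pose P2 j : 'M[L]_(dm X' j, dm X j + dm X' j) := row_mx 0 1%:M.
have hP1 s j : P1 j *m ar (osum X X') s j = ar X s j *m P1 j.+1.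
  by rewrite mul_row_block mul_mx_row !(mulmx0, mul0mx, mulmx1, mul1mx, addr0).
have hP2 s j : P2 j *m ar (osum X X') s j = ar X' s j *m P2 j.+1.
  by rewrite mul_row_block mul_mx_row !(mulmx0, mul0mx, mulmx1, mul1mx, add0r).
have hI1 s j : I1 j *m ar X s j = ar (osum X X') s j *m I1 j.+1.
  by rewrite mul_col_mx mul_block_col !(mulmx0, mul0mx, mulmx1, mul1mx, addr0).
pose pr j : 'M[L]_(dm X j, d j) := P1 j *m phi j.
pose inn j : 'M[L]_(d j, dm X j) := psi j *m I1 j.
pose prK j : 'M[L]_(dm X' j, d j) := P2 j *m phi j.
pose inK j : 'M[L]_(d j, dm X' j) := psi j *m I2 j.
have ph a1 b1 j (A : 'M[L]_(a1, _)) (B : 'M[L]_(_, b1)) : A *m phi j *m (psi j *m B) = A *m B.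
  by rewrite mulmxA -(mulmxA A) phipsi mulmx1.
pose v : V -> L := mkv (fun c => match c with
  | 0 => ent (U0 false *m pr k.+1) | 1 => ent (U0 true *m pr k.+1)
  | 2 => ent (inn k.+4 *m V0 false) | 3 => ent (inn k.+4 *m V0 true)
  | 4 => ent (inK k.+2 *m idm L _ r) | 5 => ent (idm L r _ *m prK k.+2)
  | 6 => ent (inK k.+3 *m idm L _ r) | _ => ent (idm L r _ *m prK k.+3) end) M.
have vM c : v (inr c) = coord_val M c by [].
have gE := gfam_pad vM.
have UE s : U v s = U0 s *m pr k.+1 by case: s; apply: entK.
have TE s : T v s = inn k.+4 *m V0 s by case: s; apply: entK.
have G2E : G2 v = inK k.+2 *m idm L _ r by apply: entK.
have H2E : H2 v = idm L r _ *m prK k.+2 by apply: entK.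
have G3E : G3 v = inK k.+3 *m idm L _ r by apply: entK.
have H3E : H3 v = idm L r _ *m prK k.+3 by apply: entK.
have [||||||||bD [F2 F3] u2 u3 kE] := @bs_sum L k p r X a0 d (g v) pr inn prK inK _ _ _ _ _ _ _ U0 V0
  _ (U v) (T v) (G2 v) (H2 v) (G3 v) (H3 v) UE TE G2E H2E G3E H3E.
- by move=> s j; rewrite /g gE /pr -mulmxA hphi mulmxA hP1 mulmxA.
- by move=> s j; rewrite /g gE /inn -mulmxA hI1 mulmxA hpsi mulmxA.
- by move=> s j; rewrite /g gE /prK -mulmxA hphi mulmxA hP2 mulmxA.
- by move=> j; rewrite ph mul_row_col mulmx1 mulmx0 addr0.
- by move=> j; rewrite ph mul_row_col mulmx0 mul0mx addr0.
- by move=> j; rewrite ph mul_row_col mulmx0 mul0mx addr0.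
- by move=> j; rewrite ph mul_row_col mulmx1 mul0mx add0r.
- by case.
have D1v : D1 v by split; [split; [do 2?split=> //; rewrite bD unitmx1 | rewrite u2 unitmx1] | rewrite u3 unitmx1].
have Dv : Dom v.
  have Kf : KK v false = 1%:M by apply: kE.
  have Kt : KK v true = diag_mx a by apply: kE.
  split; first by split=> //; rewrite Kf unitmx1.
  rewrite Kf Kt invmx1 mulmx1 unitmxE unitfE; apply: hankel_diag_mx => x y.
  rewrite !mxE => exy; apply/val_inj/eqP; rewrite eqn_leq.
  have le (i j : nat) : i%:R = j%:R :> L -> (i <= j)%N.
    move=> eij; rewrite leqNgt; apply/negP => lt.
    have : em (i - j)%:R = 0 by rewrite rmorph_nat natrB ?eij ?subrr // ltnW.
    move/eqP; rewrite fmorph_eq0 => /eqP e0.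
    have /pcharf0P/(_ (i - j)%N) := charK0; rewrite e0 eqxx subn_eq0 => /esym; lia.
  by rewrite !le.
have [N [bN aN [Y [Q [eN QK eM' [f [g' [hf fg [c2 e2] [c3 e3]]]]]]]]] := point bM vM D1v.
exists v, M, N; split=> //; apply/rep_iso_pad/(iso_trans eN)/iso_sym.
(* Applying the construction to the sum returns a retract [Y]; the projection onto it kills the
   Kronecker part, so it must be the module X that was put in. *)
apply: (@osum_cancel _ (pad M) X Y X' f g' psi phi hf fg) => [s j|j|j|j].
- exact: hpsi.
- exact: psiphi.
- have [->|n2] := eqVneq j k.+2; first by rewrite e2 -mulmxA F2 mulmx0.
  have [->|n3] := eqVneq j k.+3; first by rewrite e3 -mulmxA F3 mulmx0.
  by apply: mx0_eq; rewrite [dm X' j]kron_dimo // orbT.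
- by rewrite -(iso_dim eN).
Qed.

Lemma generic_kron D : generic_decomposition em m' D ->
  generic_decomposition em m (nseq r (unit_place n k.+1) ++ D).
Proof. by apply: (transfer charK0 pDom rPhi) => [v M bM vM Dv|N0 bN0 gN0]; [apply: lower | apply: lift]. Qed.

End KroneckerGeneric.

(** * Generic decompositions *)

Local Open Scope nat_scope.

Lemma eq_place n (m m' : n.-tuple nat) : (forall p, 0 < p <= n -> place m p = place m' p) -> m = m'.
Proof.
move=> e; apply: val_inj; apply: (@eq_from_nth _ 0); rewrite !size_tuple // => i lt.
exact: (e i.+1).
Qed.

Lemma place_unit n i p : 0 < p <= n -> place (unit_place n i) p = (p == i).
Proof.
rewrite /unit_place (place_tuple n (fun j => nat_of_bool (j.+1 == i))).
by case: p => // p /= ->.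
Qed.

Section Numerics.
Variables (K : fieldType) (L : closedFieldType) (em : {rmorphism K -> L}).
Hypothesis charK0 : [pchar K]%R =i pred0.

Lemma generic_zero n (m : n.-tuple nat) : (forall i, place m i = 0) ->
  generic_decomposition em m [::].
Proof.
move=> z; exists 1%R; split; last by move=> M _ _ j _; rewrite /band_dim !z.
have [E _] := ex_rep L m; exists E; split; last by rewrite /rep_eval rmorph1 oner_neq0.
have d0 i : band_dim m i = 0 by rewrite /band_dim !z.
by move=> i; split; apply: leq_trans (rank_leq_row _) _; rewrite d0.
Qed.

Lemma num_down n k (m : n.-tuple nat) r : k < n -> place m k.+2 <= place m k.+1 ->
  num_summands em (down_tuple k m) r -> num_summands em m r.
Proof. by move=> kn le [D gD <-]; exists [seq up_tuple k c | c <- D]; rewrite ?size_map //; apply: generic_down. Qed.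

Lemma num_up n k (m : n.-tuple nat) r : k < n -> place m k <= place m k.+1 ->
  num_summands em (up_tuple k m) r -> num_summands em m r.
Proof. by move=> kn le [D gD <-]; exists [seq down_tuple k c | c <- D]; rewrite ?size_map //; apply: generic_up. Qed.

Lemma num_del n k (m : n.+1.-tuple nat) r : k < n -> place m k.+2 = place m k.+1 ->
  num_summands em (del_place m k.+1) r -> num_summands em m r.
Proof. by move=> kn e [D gD <-]; exists [seq dup_place c k.+1 | c <- D]; rewrite ?size_map //; apply: generic_del. Qed.

Lemma num_kron n k (m : n.-tuple nat) r : k < n -> place m k = place m k.+2 -> place m k < place m k.+1 ->
  num_summands em (set_place m k.+1 (place m k.+2)) r -> num_summands em m (place m k.+1 - place m k + r).
Proof.
move=> kn e lt [D gD <-]; exists (nseq (place m k.+1 - place m k) (unit_place n k.+1) ++ D).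
  exact: generic_kron.
by rewrite size_cat size_nseq.
Qed.

(** The cokernel move adds place k minus place k.+2 to place k.+1 and its inverse adds the opposite;
    the sign of the difference decides which of them lowers the place. *)
Lemma generic_lower n k (m : n.-tuple nat) : k < n -> maxn (place m k) (place m k.+2) < place m k.+1 ->
  forall D', generic_decomposition em (set_place m k.+1 (place m k.+1 - `|place m k - place m k.+2|)) D' ->
  exists D, [/\ generic_decomposition em m D, size D = size D' &
    forall j p, j < size D -> p != k.+1 -> place (nth m D j) p = place (nth m D' j) p].
Proof.
move=> kn; rewrite gtn_max => /andP [lt0 lt2] D'.
have [le|gt] := leqP (place m k) (place m k.+2).
  have -> : place m k.+1 - `|place m k - place m k.+2| = place m k.+1 + place m k - place m k.+2 by lia.
  move=> gD; exists [seq up_tuple k c | c <- D']; split; rewrite ?size_map //.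
    exact: (generic_down charK0 kn (ltnW lt2) gD).
  by move=> j p lt np; rewrite (nth_map m) // place_set // (negPf np).
have -> : place m k.+1 - `|place m k - place m k.+2| = place m k.+1 + place m k.+2 - place m k by lia.
move=> gD; exists [seq down_tuple k c | c <- D']; split; rewrite ?size_map //.
  exact: (generic_up charK0 kn (ltnW lt0) gD).
by move=> j p lt np; rewrite (nth_map m) // place_set // (negPf np).
Qed.

Definition weight n (m : n.-tuple nat) := \sum_(j < n) place m j.+1.

Lemma weight_set n (m : n.-tuple nat) k v : k < n -> v < place m k.+1 -> weight (set_place m k.+1 v) < weight m.
Proof.
move=> kn lt; rewrite /weight (bigD1 (Ordinal kn)) //= [X in _ < X](bigD1 (Ordinal kn)) //=.
rewrite place_set // eqxx -addSn leq_add // leq_sum // => j nj.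
by rewrite place_set // ifF //; apply: contraNF nj => /eqP [e]; apply/eqP/val_inj.
Qed.

(** Induction on n and then on the weight, working at a maximal place: equality with a neighbour
    allows a deletion, and a strict maximum is lowered by splitting off Kronecker modules if its
    neighbours agree and by a cokernel move or its inverse otherwise. *)
Lemma generic_exists n (m : n.-tuple nat) : exists D, generic_decomposition em m D.
Proof.
elim: n m => [|n IHn] m.
  by exists [::]; apply: generic_zero => -[|i] //; rewrite place_out.
have [w] := ubnP (weight m); elim: w m => // w IHw m; rewrite ltnS => lew.
case: (@arg_maxnP _ (@ord0 n) xpredT (fun i : 'I_n.+1 => place m i.+1)) => // -[k kn] _ /= kmax.
have mx p : place m p <= place m k.+1.
  case: p => // p; have [h|h] := ltnP p n.+1; first exact: (kmax (Ordinal h)).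
  by rewrite place_out.
have [z|nz] := posnP (place m k.+1).
  by exists [::]; apply: generic_zero => i; have := mx i; rewrite z leqn0 => /eqP.
have [e|ne] := eqVneq (place m k.+2) (place m k.+1).
  have kn' : k < n by rewrite ltnNge; apply/negP => h; move: nz; rewrite -e place_out.
  have [D gD] := IHn (del_place m k.+1); exists [seq dup_place c k.+1 | c <- D].
  exact: generic_del.
have [e|ne'] := eqVneq (place m k.+1) (place m k).
  have [k' kE] : exists k', k = k'.+1 by exists k.-1; move: nz; rewrite e; case: (k).
  subst k; have [D gD] := IHn (del_place m k'.+1); exists [seq dup_place c k'.+1 | c <- D].
  exact: generic_del.
have lt0 : place m k < place m k.+1 by rewrite ltn_neqAle eq_sym ne' mx.
have lt2 : place m k.+2 < place m k.+1 by rewrite ltn_neqAle ne mx.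
have [e|nek] := eqVneq (place m k) (place m k.+2).
  have [|D gD] := IHw (set_place m k.+1 (place m k.+2)).
    exact: leq_trans (weight_set kn lt2) lew.
  by eexists; apply: (generic_kron charK0 kn e lt0 gD).
have [|D gD] := IHw (set_place m k.+1 (place m k.+1 - `|place m k - place m k.+2|)).
  by apply: leq_trans (weight_set kn _) lew; lia.
have [|D' [gD' _ _]] := generic_lower kn _ gD; first by rewrite gtn_max lt0.
by exists D'.
Qed.

(** The subtractive Euclidean algorithm: as the place outside the vector is zero, a cokernel move or
    its inverse subtracts the smaller place from the larger. It stops at a zero place or at two
    equal places. *)
Lemma generic_two n1 n2 d : coprime n1 n2 ->
  generic_decomposition em [tuple d * n1; d * n2] (nseq d [tuple n1; n2]).
Proof.
have [->|d0] := posnP d; first by move=> _; apply: generic_zero => -[|[|[|i]]] //; rewrite place_out.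
have [w] := ubnP (n1 + n2); elim: w n1 n2 => // w IH n1 n2 lew co.
(* A single nonzero place r is a generic pair of r by r matrices, which splits completely. *)
have zero p (m : p.-tuple nat) k r c : k < p -> (forall i, place m i = if i == k.+1 then r else 0) ->
    0 < r -> unit_place p k.+1 = c -> generic_decomposition em m (nseq r c).
  move=> kp mE r0 <-; have mk1 : place m k.+1 = r by rewrite mE eqxx.
  have mk : place m k = 0 by rewrite mE ifF //; lia.
  have mk2 : place m k.+2 = 0 by rewrite mE ifF //; lia.
  have gz : generic_decomposition em (set_place m k.+1 (place m k.+2)) [::].
    by apply: generic_zero => i; rewrite place_set // mk2 mE; case: eqP.
  have := generic_kron charK0 kp _ _ gz; rewrite cats0 mk mk1 mk2 subn0; exact.
have [lt|lt|e] := ltngtP n1 n2.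
- have [n10|n1p] := posnP n1.
    move: co lt; rewrite n10 /coprime gcd0n => /eqP -> _; rewrite muln0 muln1.
    by apply: (zero 2 _ 1) => // [[|[|[|i]]]|]; rewrite /place /= ?nth_nil //;
      by apply: eq_place => -[|[|[|i]]] // _; rewrite place_unit.
  have -> : nseq d [tuple n1; n2] = [seq down_tuple 1 c | c <- nseq d [tuple n1; n2 - n1]].
    rewrite map_nseq; congr nseq; apply: eq_place => -[|[|[|i]]] // _;
      by rewrite place_set // /place /= ?subn0 ?subnK // ltnW.
  apply: (generic_up charK0) => //; first by rewrite /place /= leq_mul2l ltnW ?orbT.
  have -> : up_tuple 1 [tuple d * n1; d * n2] = [tuple d * n1; d * (n2 - n1)].
    by apply: eq_place => -[|[|[|i]]] // _; rewrite place_set // /place /= ?addn0 ?mulnBr.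
  by apply: IH; [lia | rewrite /coprime -(gcdnDr n1 (n2 - n1)) subnK // ltnW].
- have [n20|n2p] := posnP n2.
    move: co lt; rewrite n20 /coprime gcdn0 => /eqP -> _; rewrite muln0 muln1.
    by apply: (zero 2 _ 0) => // [[|[|[|i]]]|]; rewrite /place /= ?nth_nil //;
      by apply: eq_place => -[|[|[|i]]] // _; rewrite place_unit.
  have -> : nseq d [tuple n1; n2] = [seq up_tuple 0 c | c <- nseq d [tuple n1 - n2; n2]].
    rewrite map_nseq; congr nseq; apply: eq_place => -[|[|[|i]]] // _;
      by rewrite place_set // /place /= ?subn0 ?subnK // ltnW.
  apply: (generic_down charK0) => //; first by rewrite /place /= leq_mul2l ltnW ?orbT.
  have -> : down_tuple 0 [tuple d * n1; d * n2] = [tuple d * (n1 - n2); d * n2].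
    by apply: eq_place => -[|[|[|i]]] // _; rewrite place_set // /place /= ?addn0 ?mulnBr.
  by apply: IH; [lia | rewrite /coprime gcdnC -(gcdnDr n2 (n1 - n2)) subnK 1?gcdnC // ltnW].
- move: co; rewrite e /coprime gcdnn => /eqP n21; rewrite n21 muln1.
  have -> : nseq d [tuple 1; 1] = [seq dup_place c 1 | c <- nseq d [tuple 1]].
    by rewrite map_nseq; congr nseq; apply: eq_place => -[|[|[|i]]] // _; rewrite place_dup.
  apply: (generic_del charK0 (k := 0)) => //.
  apply: (zero 1 _ 0) => // [|]; last by apply: eq_place => -[|[|i]] // _; rewrite place_unit.
  by case=> [|[|i]]; rewrite place_del // /place /= ?nth_nil.
Qed.

Lemma decomposes_as1 n (c : n.-tuple nat) beta (M : rep L n beta) :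
  decomposes_as [:: c] M -> indecomposable M.
Proof.
move/decomp_odec => /= [N [X' [_ i e z]]]; apply/indec_pad.
apply: (iso_oindec _ i); apply/iso_sym/(iso_trans e)/(iso_trans (osumC _ _)).
exact: osum0.
Qed.

Lemma num_two m1 m2 : num_summands em [tuple m1; m2] (gcdn m2 m1).
Proof.
set d := gcdn m2 m1.
have e1 : m1 = d * (m1 %/ d) by rewrite mulnC divnK // dvdn_gcdr.
have e2 : m2 = d * (m2 %/ d) by rewrite mulnC divnK // dvdn_gcdl.
have [d0|d_gt0] := posnP d.
  rewrite d0; exists [::] => //; apply: generic_zero => -[|[|[|i]]]; rewrite /place /= ?nth_nil //.
    by rewrite e1 d0.
  by rewrite e2 d0.
exists (nseq d [tuple m1 %/ d; m2 %/ d]); last exact: size_nseq.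
have := @generic_two (m1 %/ d) (m2 %/ d) d; rewrite -e1 -e2; apply.
rewrite /coprime gcdnC -(eqn_pmul2l d_gt0) muln1.
by rewrite muln_gcdr -e1 -e2.
Qed.

(** The third alternative accounts for the sign change when the absolute difference crosses zero. *)
Lemma gcd_shift b x y : x = y + b \/ y = x + b \/ x + y = b -> gcdn b x = gcdn b y.
Proof.
case=> [->|[->|<-]]; rewrite ?gcdnDr //.
by rewrite gcdnC gcdnDl [RHS]gcdnC gcdnDr gcdnC.
Qed.

(** Every reduction preserves the gcd. In the excluded case the module is a sum of two unrelated
    pairs of square matrices and has m1 + m3 summands, while the gcd would be their absolute
    difference. *)
Lemma num_three m1 m2 m3 : ~ (m2 = 0 /\ 0 < m3 /\ 0 < m1) ->
  num_summands em [tuple m1; m2; m3] (gcdn m2 `|m3 - m1|).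
Proof.
have [w] := ubnP (m1 + m2 + m3); elim: w m1 m2 m3 => // w IH a b c lew ex.
have del1 : b = a -> num_summands em [tuple a; b; c] (gcdn c b).
  move=> e; apply: (num_del (k := 0)) => //.
  have -> : del_place [tuple a; b; c] 1 = [tuple b; c]; last exact: num_two.
  by apply: eq_place => -[|[|[|i]]] // _; rewrite place_del.
have del2 : c = b -> num_summands em [tuple a; b; c] (gcdn b a).
  move=> e; apply: (num_del (k := 1)) => //.
  have -> : del_place [tuple a; b; c] 2 = [tuple a; b]; last exact: num_two.
  by apply: eq_place => -[|[|[|i]]] // _; rewrite place_del.
(* For b = 0 the exclusion leaves a = 0 or c = 0, so two adjacent zeros can be merged. *)
have [b0|b_gt0] := posnP b.
  have [a0|a_gt0] := posnP a.
    have -> : gcdn b `|c - a| = gcdn c b by rewrite a0 b0 subr0 gcd0n gcdn0.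
    by apply: del1; rewrite a0 b0.
  have c0 : c = 0 by case: (posnP c) => // c_gt0; case: ex.
  have -> : gcdn b `|c - a| = gcdn b a by rewrite c0; congr gcdn; lia.
  by apply: del2; rewrite c0 b0.
have [ab|ab|ab] := ltngtP a b; last first.
- by rewrite (gcd_shift (y := c)) 1?gcdnC; [apply: del1 | lia].
- apply: (num_down (k := 0)) => //; first exact: ltnW.
  have -> : down_tuple 0 [tuple a; b; c] = [tuple a - b; b; c].
    by apply: eq_place => -[|[|[|[|i]]]] // _; rewrite place_set // /place /= addn0.
  rewrite (gcd_shift (y := `|c - (a - b)%N|)); first by apply: IH; lia.
  lia.
have [cb|cb|cb] := ltngtP c b; last first.
- by rewrite (gcd_shift (y := a)); [apply: del2 | lia].
- apply: (num_up (k := 2)) => //; first exact: ltnW.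
  have -> : up_tuple 2 [tuple a; b; c] = [tuple a; b; c - b].
    by apply: eq_place => -[|[|[|[|i]]]] // _; rewrite place_set // /place /= addn0.
  rewrite (gcd_shift (y := `|(c - b)%N - a|)); first by apply: IH; lia.
  lia.
have [ac|ac|ac] := ltngtP a c.
- apply: (num_down (k := 1)) => //; first exact: ltnW.
  have -> : down_tuple 1 [tuple a; b; c] = [tuple a; b + a - c; c].
    by apply: eq_place => -[|[|[|[|i]]]] // _; rewrite place_set.
  rewrite gcdnC (gcd_shift (y := b + a - c)); last by lia.
  by rewrite gcdnC; apply: IH; lia.
- apply: (num_up (k := 1)) => //; first exact: ltnW.
  have -> : up_tuple 1 [tuple a; b; c] = [tuple a; b + c - a; c].
    by apply: eq_place => -[|[|[|[|i]]]] // _; rewrite place_set.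
  rewrite gcdnC (gcd_shift (y := b + c - a)); last by lia.
  by rewrite gcdnC; apply: IH; lia.
(* Here a = c < b: the Kronecker part gives b - a summands and the remaining vector with three equal
   places gives a, in total b, the gcd of b and 0. *)
have := @num_kron 3 1 [tuple a; b; c] a isT ac ab; rewrite {2 3}/place /=.
have -> : gcdn b `|c - a| = b - a + a by rewrite ac subrr gcdn0 subnK // ltnW.
apply; have -> : set_place [tuple a; b; c] 2 c = [tuple a; a; a].
  by apply: eq_place => -[|[|[|[|i]]]] // _; rewrite place_set //= /place /= ?ac.
have := IH a a a; rewrite subrr gcdn0; apply; lia.
Qed.

End Numerics.

Theorem theoremB (K : fieldType) (L : closedFieldType)
    (iota : {rmorphism K -> L})
    (charK0 : [pchar K]%R =i pred0)
    (algL : integralRange iota) :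
  (* existence of generic decompositions *)
  (forall (n : nat) (m : n.-tuple nat), 0 < n ->
     exists D : seq (n.-tuple nat), generic_decomposition iota m D) /\
  (* (a), for A(n.+1) and A(n) *)
  (forall (n : nat) (m : n.+1.-tuple nat) (i : nat),
     1 <= i <= n -> place m i.+1 = place m i ->
     forall D : seq (n.-tuple nat),
       generic_decomposition iota (del_place m i) D ->
       generic_decomposition iota m [seq dup_place c i | c <- D]) /\
  (* (b) *)
  (forall (n : nat) (m : n.-tuple nat) (i : nat),
     1 <= i <= n -> maxn (place m i.-1) (place m i.+1) < place m i ->
     forall D' : seq (n.-tuple nat),
       generic_decomposition iota
         (set_place m i (place m i - `|place m i.-1 - place m i.+1|)) D' ->
       exists D : seq (n.-tuple nat),
         [/\ generic_decomposition iota m D,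
             size D = size D' &
             forall k p : nat, k < size D -> p != i ->
               place (nth m D k) p = place (nth m D' k) p]) /\
  (* (c) *)
  (forall (n : nat) (m : n.-tuple nat) (i : nat),
     1 <= i <= n -> place m i.-1 = place m i.+1 ->
     place m i.-1 < place m i ->
     forall D : seq (n.-tuple nat),
       generic_decomposition iota (set_place m i (place m i.+1)) D ->
       generic_decomposition iota m
         (nseq (place m i - place m i.-1) (unit_place n i) ++ D)) /\
  (* (d) *)
  (forall m2 m1 n2 n1 d : nat,
     gcdn m2 m1 = d -> m2 = d * n2 -> m1 = d * n1 ->
     [/\ generic_decomposition iota [tuple m1; m2]
           (nseq d [tuple n1; n2]),
         0 < d -> schur_component iota [tuple n1; n2] &
         num_summands iota [tuple m1; m2] d]) /\
  (* (e) *)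
  (forall m3 m2 m1 : nat,
     ~ (m2 = 0 /\ 0 < m3 /\ 0 < m1) ->
     num_summands iota [tuple m1; m2; m3] (gcdn m2 `|m3 - m1|)).
Proof.
split; first by move=> n m _; apply: generic_exists.
split.
  by move=> n m [//|k] /= kn e D; apply: generic_del.
split.
  by move=> n m [//|k] /= kn lt D'; apply: generic_lower.
split.
  by move=> n m [//|k] /= kn e lt D; apply: generic_kron.
split; last by move=> *; apply: num_three.
move=> m2 m1 n2 n1 d dE e2 e1.
have co : 0 < d -> coprime n1 n2.
  by move=> d_gt0; rewrite /coprime gcdnC -(eqn_pmul2l d_gt0) muln1 muln_gcdr -e1 -e2 dE.
have gD : generic_decomposition iota [tuple m1; m2] (nseq d [tuple n1; n2]).
  (* For d = 0 nothing is known about [n1] and [n2], but the vector is zero and has the empty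
     decomposition. *)
  have [d0|d_gt0] := posnP d; last by rewrite e1 e2; exact: (@generic_two K L iota charK0 n1 n2 d (co d_gt0)).
  by rewrite d0; apply: generic_zero => -[|[|[|i]]]; rewrite /place /= ?nth_nil // ?e1 ?e2 d0.
split=> [//|d_gt0|]; last by exists (nseq d [tuple n1; n2]); rewrite ?size_nseq.
(* With multiplicity one the decomposition has a single summand, so the general module is
   indecomposable. *)
have := @generic_two K L iota charK0 n1 n2 1 (co d_gt0); rewrite !mul1n => -[f [ne hf]].
by exists f; split=> // M bM fM; apply: decomposes_as1 (hf M bM fM).
Qed.
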